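(* Let $T>0$ and let $a,a_1,a_2,a_3,f:[0,1]\times\mathbb{R}\to\mathbb{R}$ and $r_0,r_1:\mathbb{R}\to\mathbb{R}$ be $T$-periodic in $t$ with $a(x,t)>0$ for all $(x,t)$ and $\int_0^Ta(0,t)r_0(t)\,dt\neq0$. (i) Let $k\ge1$ be an integer and assume $a\in C_T^{k+1}$, $a_1,a_2,a_3,f\in C_T^k$, $r_0,r_1\in C_T^k(\mathbb{R})$, and that one of the following four conditions holds: (C1) $c_1^l(0,1,t)\,c_2^l(1,0,\tau_1(0,1,t))<1$ for all $t\in\mathbb{R}$ and $l=0,1,\dots,k$; (C2) $c_1^l(0,1,t)\,c_2^l(1,0,\tau_1(0,1,t))>1$ for all $t\in\mathbb{R}$ and $l=0,1,\dots,k$; (C3) $c_2^l(1,0,t)\,c_1^l(0,1,\tau_2(1,0,t))<1$ for all $t\in\mathbb{R}$ and $l=0,1,\dots,k$; (C4) $c_2^l(1,0,t)\,c_1^l(0,1,\tau_2(1,0,t))>1$ for all $t\in\mathbb{R}$ and $l=0,1,\dots,k$. Then every weak solution of problem (P) belongs to $C_T^{k+1}$. (ii) Assume that $a$ does not depend on $t$, that $a,a_1,a_2,a_3,f\in C_T^\infty$ and $r_0,r_1\in C_T^\infty(\mathbb{R})$, and that either $\int_0^1\big[(b_{11}/a)(\eta,\tau_1(\eta,1,t))+(b_{22}/a)(\eta,\tau_2(\eta,0,\tau_1(0,1,t)))\big]d\eta\neq0$ for all $t\in\mathbb{R}$, or $\int_0^1\big[(b_{22}/a)(\eta,\tau_2(\eta,0,t))+(b_{11}/a)(\eta,\tau_1(\eta,1,\tau_2(0,1,t)))\big]d\eta\neq0$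 for all $t\in\mathbb{R}$. Then every weak solution of problem (P) belongs to $C_T^\infty$.
   Context: For an integer $l\ge0$, $C_T^l$ is the Banach space of functions $u:[0,1]\times\mathbb{R}\to\mathbb{R}$, $T$-periodic in $t$ and $l$ times continuously differentiable, with the usual $C^l$ sup-norm; $C_T=C_T^0$; $C_T^\infty$ the $T$-periodic-in-$t$ infinitely differentiable functions; $\mathcal{C}=C_T\times C_T$; $C_T^l(\mathbb{R})$, $C_T^\infty(\mathbb{R})$ the analogous spaces of $T$-periodic functions $\mathbb{R}\to\mathbb{R}$. Problem (P): $\partial_t^2w-a^2(x,t)\partial_x^2w+a_1(x,t)\partial_tw+a_2(x,t)\partial_xw+a_3(x,t)w=f(x,t)$ for $x\in(0,1)$, $w(x,t)=w(x,t+T)$, $\partial_xw(0,t)=r_0(t)w(0,t)$, $\partial_xw(1,t)=r_1(t)w(1,t)$. Set $b_{11}=\frac{a_1}{2}+\frac{a_2}{2a}+\frac{a\partial_xa-\partial_ta}{2a}$, $b_{12}=\frac{a_1}{2}-\frac{a_2}{2a}+\frac{a\partial_xa-\partial_ta}{2a}$, $b_{21}=\frac{a_1}{2}+\frac{a_2}{2a}+\frac{a\partial_xa+\partial_ta}{2a}$, $b_{22}=\frac{a_1}{2}-\frac{a_2}{2a}-\frac{a\partial_xa+\partial_ta}{2a}$. For $j=1,2$ the characteristic $\xi\in[0,1]\mapsto\tau_j(\xi,x,t)$ solves $\partial_\xi\tau_j(\xi,x,t)=(-1)^j/a(\xi,\tau_j(\xi,x,t))$, $\tau_j(x,x,t)=t$.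 For integers $l\ge0$ let $c_j^l(\xi,x,t)=\exp\int_x^\xi(-1)^j\big(\frac{b_{jj}}{a}-l\frac{\partial_ta}{a^2}\big)(\eta,\tau_j(\eta,x,t))\,d\eta$, $c_j=c_j^0$, and $d_j(\xi,x,t)=(-1)^jc_j(\xi,x,t)/a(\xi,\tau_j(\xi,x,t))$. With $C=\int_0^Ta(0,t)r_0(t)dt$, for $u=(u_1,u_2)\in\mathcal{C}$: $[Iu](t)=\int_0^t\frac{u_1(0,s)+u_2(0,s)}{2}ds$, $[Ju](x,t)=\int_0^x\frac{u_1(\xi,t)-u_2(\xi,t)}{2a(\xi,t)}d\xi$, $Nu=\frac1C\int_0^T\big(\frac{u_1(0,t)-u_2(0,t)}{2}-a(0,t)r_0(t)[Iu](t)\big)dt$, $[Gu](t)=[Iu](t)+Nu$, $[Fu](x,t)=[Gu](t)+[Ju](x,t)$. $u\in\mathcal{C}$ is a weak solution of the first-order system if, with $\tau_j(\xi)=\tau_j(\xi,x,t)$: $u_1(x,t)=c_1(0,x,t)\big[u_2(0,\tau_1(0))+2a(0,\tau_1(0))r_0(\tau_1(0))[Gu](\tau_1(0))\big]-\int_0^xd_1(\xi,x,t)b_{12}(\xi,\tau_1(\xi))u_2(\xi,\tau_1(\xi))d\xi+\int_0^xd_1(\xi,x,t)\big(f-a_3\,Fu\big)(\xi,\tau_1(\xi))d\xi$, $u_2(x,t)=c_2(1,x,t)\big[u_1(1,\tau_2(1))-2a(1,\tau_2(1))r_1(\tau_2(1))[Fu](1,\tau_2(1))\big]-\int_1^xd_2(\xi,x,t)b_{21}(\xi,\tau_2(\xi))u_1(\xi,\tau_2(\xi))d\xi+\int_1^xd_2(\xi,x,t)\big(f-a_3\,Fu\big)(\xi,\tau_2(\xi))d\xi$.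 A weak solution of (P) is $w(x,t)=[Iu](t)+[Ju](x,t)+Nu$ for such $u$. *)

(* Defs.v *)
From Stdlib Require Import Reals ClassicalEpsilon.
From Coquelicot Require Import Coquelicot.
Open Scope R_scope.

Definition is_deriv01 (g : R -> R) (xi d : R) : Prop :=
  filterlim (fun h => (g (xi + h) - g xi) / h)
    (within (fun h => h <> 0 /\ 0 <= xi + h <= 1) (locally 0)) (locally d).

Definition is_pderiv_x (u : R -> R -> R) (x t d : R) : Prop :=
  is_deriv01 (fun y => u y t) x d.

Definition Dx (u : R -> R -> R) (x t : R) : R :=
  epsilon (inhabits 0) (fun d => is_pderiv_x u x t d).

Definition Dt (u : R -> R -> R) (x t : R) : R := Derive (fun s => u x s) t.

Definition cont01 (u : R -> R -> R) : Prop :=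
  forall x t, 0 <= x <= 1 ->
    filterlim (fun p : R * R => u (fst p) (snd p))
      (within (fun p : R * R => 0 <= fst p <= 1) (locally (x, t)))
      (locally (u x t)).

Definition periodic2 (T : R) (u : R -> R -> R) : Prop :=
  forall x t, 0 <= x <= 1 -> u x (t + T) = u x t.

Fixpoint Cl (l : nat) (u : R -> R -> R) : Prop :=
  match l with
  | O => cont01 u
  | S m => cont01 u /\
      (forall x t, 0 <= x <= 1 ->
         is_pderiv_x u x t (Dx u x t) /\ is_derive (fun s => u x s) t (Dt u x t)) /\
      Cl m (Dx u) /\ Cl m (Dt u)
  end.

Definition CT (l : nat) (T : R) (u : R -> R -> R) : Prop := periodic2 T u /\ Cl l u.
Definition CTinf (T : R) (u : R -> R -> R) : Prop := forall l, CT l T u.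

Fixpoint Cl1 (l : nat) (r : R -> R) : Prop :=
  match l with
  | O => forall t, continuous r t
  | S m => (forall t, continuous r t) /\ (forall t, ex_derive r t) /\ Cl1 m (Derive r)
  end.

Definition periodic1 (T : R) (r : R -> R) : Prop := forall t, r (t + T) = r t.
Definition CT1 (l : nat) (T : R) (r : R -> R) : Prop := periodic1 T r /\ Cl1 l r.
Definition CT1inf (T : R) (r : R -> R) : Prop := forall l, CT1 l T r.

Definition b11 (a a1 a2 : R -> R -> R) (x t : R) : R :=
  a1 x t / 2 + a2 x t / (2 * a x t) + (a x t * Dx a x t - Dt a x t) / (2 * a x t).
Definition b12 (a a1 a2 : R -> R -> R) (x t : R) : R :=
  a1 x t / 2 - a2 x t / (2 * a x t) + (a x t * Dx a x t - Dt a x t) / (2 * a x t).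
Definition b21 (a a1 a2 : R -> R -> R) (x t : R) : R :=
  a1 x t / 2 + a2 x t / (2 * a x t) + (a x t * Dx a x t + Dt a x t) / (2 * a x t).
Definition b22 (a a1 a2 : R -> R -> R) (x t : R) : R :=
  a1 x t / 2 - a2 x t / (2 * a x t) - (a x t * Dx a x t + Dt a x t) / (2 * a x t).

Definition is_char (a : R -> R -> R) (j : nat) (tau : R -> R -> R -> R) : Prop :=
  forall x t, 0 <= x <= 1 ->
    tau x x t = t /\
    forall xi, 0 <= xi <= 1 ->
      is_deriv01 (fun z => tau z x t) xi ((-1) ^ j / a xi (tau xi x t)).

Definition cjl (a bjj : R -> R -> R) (j l : nat) (tau : R -> R -> R -> R)
    (xi x t : R) : R :=
  exp (RInt (fun eta =>
         (-1) ^ j * (bjj eta (tau eta x t) / a eta (tau eta x t)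
                     - INR l * Dt a eta (tau eta x t) / (a eta (tau eta x t)) ^ 2))
        x xi).

Definition dj (a bjj : R -> R -> R) (j : nat) (tau : R -> R -> R -> R) (xi x t : R) : R :=
  (-1) ^ j * cjl a bjj j 0 tau xi x t / a xi (tau xi x t).

Definition Cconst (T : R) (a : R -> R -> R) (r0 : R -> R) : R :=
  RInt (fun t => a 0 t * r0 t) 0 T.

Definition Iop (u1 u2 : R -> R -> R) (t : R) : R :=
  RInt (fun s => (u1 0 s + u2 0 s) / 2) 0 t.

Definition Jop (a : R -> R -> R) (u1 u2 : R -> R -> R) (x t : R) : R :=
  RInt (fun xi => (u1 xi t - u2 xi t) / (2 * a xi t)) 0 x.

Definition Nop (T : R) (a : R -> R -> R) (r0 : R -> R) (u1 u2 : R -> R -> R) : R :=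
  / Cconst T a r0 *
  RInt (fun t => (u1 0 t - u2 0 t) / 2 - a 0 t * r0 t * Iop u1 u2 t) 0 T.

Definition Gop T a r0 u1 u2 (t : R) : R := Iop u1 u2 t + Nop T a r0 u1 u2.
Definition Fop T a r0 u1 u2 (x t : R) : R := Gop T a r0 u1 u2 t + Jop a u1 u2 x t.

Definition weak_sol_sys (T : R) (a a1 a2 a3 f : R -> R -> R) (r0 r1 : R -> R)
    (tau1 tau2 : R -> R -> R -> R) (u1 u2 : R -> R -> R) : Prop :=
  CT 0 T u1 /\ CT 0 T u2 /\
  let B11 := b11 a a1 a2 in let B12 := b12 a a1 a2 in
  let B21 := b21 a a1 a2 in let B22 := b22 a a1 a2 in
  let G := Gop T a r0 u1 u2 in let F := Fop T a r0 u1 u2 in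
  forall x t, 0 <= x <= 1 ->
    u1 x t =
      cjl a B11 1 0 tau1 0 x t *
        (u2 0 (tau1 0 x t) + 2 * a 0 (tau1 0 x t) * r0 (tau1 0 x t) * G (tau1 0 x t))
      - RInt (fun xi => dj a B11 1 tau1 xi x t * B12 xi (tau1 xi x t) * u2 xi (tau1 xi x t)) 0 x
      + RInt (fun xi => dj a B11 1 tau1 xi x t *
                (f xi (tau1 xi x t) - a3 xi (tau1 xi x t) * F xi (tau1 xi x t))) 0 x
    /\
    u2 x t =
      cjl a B22 2 0 tau2 1 x t *
        (u1 1 (tau2 1 x t) - 2 * a 1 (tau2 1 x t) * r1 (tau2 1 x t) * F 1 (tau2 1 x t))
      - RInt (fun xi => dj a B22 2 tau2 xi x t * B21 xi (tau2 xi x t) * u1 xi (tau2 xi x t)) 1 x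
      + RInt (fun xi => dj a B22 2 tau2 xi x t *
                (f xi (tau2 xi x t) - a3 xi (tau2 xi x t) * F xi (tau2 xi x t))) 1 x.

Definition wP (T : R) (a : R -> R -> R) (r0 : R -> R) (u1 u2 : R -> R -> R) (x t : R) : R :=
  Iop u1 u2 t + Jop a u1 u2 x t + Nop T a r0 u1 u2.

Definition weak_sol_P (T : R) (a a1 a2 a3 f : R -> R -> R) (r0 r1 : R -> R)
    (tau1 tau2 : R -> R -> R -> R) (w : R -> R -> R) : Prop :=
  exists u1 u2, weak_sol_sys T a a1 a2 a3 f r0 r1 tau1 tau2 u1 u2 /\
                w = wP T a r0 u1 u2.

(* Main.v *)
(** Along its characteristics [tau_j] each [u_j] solves a scalar linear equation, so
    the system reduces to a functional equation [z = kappa * (z o phi) + r] for a boundary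
    trace [z].  The remainder [r] is smoother than [u]: the coupling term integrates,
    along one family of characteristics, a function that is differentiable along the
    transversal family, and such an integral is continuously differentiable in [t].
    After [l] differentiations in [t] the factor of the functional equation becomes
    [c_1^l c_2^l]; when it is everywhere below 1, or everywhere above 1, the equation is
    a contraction for [z] or for its inverse form, so the [t]-derivative of [z] exists.
    The [t]-derivative of [u] solves a system of the same kind with [b_jj / a] shifted by
    [- d_t a / a^2], and induction yields all [t]-derivatives; the equations
    then give the [x]-derivatives. *)

Require Import Defs.
From Stdlib Require Import Reals Ranalysis5 Lra Lia ClassicalEpsilon.
From Coquelicot Require Import Coquelicot.
Open Scope R_scope.

(** The terms [G] and [F] are nonlocal, so the system does not have the plain form to which the
    functional equation applies. The way out is that [F], which is [w] itself, is always one class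
    smoother than [u]: its x-derivative is algebraic in [u], and its t-derivative, by a flux balance
    of the two transport equations, is again of the class of [u]. Hence the boundary terms and
    [a3 * F] can be frozen as known data of the next class, [u] climbs one class at a time, and [w]
    ends one class above [u].

    The conditions with [l = 0] and [l = 1] act together at each differentiation. The first makes
    the iterates of the functional equation converge to the given [z]; the second does the same for
    their derivatives, since differentiating [z (phi t)] brings out [phi'], and [c^1] is [c^0] times
    the t-derivative of the characteristic.

    At the start [u] is only known to be differentiable along its own characteristics; hence the
    equations are stated through directional derivatives, and integrated identities replace mixed
    derivatives. *)

Lemma continuous_Rplus {U : UniformSpace} (f g : U -> R) (p : U) :
  continuous f p -> continuous g p -> continuous (fun q => f q + g q) p.
Proof. exact (continuous_plus f g p). Qed.

Lemma continuous_Rmult {U : UniformSpace} (f g : U -> R) (p : U) :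
  continuous f p -> continuous g p -> continuous (fun q => f q * g q) p.
Proof. exact (continuous_mult f g p). Qed.

Lemma continuous_Ropp {U : UniformSpace} (f : U -> R) (p : U) :
  continuous f p -> continuous (fun q => - f q) p.
Proof. exact (continuous_opp f p). Qed.

Lemma continuous_Rminus {U : UniformSpace} (f g : U -> R) (p : U) :
  continuous f p -> continuous g p -> continuous (fun q => f q - g q) p.
Proof. exact (continuous_minus f g p). Qed.

Lemma continuous_Rinv_all {U : UniformSpace} (f : U -> R) (p : U) :
  (forall q, f q <> 0) -> continuous f p -> continuous (fun q => / f q) p.
Proof.
  intros Hn Hf. apply (continuous_comp f Rinv).
  - exact Hf.
  - apply continuous_Rinv. apply Hn.
Qed.

Lemma continuous_Rexp {U : UniformSpace} (f : U -> R) (p : U) :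
  continuous f p -> continuous (fun q => exp (f q)) p.
Proof.
  intros Hf. apply (continuous_comp f exp); [exact Hf|]. apply continuous_exp.
Qed.

Lemma continuous_pow2 {U : UniformSpace} (f : U -> R) (p : U) :
  continuous f p -> continuous (fun q => f q ^ 2) p.
Proof.
  intros Hf. simpl. apply continuous_Rmult; [exact Hf|].
  apply continuous_Rmult; [exact Hf|apply continuous_const].
Qed.

Lemma continuous_comp1 {U : UniformSpace} (h : R -> R) (f : U -> R) (p : U) :
  (forall t, continuous h t) -> continuous f p -> continuous (fun q => h (f q)) p.
Proof. intros Hh Hf. apply (continuous_comp f h); [exact Hf|apply Hh]. Qed.

(** * Joint continuity, proved by the shape of the expression *)

Definition G0 (u : R -> R -> R) : Prop :=
  forall p : R * R, continuous (fun q : R * R => u (fst q) (snd q)) p.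

Lemma continuous_G0 {U : UniformSpace} (u : R -> R -> R) (f g : U -> R) (p : U) :
  G0 u -> continuous f p -> continuous g p -> continuous (fun q => u (f q) (g q)) p.
Proof. intros Hu Hf Hg. apply continuous_comp_2; auto. Qed.

Lemma continuous_fst1 {U V : UniformSpace} (p : U * V) : continuous (fun q => fst q) p.
Proof. destruct p. apply continuous_fst. Qed.

Lemma continuous_snd1 {U V : UniformSpace} (p : U * V) : continuous (fun q => snd q) p.
Proof. destruct p. apply continuous_snd. Qed.

Lemma continuous_fst_comp {W U V : UniformSpace} (f : W -> U * V) (p : W) :
  continuous f p -> continuous (fun q => fst (f q)) p.
Proof. intros Hf. apply (continuous_comp f fst); [exact Hf|apply continuous_fst1]. Qed.

Lemma continuous_snd_comp {W U V : UniformSpace} (f : W -> U * V) (p : W) :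
  continuous f p -> continuous (fun q => snd (f q)) p.
Proof. intros Hf. apply (continuous_comp f snd); [exact Hf|apply continuous_snd1]. Qed.

Ltac cnt_step :=
  match goal with
  | H : ?A |- ?A => exact H
  | |- continuous (fun _ => ?c) _ => apply continuous_const
  | |- continuous (fun x => x) _ => apply continuous_id
  | |- continuous (fun x => fst (@?f x)) _ => apply (continuous_fst_comp f)
  | |- continuous (fun x => snd (@?f x)) _ => apply (continuous_snd_comp f)
  | |- continuous fst _ => apply continuous_fst1
  | |- continuous snd _ => apply continuous_snd1
  | H : forall t, continuous ?h t |- continuous ?h _ => apply H
  | H : G0 ?u |- continuous (fun x => ?u (@?f x) (@?g x)) _ =>
      apply (continuous_G0 u f g); [exact H| |]
  | H : forall t, continuous ?h t |- continuous (fun x => ?h (@?f x)) _ =>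
      apply (continuous_comp1 h f); [exact H|]
  | H : G0 ?u |- continuous (?u ?x) _ => apply (continuous_G0 u (fun _ => x) (fun s => s)); [exact H| |]
  | |- continuous (fun x => @?f x + @?g x) _ => apply (continuous_Rplus f g)
  | |- continuous (fun x => @?f x - @?g x) _ => apply (continuous_Rminus f g)
  | |- continuous (fun x => @?f x * @?g x) _ => apply (continuous_Rmult f g)
  | |- continuous (fun x => - @?f x) _ => apply (continuous_Ropp f)
  | |- continuous (fun x => exp (@?f x)) _ => apply (continuous_Rexp f)
  | |- continuous (fun x => (@?f x) ^ 2) _ => apply (continuous_pow2 f)
  end.
Ltac cnt := intros; repeat cnt_step.

(** * Derivatives relative to the interval [0,1] *)

Lemma is_derive_eps (f : R -> R) (x l : R) :
  is_derive f x l <->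
  forall eps, 0 < eps -> exists d, 0 < d /\
    forall y, Rabs (y - x) < d -> Rabs (f y - f x - l * (y - x)) <= eps * Rabs (y - x).
Proof.
  rewrite is_derive_Reals. split.
  - intros H eps Heps. destruct (H eps Heps) as [d Hd]. exists d.
    split; [apply cond_pos|]. intros y Hy.
    destruct (Req_dec y x) as [->|Hn].
    + replace (f x - f x - l * (x - x)) with 0 by ring.
      rewrite Rabs_R0. apply Rmult_le_pos; [lra|apply Rabs_pos].
    + assert (Hh : y - x <> 0) by lra.
      specialize (Hd (y - x) Hh Hy). replace (x + (y - x)) with y in Hd by ring.
      replace (f y - f x - l * (y - x)) with (((f y - f x) / (y - x) - l) * (y - x))
        by (field; exact Hh).
      rewrite Rabs_mult. apply Rmult_le_compat_r; [apply Rabs_pos|lra].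
  - intros H eps Heps. destruct (H (eps / 2)) as [d [Hd1 Hd2]]; [lra|].
    exists (mkposreal d Hd1). intros h Hh0 Hh. simpl in Hh.
    specialize (Hd2 (x + h)). replace (x + h - x) with h in Hd2 by ring.
    specialize (Hd2 Hh).
    assert (Ha : 0 < Rabs h) by (apply Rabs_pos_lt; exact Hh0).
    replace ((f (x + h) - f x) / h - l) with ((f (x + h) - f x - l * h) / h)
      by (field; exact Hh0).
    unfold Rdiv. rewrite Rabs_mult, Rabs_inv.
    apply Rmult_lt_reg_r with (Rabs h); [exact Ha|].
    rewrite Rmult_assoc, Rinv_l, Rmult_1_r; [|lra]. nra.
Qed.

Lemma deriv01_eps (g : R -> R) (x l : R) :
  is_deriv01 g x l <->
  forall eps, 0 < eps -> exists d, 0 < d /\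
    forall y, 0 <= y <= 1 -> Rabs (y - x) < d ->
      Rabs (g y - g x - l * (y - x)) <= eps * Rabs (y - x).
Proof.
  unfold is_deriv01. rewrite filterlim_locally. split.
  - intros H eps Heps. destruct (H (mkposreal eps Heps)) as [d Hd]. exists d.
    split; [apply cond_pos|]. intros y Hy01 Hy.
    destruct (Req_dec y x) as [->|Hn].
    + replace (g x - g x - l * (x - x)) with 0 by ring.
      rewrite Rabs_R0. apply Rmult_le_pos; [lra|apply Rabs_pos].
    + assert (Hh : y - x <> 0) by lra.
      assert (Hb : Rabs ((g y - g x) / (y - x) - l) < eps).
      { assert (Ey : x + (y - x) = y) by ring.
        specialize (Hd (y - x)). rewrite Ey in Hd.
        apply Hd; [|split; assumption].
        change (Rabs (y - x - 0) < d). rewrite Rminus_0_r. exact Hy. }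
      replace (g y - g x - l * (y - x)) with (((g y - g x) / (y - x) - l) * (y - x))
        by (field; exact Hh).
      rewrite Rabs_mult. apply Rmult_le_compat_r; [apply Rabs_pos|lra].
  - intros H eps. pose proof (cond_pos eps) as Heps.
    destruct (H (eps / 2)) as [d [Hd1 Hd2]]; [lra|].
    exists (mkposreal d Hd1). refine (fun h : R => _). intros Hh [Hh0 Hh01].
    change (Rabs (h - 0) < d) in Hh. rewrite Rminus_0_r in Hh.
    specialize (Hd2 (x + h) Hh01).
    replace (x + h - x) with h in Hd2 by ring.
    specialize (Hd2 Hh).
    assert (Ha : 0 < Rabs h) by (apply Rabs_pos_lt; exact Hh0).
    change (Rabs ((g (x + h) - g x) / h - l) < eps).
    replace ((g (x + h) - g x) / h - l) with ((g (x + h) - g x - l * h) / h)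
      by (field; exact Hh0).
    unfold Rdiv. rewrite Rabs_mult, Rabs_inv.
    apply Rmult_lt_reg_r with (Rabs h); [exact Ha|].
    rewrite Rmult_assoc, Rinv_l, Rmult_1_r; [|lra]. nra.
Qed.

Definition clamp (x : R) : R := Rmax 0 (Rmin 1 x).

Lemma clamp_01 (x : R) : 0 <= clamp x <= 1.
Proof.
  unfold clamp. split; [apply Rmax_l|]. apply Rmax_lub; [lra|apply Rmin_l].
Qed.

Lemma clamp_id (x : R) : 0 <= x <= 1 -> clamp x = x.
Proof.
  intros H. unfold clamp. rewrite Rmin_right by lra. apply Rmax_right. lra.
Qed.

Lemma clamp_k (x : R) : clamp (clamp x) = clamp x.
Proof. apply clamp_id, clamp_01. Qed.

Lemma clamp_0 : clamp 0 = 0.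
Proof. apply clamp_id; lra. Qed.

Lemma clamp_1 : clamp 1 = 1.
Proof. apply clamp_id; lra. Qed.

Lemma clamp_lip (x y : R) : Rabs (clamp x - clamp y) <= Rabs (x - y).
Proof.
  unfold clamp. apply Rabs_le. unfold Rabs, Rmax, Rmin.
  destruct (Rle_dec 1 x), (Rle_dec 1 y); repeat destruct Rle_dec;
    destruct (Rcase_abs (x - y)); lra.
Qed.

Lemma continuous_lip {U : UniformSpace} (f : U -> R) (p : U) (h : R -> R) :
  (forall x y, Rabs (h x - h y) <= Rabs (x - y)) ->
  continuous f p -> continuous (fun q => h (f q)) p.
Proof.
  intros Hl Hf. apply (continuous_comp f h); [exact Hf|].
  apply filterlim_locally. intros eps. exists eps. intros y Hy.
  eapply Rle_lt_trans; [apply Hl|exact Hy].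
Qed.

Lemma continuous_k {U : UniformSpace} (f : U -> R) (p : U) :
  continuous f p -> continuous (fun q => clamp (f q)) p.
Proof. apply continuous_lip, clamp_lip. Qed.

(* Functions on the strip are replaced by their composition with the clamp in [x], which
   makes continuity and [t]-derivatives statements about all of R^2; only [x]-derivatives
   remain relative to [0,1]. *)
Definition cl (u : R -> R -> R) (x t : R) : R := u (clamp x) t.

Lemma G0_cl (u : R -> R -> R) : G0 u -> G0 (cl u).
Proof.
  intros Hu p. unfold cl.
  apply (continuous_G0 u); [exact Hu|apply continuous_k; cnt|cnt].
Qed.

Lemma cont01_cl (u : R -> R -> R) : cont01 u <-> G0 (cl u).
Proof.
  split.
  - intros Hu [x t]. apply filterlim_locally. intros eps.
    specialize (Hu (clamp x) t (clamp_01 x)). rewrite filterlim_locally in Hu.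
    destruct (Hu eps) as [d Hd]. exists d. intros [y s] [Hy Hs]. simpl in *.
    unfold cl. apply (Hd (clamp y, s)); [|apply clamp_01].
    split; simpl; [|exact Hs]. eapply Rle_lt_trans; [apply clamp_lip|exact Hy].
  - intros Hu x t Hx. specialize (Hu (x, t)). simpl in Hu.
    apply filterlim_locally. intros eps.
    unfold continuous in Hu. rewrite filterlim_locally in Hu. destruct (Hu eps) as [d Hd].
    exists d. intros [y s] Hys Hy. simpl in Hy.
    specialize (Hd (y, s) Hys). simpl in Hd. unfold cl in Hd.
    rewrite !clamp_id in Hd by assumption. exact Hd.
Qed.

Lemma deriv01_ext (f g : R -> R) (x l : R) :
  0 <= x <= 1 -> (forall y, 0 <= y <= 1 -> f y = g y) ->
  is_deriv01 f x l -> is_deriv01 g x l.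
Proof.
  rewrite !deriv01_eps. intros Hx He H eps Heps.
  destruct (H eps Heps) as [d [Hd1 Hd2]]. exists d. split; [exact Hd1|].
  intros y Hy Hyd. rewrite <- !He by assumption. auto.
Qed.

Lemma deriv01_of_derive (f : R -> R) (x l : R) : is_derive f x l -> is_deriv01 f x l.
Proof.
  rewrite deriv01_eps, is_derive_eps. intros H eps Heps.
  destruct (H eps Heps) as [d [Hd1 Hd2]]. exists d. split; [exact Hd1|]. auto.
Qed.

(* Away from [0,1] the extension continues [g] linearly with slope [l]. *)
Lemma deriv01_extend (g : R -> R) (x l : R) :
  0 <= x <= 1 -> is_deriv01 g x l ->
  exists h : R -> R, is_derive h x l /\ forall y, 0 <= y <= 1 -> h y = g y.
Proof.
  intros Hx Hg. exists (fun y => g (clamp y) + l * (y - clamp y)). split.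
  - rewrite deriv01_eps in Hg. rewrite is_derive_eps. intros eps Heps.
    destruct (Hg eps Heps) as [d [Hd1 Hd2]]. exists d. split; [exact Hd1|].
    intros y Hy. rewrite (clamp_id x Hx).
    pose proof (clamp_lip y x) as Hk. rewrite (clamp_id x Hx) in Hk.
    replace (g (clamp y) + l * (y - clamp y) - (g x + l * (x - x)) - l * (y - x))
      with (g (clamp y) - g x - l * (clamp y - x)) by ring.
    eapply Rle_trans; [apply Hd2; [apply clamp_01|lra]|].
    apply Rmult_le_compat_l; lra.
  - intros y Hy. rewrite (clamp_id y Hy). ring.
Qed.

(** At 0 and 1 a zero slope survives the composition with the clamp, because the composite is
    constant beyond the endpoints. This brings derivatives relative to [0,1] within reach of the
    ordinary mean value theorem. *)
Lemma deriv01_k (g : R -> R) (x : R) :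
  0 <= x <= 1 -> is_deriv01 g x 0 -> is_derive (fun y => g (clamp y)) x 0.
Proof.
  intros Hx Hg. rewrite deriv01_eps in Hg. rewrite is_derive_eps. intros eps Heps.
  destruct (Hg eps Heps) as [d [Hd1 Hd2]]. exists d. split; [exact Hd1|].
  intros y Hy. rewrite (clamp_id x Hx).
  pose proof (clamp_lip y x) as Hk. rewrite (clamp_id x Hx) in Hk.
  specialize (Hd2 (clamp y) (clamp_01 y)). rewrite Rmult_0_l in *.
  eapply Rle_trans; [apply Hd2; lra|].
  apply Rmult_le_compat_l; lra.
Qed.

Lemma deriv01_unique (g : R -> R) (x l l' : R) :
  0 <= x <= 1 -> is_deriv01 g x l -> is_deriv01 g x l' -> l = l'.
Proof.
  rewrite !deriv01_eps. intros Hx H H'.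
  destruct (Req_dec l l') as [|Hn]; [assumption|exfalso].
  set (e := Rabs (l - l') / 3).
  assert (He : 0 < e) by (unfold e; assert (0 < Rabs (l - l')) by (apply Rabs_pos_lt; lra); lra).
  destruct (H e He) as [d [Hd1 Hd2]]. destruct (H' e He) as [d' [Hd1' Hd2']].
  assert (Hy : exists y, 0 <= y <= 1 /\ 0 < Rabs (y - x) /\ Rabs (y - x) < d /\ Rabs (y - x) < d').
  (* As [r <= 1/2], one of [x + r] and [x - r] stays in [0,1], depending on the half in which [x]
     lies. *)
  { set (r := Rmin (1/2) (Rmin (d/2) (d'/2))).
    assert (Hr : 0 < r /\ r <= 1/2 /\ r < d /\ r < d').
    { unfold r, Rmin. repeat destruct Rle_dec; lra. }
    destruct (Rle_dec x (1/2)).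
    - exists (x + r). replace (x + r - x) with r by ring. rewrite Rabs_pos_eq; lra.
    - exists (x - r). replace (x - r - x) with (- r) by ring.
      rewrite Rabs_Ropp, Rabs_pos_eq; lra. }
  destruct Hy as [y (Hy & Hy0 & Hyd & Hyd')].
  specialize (Hd2 y Hy Hyd). specialize (Hd2' y Hy Hyd').
  assert (Hs : Rabs ((l - l') * (y - x)) <= 2 * e * Rabs (y - x)).
  { replace ((l - l') * (y - x)) with
      ((g y - g x - l' * (y - x)) - (g y - g x - l * (y - x))) by ring.
    eapply Rle_trans; [apply Rabs_triang|]. rewrite Rabs_Ropp. lra. }
  rewrite Rabs_mult in Hs. unfold e in Hs. unfold e in He. nra.
Qed.

Lemma deriv01_const (c x : R) : is_deriv01 (fun _ => c) x 0.
Proof. apply deriv01_of_derive. apply (is_derive_const c x). Qed.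

Lemma deriv01_plus (f g : R -> R) (x l l' : R) :
  0 <= x <= 1 -> is_deriv01 f x l -> is_deriv01 g x l' ->
  is_deriv01 (fun y => f y + g y) x (l + l').
Proof.
  intros Hx Hf Hg.
  destruct (deriv01_extend f x l Hx Hf) as [F [HF EF]].
  destruct (deriv01_extend g x l' Hx Hg) as [G [HG EG]].
  apply (deriv01_ext (fun y => F y + G y)); [exact Hx| |].
  - intros y Hy. rewrite EF, EG by assumption. reflexivity.
  - apply deriv01_of_derive. exact (is_derive_plus F G x l l' HF HG).
Qed.

Lemma deriv01_comp (h : R -> R) (g : R -> R) (x l d : R) :
  0 <= x <= 1 -> is_deriv01 g x l -> is_derive h (g x) d ->
  is_deriv01 (fun y => h (g y)) x (l * d).
Proof.
  intros Hx Hg Hh.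
  destruct (deriv01_extend g x l Hx Hg) as [G [HG EG]].
  apply (deriv01_ext (fun y => h (G y))); [exact Hx| |].
  - intros y Hy. rewrite EG by assumption. reflexivity.
  - apply deriv01_of_derive. rewrite <- (EG x Hx) in Hh.
    exact (is_derive_comp h G x d l Hh HG).
Qed.

Lemma deriv01_eq (g : R -> R) (x l l' : R) : l = l' -> is_deriv01 g x l -> is_deriv01 g x l'.
Proof. intros ->. auto. Qed.

Lemma deriv01_scal (c : R) (g : R -> R) (x l : R) :
  0 <= x <= 1 -> is_deriv01 g x l -> is_deriv01 (fun y => c * g y) x (c * l).
Proof.
  intros Hx Hg. apply (deriv01_eq _ _ (l * c)); [ring|].
  apply (deriv01_comp (fun z => c * z)); [exact Hx|exact Hg|].
  auto_derive; [trivial|ring].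
Qed.

Lemma deriv01_minus (f g : R -> R) (x l l' : R) :
  0 <= x <= 1 -> is_deriv01 f x l -> is_deriv01 g x l' ->
  is_deriv01 (fun y => f y - g y) x (l - l').
Proof.
  intros Hx Hf Hg.
  apply (deriv01_ext (fun y => f y + (-1) * g y)); [exact Hx|intros; ring|].
  apply (deriv01_eq _ _ (l + (-1) * l')); [ring|].
  apply deriv01_plus; [exact Hx|exact Hf|]. apply deriv01_scal; assumption.
Qed.

Lemma is_derive_Rmult (f g : R -> R) (x l l' : R) :
  is_derive f x l -> is_derive g x l' ->
  is_derive (fun y => f y * g y) x (l * g x + f x * l').
Proof. intros Hf Hg. exact (is_derive_mult f g x l l' Hf Hg Rmult_comm). Qed.

Lemma deriv01_mult (f g : R -> R) (x l l' : R) :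
  0 <= x <= 1 -> is_deriv01 f x l -> is_deriv01 g x l' ->
  is_deriv01 (fun y => f y * g y) x (l * g x + f x * l').
Proof.
  intros Hx Hf Hg.
  destruct (deriv01_extend f x l Hx Hf) as [F [HF EF]].
  destruct (deriv01_extend g x l' Hx Hg) as [G [HG EG]].
  apply (deriv01_ext (fun y => F y * G y)); [exact Hx| |].
  - intros y Hy. rewrite EF, EG by assumption. reflexivity.
  - apply deriv01_of_derive. rewrite <- EF, <- EG by assumption.
    apply is_derive_Rmult; assumption.
Qed.

Lemma deriv01_exp (g : R -> R) (x l : R) :
  0 <= x <= 1 -> is_deriv01 g x l -> is_deriv01 (fun y => exp (g y)) x (l * exp (g x)).
Proof.
  intros Hx Hg. apply (deriv01_comp exp); [exact Hx|exact Hg|]. apply is_derive_exp.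
Qed.

Lemma deriv01_inv (g : R -> R) (x l : R) :
  0 <= x <= 1 -> g x <> 0 -> is_deriv01 g x l ->
  is_deriv01 (fun y => / g y) x (- l / g x ^ 2).
Proof.
  intros Hx Hn Hg. apply (deriv01_eq _ _ (l * (- 1 / g x ^ 2))); [unfold Rdiv; ring|].
  apply (deriv01_comp Rinv); [exact Hx|exact Hg|].
  apply (is_derive_inv (fun y => y)); [|exact Hn]. apply (is_derive_id (g x)).
Qed.

Lemma deriv01_continuous_at (g : R -> R) (x l : R) :
  0 <= x <= 1 -> is_deriv01 g x l -> continuous (fun y => g (clamp y)) x.
Proof.
  intros Hx Hg.
  destruct (deriv01_extend g x l Hx Hg) as [G [HG EG]].
  apply continuous_ext with (fun y => G (clamp y)).
  - intros y. apply EG, clamp_01.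
  - apply (continuous_comp clamp G).
    + apply (continuous_k (fun y => y)). apply continuous_id.
    + rewrite (clamp_id x Hx). apply (ex_derive_continuous G). exists l. exact HG.
Qed.

Lemma deriv01_continuous (g g' : R -> R) :
  (forall x, 0 <= x <= 1 -> is_deriv01 g x (g' x)) ->
  forall x, continuous (fun y => g (clamp y)) x.
Proof.
  intros Hg x.
  apply continuous_ext with (fun y => (fun z => g (clamp z)) (clamp y)).
  - intros y. simpl. rewrite clamp_k. reflexivity.
  - apply (continuous_comp clamp (fun z => g (clamp z))).
    + apply (continuous_k (fun y => y)). apply continuous_id.
    + apply (deriv01_continuous_at g (clamp x) (g' (clamp x))); [apply clamp_01|apply Hg, clamp_01].
Qed.

Lemma deriv01_zero (g : R -> R) :
  (forall x, 0 <= x <= 1 -> is_deriv01 g x 0) ->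
  forall x y, 0 <= x <= 1 -> 0 <= y <= 1 -> g x = g y.
Proof.
  intros Hg.
  assert (Hlt : forall x y, 0 <= x <= 1 -> 0 <= y <= 1 -> x < y -> g x = g y).
  { intros x y Hx Hy Hxy.
    rewrite <- (clamp_id x Hx), <- (clamp_id y Hy).
    apply (eq_is_derive (fun z => g (clamp z)) x y); [|exact Hxy].
    intros z Hz. apply deriv01_k; [lra|]. apply Hg. lra. }
  intros x y Hx Hy. destruct (Rtotal_order x y) as [H|[->|H]].
  - auto.
  - reflexivity.
  - symmetry. auto.
Qed.

Lemma ex_RInt_cont (f : R -> R) (a b : R) : (forall x, continuous f x) -> ex_RInt f a b.
Proof. intros Hf. apply (ex_RInt_continuous f a b). auto. Qed.

Lemma is_derive_RInt_cont (f : R -> R) (a x : R) :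
  (forall x, continuous f x) -> is_derive (fun b => RInt f a b) x (f x).
Proof.
  intros Hf. apply (is_derive_RInt f (fun b => RInt f a b) a x); [|apply Hf].
  apply filter_forall. intros b. apply (RInt_correct f a b). apply ex_RInt_cont, Hf.
Qed.

Lemma deriv01_FTC (g g' : R -> R) :
  (forall x, continuous g' x) ->
  (forall x, 0 <= x <= 1 -> is_deriv01 g x (g' x)) ->
  forall x y, 0 <= x <= 1 -> 0 <= y <= 1 -> g y - g x = RInt g' x y.
Proof.
  intros Hc Hg x y Hx Hy.
  assert (E := deriv01_zero (fun z => g z - RInt g' x z)).
  assert (H : forall z, 0 <= z <= 1 -> is_deriv01 (fun z => g z - RInt g' x z) z 0).
  { intros z Hz. apply (deriv01_eq _ _ (g' z - g' z)); [ring|].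
    apply deriv01_minus; [exact Hz|apply Hg, Hz|].
    apply deriv01_of_derive. apply is_derive_RInt_cont, Hc. }
  specialize (E H y x Hy Hx). cbv beta in E. rewrite (RInt_point (V:=R_CompleteNormedModule) x g') in E.
  change (@zero R_CompleteNormedModule) with 0 in E. lra.
Qed.

(** * Integrals depending on parameters *)

Lemma continuous_eps {U : UniformSpace} (f : U -> R) (p : U) :
  continuous f p <->
  forall eps, 0 < eps -> locally p (fun q => Rabs (f q - f p) < eps).
Proof.
  unfold continuous. rewrite filterlim_locally. split.
  - intros H eps Heps. exact (H (mkposreal eps Heps)).
  - intros H eps. exact (H eps (cond_pos eps)).
Qed.

(** The tube lemma: neighbourhoods of the points [(x, p0)] are merged, by compactness of the
    segment, into one neighbourhood of [p0]. *)
Lemma continuous_tube {P : UniformSpace} (f : R -> P -> R) (a b : R) (p0 : P) (eps : R) :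
  (forall x, continuous (fun z : R * P => f (fst z) (snd z)) (x, p0)) -> 0 < eps ->
  locally p0 (fun p => forall x, a <= x <= b -> Rabs (f x p - f x p0) < eps).
Proof.
  intros Hf Heps.
  assert (Hd : forall x : R, exists d : posreal,
            forall z : R * P, ball (x, p0) d z -> Rabs (f (fst z) (snd z) - f x p0) < eps / 2).
  { intros x. destruct (proj1 (continuous_eps _ _) (Hf x) (eps / 2)) as [d Hd]; [lra|].
    exists d. exact Hd. }
  set (delta := fun x => proj1_sig (constructive_indefinite_description _ (Hd x))).
  assert (Hdelta : forall x (z : R * P), ball (x, p0) (delta x) z ->
            Rabs (f (fst z) (snd z) - f x p0) < eps / 2).
  { intros x. exact (proj2_sig (constructive_indefinite_description _ (Hd x))). }
  (* The covering property comes doubly negated, so the goal is first turned into the refutation of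
     the opposite inequality. *)
  destruct (compactness_value_1d a b delta) as [d Hc].
  exists d. intros p Hp x Hx. apply Rnot_le_lt. intros Hle.
  apply (Hc x Hx). intros [t (Ht & Hxt & Hdt)].
  assert (H1 : Rabs (f x p - f t p0) < eps / 2).
  { apply (Hdelta t (x, p)). split; simpl; [exact Hxt|].
    apply ball_le with d; assumption. }
  assert (H2 : Rabs (f x p0 - f t p0) < eps / 2).
  { apply (Hdelta t (x, p0)). split; simpl; [exact Hxt|apply ball_center]. }
  assert (Rabs (f x p - f x p0) < eps); [|lra].
  replace (f x p - f x p0) with ((f x p - f t p0) - (f x p0 - f t p0)) by ring.
  eapply Rle_lt_trans; [apply Rabs_triang|]. rewrite Rabs_Ropp. lra.
Qed.

Lemma Rabs_RInt_le (f : R -> R) (a b M : R) :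
  (forall x, continuous f x) -> (forall x, Rmin a b <= x <= Rmax a b -> Rabs (f x) <= M) ->
  Rabs (RInt f a b) <= M * Rabs (b - a).
Proof.
  intros Hf HM. destruct (Rle_dec a b) as [Hab|Hab].
  - rewrite Rmin_left, Rmax_right in HM by lra.
    rewrite (Rabs_pos_eq (b - a)) by lra. rewrite Rmult_comm.
    apply abs_RInt_le_const; [exact Hab|apply ex_RInt_cont, Hf|exact HM].
  - rewrite Rmin_right, Rmax_left in HM by lra.
    rewrite <- (opp_RInt_swap f b a) by (apply ex_RInt_cont, Hf).
    change (Rabs (- RInt f b a) <= M * Rabs (b - a)).
    rewrite Rabs_Ropp, (Rabs_left (b - a)) by lra.
    replace (M * - (b - a)) with ((a - b) * M) by ring.
    apply abs_RInt_le_const; [lra|apply ex_RInt_cont, Hf|exact HM].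
Qed.

Lemma continuous_section {P : UniformSpace} (f : R -> P -> R) (p : P) :
  (forall z : R * P, continuous (fun z : R * P => f (fst z) (snd z)) z) ->
  forall x, continuous (fun x => f x p) x.
Proof.
  intros Hf x. apply (continuous_comp (fun x : R => (x, p)) (fun z : R * P => f (fst z) (snd z))).
  - apply (continuous_comp_2 (fun x : R => x) (fun _ : R => p) (fun x p => (x, p))).
    + apply continuous_id.
    + apply continuous_const.
    + apply filterlim_locally. intros eps. exists eps. intros [y q] [Hy Hq]. split; assumption.
  - apply Hf.
Qed.

Lemma RInt_minus_R (f g : R -> R) (a b : R) :
  (forall x, continuous f x) -> (forall x, continuous g x) ->
  RInt (fun x => f x - g x) a b = RInt f a b - RInt g a b.
Proof.
  intros Hf Hg. apply (RInt_minus f g a b); apply ex_RInt_cont; assumption.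
Qed.

Lemma RInt_plus_R (f g : R -> R) (a b : R) :
  (forall x, continuous f x) -> (forall x, continuous g x) ->
  RInt (fun x => f x + g x) a b = RInt f a b + RInt g a b.
Proof.
  intros Hf Hg. apply (RInt_plus f g a b); apply ex_RInt_cont; assumption.
Qed.

Lemma RInt_scal_R (f : R -> R) (c a b : R) :
  (forall x, continuous f x) ->
  RInt (fun x => c * f x) a b = c * RInt f a b.
Proof.
  intros Hf. apply (RInt_scal f a b c). apply ex_RInt_cont; assumption.
Qed.

Lemma RInt_Chasles_R (f : R -> R) (a b c : R) :
  (forall x, continuous f x) -> RInt f a b + RInt f b c = RInt f a c.
Proof.
  intros Hf. apply (RInt_Chasles f a b c); apply ex_RInt_cont; assumption.
Qed.

Lemma RInt_point_R (f : R -> R) (a : R) : RInt f a a = 0.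
Proof. exact (RInt_point a f). Qed.

Lemma RInt_swap_R (f : R -> R) (a b : R) :
  (forall x, continuous f x) -> RInt f b a = - RInt f a b.
Proof.
  intros Hf. pose proof (RInt_Chasles_R f a b a Hf) as H. rewrite RInt_point_R in H. lra.
Qed.

Lemma RInt_ext_R (f g : R -> R) (a b : R) :
  (forall x, Rmin a b <= x <= Rmax a b -> f x = g x) -> RInt f a b = RInt g a b.
Proof. intros H. apply RInt_ext. intros x Hx. apply H. lra. Qed.

Lemma between_01 (a b x : R) :
  0 <= a <= 1 -> 0 <= b <= 1 -> Rmin a b <= x <= Rmax a b -> 0 <= x <= 1.
Proof. unfold Rmin, Rmax. destruct (Rle_dec a b); lra. Qed.

Lemma continuous_RInt_param {P : UniformSpace} (f : R -> P -> R) (A B : P -> R) (p0 : P) :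
  (forall z : R * P, continuous (fun z : R * P => f (fst z) (snd z)) z) ->
  continuous A p0 -> continuous B p0 ->
  continuous (fun p => RInt (fun x => f x p) (A p) (B p)) p0.
Proof.
  intros Hf HA HB.
  assert (Hs : forall p x, continuous (fun x => f x p) x)
    by (intros p; apply continuous_section, Hf).
  assert (HI : continuous (fun p => RInt (fun x => f x p0) (A p) (B p)) p0).
  { apply (continuous_comp_2 A B (fun a b => RInt (fun x => f x p0) a b)); [exact HA|exact HB|].
    apply (continuous_RInt (fun x => f x p0) (A p0) (B p0) (fun a b => RInt (fun x => f x p0) a b)).
    apply filter_forall. intros z.
    apply (RInt_correct (fun x => f x p0) (fst z) (snd z)). apply ex_RInt_cont, Hs. }
  apply continuous_eps. intros eps Heps.
  (* The margin 1 keeps the moving limits [A p] and [B p] in one fixed segment for [p] near [p0];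
     the tolerance on the integrand is [eps / 2] divided by the length of that segment. *)
  set (a := Rmin (A p0) (B p0) - 1). set (b := Rmax (A p0) (B p0) + 1).
  assert (Hab : 0 < b - a).
  { unfold a, b. pose proof (Rmin_l (A p0) (B p0)). pose proof (Rmax_l (A p0) (B p0)). lra. }
  assert (He' : 0 < eps / 2 / (b - a)) by (apply Rdiv_lt_0_compat; lra).
  pose proof (continuous_tube f a b p0 (eps / 2 / (b - a)) (fun x => Hf (x, p0)) He') as H1.
  pose proof (proj1 (continuous_eps _ _) HI (eps / 2) ltac:(lra)) as H2.
  pose proof (proj1 (continuous_eps _ _) HA 1 ltac:(lra)) as H3.
  pose proof (proj1 (continuous_eps _ _) HB 1 ltac:(lra)) as H4.
  generalize (filter_and _ _ (filter_and _ _ H1 H2) (filter_and _ _ H3 H4)).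
  apply filter_imp. intros p [[K1 K2] [K3 K4]].
  replace (RInt (fun x => f x p) (A p) (B p) - RInt (fun x => f x p0) (A p0) (B p0))
    with (RInt (fun x => f x p - f x p0) (A p) (B p) +
          (RInt (fun x => f x p0) (A p) (B p) - RInt (fun x => f x p0) (A p0) (B p0)))
    by (rewrite RInt_minus_R by apply Hs; ring).
  apply Rabs_def2 in K3. apply Rabs_def2 in K4.
  assert (HAp : a <= A p <= b).
  { unfold a, b. pose proof (Rmin_l (A p0) (B p0)). pose proof (Rmax_l (A p0) (B p0)). lra. }
  assert (HBp : a <= B p <= b).
  { unfold a, b. pose proof (Rmin_r (A p0) (B p0)). pose proof (Rmax_r (A p0) (B p0)). lra. }
  assert (K5 : Rabs (RInt (fun x => f x p - f x p0) (A p) (B p))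
               <= eps / 2 / (b - a) * Rabs (B p - A p)).
  { apply Rabs_RInt_le.
    - intros x. apply continuous_Rminus; apply Hs.
    - intros x Hx. left. apply K1. revert Hx. unfold Rmin, Rmax. destruct Rle_dec; lra. }
  assert (K6 : Rabs (B p - A p) <= b - a) by (apply Rabs_le; lra).
  assert (K7 : eps / 2 / (b - a) * Rabs (B p - A p) <= eps / 2).
  { apply Rle_trans with (eps / 2 / (b - a) * (b - a)).
    - apply Rmult_le_compat_l; lra.
    - right. field. lra. }
  eapply Rle_lt_trans; [apply Rabs_triang|]. lra.
Qed.

Lemma is_derive_RInt_param_cont (f ft : R -> R -> R) (a b t : R) :
  G0 f -> G0 ft -> (forall t x, is_derive (fun s => f s x) t (ft t x)) ->
  is_derive (fun s => RInt (fun x => f s x) a b) t (RInt (fun x => ft t x) a b).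
Proof.
  intros Hf Hft Hd.
  assert (E : RInt (fun x => ft t x) a b = RInt (fun x => Derive (fun s => f s x) t) a b).
  { apply RInt_ext. intros x _. symmetry. apply is_derive_unique, Hd. }
  rewrite E. apply is_derive_RInt_param.
  - apply filter_forall. intros s x _. exists (ft s x). apply Hd.
  - intros x _. apply continuity_2d_pt_ext with ft.
    + intros s y. symmetry. apply is_derive_unique, Hd.
    + apply continuity_2d_pt_filterlim. apply (Hft (t, x)).
  - apply filter_forall. intros s. apply ex_RInt_cont. intros x. cnt.
Qed.

(** * Functions with a continuous [t]-derivative *)

(** Regularity in [x] is deliberately left out: a weak solution first gains its t-derivative, and
    the x-derivative is then read off from the transport equation by [pd_of_charD]. *)
Definition C1t (u v : R -> R -> R) : Prop :=
  G0 u /\ G0 v /\ forall x t, is_derive (fun s => u x s) t (v x t).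

Lemma G0_section (u : R -> R -> R) (x : R) : G0 u -> forall t, continuous (u x) t.
Proof. intros Hu t. apply (continuous_G0 u (fun _ => x) (fun s => s)); cnt. Qed.

Lemma C1t_ext (u u' v v' : R -> R -> R) :
  (forall x t, u x t = u' x t) -> (forall x t, v x t = v' x t) -> C1t u v -> C1t u' v'.
Proof.
  intros E E' (H1 & H2 & H3). split; [|split].
  - intros p. apply continuous_ext with (fun q => u (fst q) (snd q)); [intros; apply E|apply H1].
  - intros p. apply continuous_ext with (fun q => v (fst q) (snd q)); [intros; apply E'|apply H2].
  - intros x t. rewrite <- E'. apply is_derive_ext with (fun s => u x s); [intros; apply E|apply H3].
Qed.

Lemma C1t_plus (u v u' v' : R -> R -> R) :
  C1t u u' -> C1t v v' -> C1t (fun x t => u x t + v x t) (fun x t => u' x t + v' x t).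
Proof.
  intros (H1 & H2 & H3) (H4 & H5 & H6). split; [|split]; try (intros p; solve [cnt]).
  intros x t. exact (is_derive_plus (u x) (v x) t _ _ (H3 x t) (H6 x t)).
Qed.

Lemma C1t_mult (u v u' v' : R -> R -> R) :
  C1t u u' -> C1t v v' ->
  C1t (fun x t => u x t * v x t) (fun x t => u' x t * v x t + u x t * v' x t).
Proof.
  intros (H1 & H2 & H3) (H4 & H5 & H6). split; [|split]; try (intros p; solve [cnt]).
  intros x t. exact (is_derive_Rmult (u x) (v x) t _ _ (H3 x t) (H6 x t)).
Qed.

Lemma C1t_const (c : R) : C1t (fun _ _ => c) (fun _ _ => 0).
Proof.
  split; [|split]; try (intros p; solve [cnt]). intros x t. exact (is_derive_const c t).
Qed.

Lemma C1t_scal (c : R) (u v : R -> R -> R) :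
  C1t u v -> C1t (fun x t => c * u x t) (fun x t => c * v x t).
Proof.
  intros H. eapply C1t_ext; [| |exact (C1t_mult _ _ _ _ (C1t_const c) H)];
    intros; simpl; ring.
Qed.

Lemma C1t_minus (u v u' v' : R -> R -> R) :
  C1t u u' -> C1t v v' -> C1t (fun x t => u x t - v x t) (fun x t => u' x t - v' x t).
Proof.
  intros H H'. eapply C1t_ext; [| |exact (C1t_plus _ _ _ _ H (C1t_scal (-1) _ _ H'))];
    intros; simpl; ring.
Qed.

Lemma C1t_exp (u v : R -> R -> R) :
  C1t u v -> C1t (fun x t => exp (u x t)) (fun x t => v x t * exp (u x t)).
Proof.
  intros (H1 & H2 & H3). split; [|split]; try (intros p; solve [cnt]).
  intros x t.
  exact (is_derive_comp exp (u x) t _ _ (is_derive_exp (u x t)) (H3 x t)).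
Qed.

Lemma C1t_inv (u v : R -> R -> R) :
  (forall x t, u x t <> 0) -> C1t u v ->
  C1t (fun x t => / u x t) (fun x t => - v x t * (/ u x t * / u x t)).
Proof.
  intros Hn (H1 & H2 & H3).
  assert (Hi : G0 (fun x t => / u x t)).
  { intros p. apply (continuous_Rinv_all (fun q : R * R => u (fst q) (snd q))); [auto|cnt]. }
  split; [|split]; [exact Hi| |].
  - intros p. apply continuous_Rmult; [cnt|].
    apply continuous_Rmult; apply Hi.
  - intros x t. replace (- v x t * (/ u x t * / u x t)) with (- v x t / u x t ^ 2)
      by (field; apply Hn).
    apply (is_derive_inv (u x)); auto.
Qed.

Lemma C1t_cl (u v : R -> R -> R) : C1t u v -> C1t (cl u) (cl v).
Proof.
  intros (H1 & H2 & H3). split; [|split]; try (apply G0_cl; assumption).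
  intros x t. apply H3.
Qed.

Lemma C1t_prim (y : R -> R -> R) : G0 y -> C1t (fun x t => RInt (y x) 0 t) y.
Proof.
  intros Hy. split; [|split].
  - intros p. apply (continuous_RInt_param (fun s (q : R * R) => y (fst q) s)); cnt.
  - exact Hy.
  - intros x t. apply is_derive_RInt_cont. apply G0_section, Hy.
Qed.

Lemma C1t_frozen (f : R -> R) : (forall x, continuous f x) ->
  C1t (fun x _ => f x) (fun _ _ => 0).
Proof.
  intros Hf. split; [|split]; try (intros p; solve [cnt]). intros x t. exact (is_derive_const (f x) t).
Qed.

(* The slope of [u] along a curve [phi] differs from its [x]-derivative by the
   transport term alone, and this only needs differentiability in [t]. *)
Lemma deriv01_shear (u v : R -> R -> R) (phi : R -> R) (x d : R) :
  0 <= x <= 1 -> C1t u v -> is_deriv01 phi x d ->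
  is_deriv01 (fun y => u y (phi y) - u y (phi x)) x (v x (phi x) * d).
Proof.
  intros Hx (Hu & Hv & Huv) Hphi.
  apply deriv01_eps. intros eps Heps.
  set (V := v x (phi x)).
  set (e := Rmin 1 (eps / (Rabs d + 1 + Rabs V))).
  assert (Hden : 0 < Rabs d + 1 + Rabs V).
  { pose proof (Rabs_pos d). pose proof (Rabs_pos V). lra. }
  assert (He : 0 < e) by (unfold e; apply Rmin_pos; [lra|apply Rdiv_lt_0_compat; lra]).
  assert (He1 : e <= 1) by apply Rmin_l.
  assert (He2 : e * (Rabs d + 1 + Rabs V) <= eps).
  { apply Rle_trans with (eps / (Rabs d + 1 + Rabs V) * (Rabs d + 1 + Rabs V)).
    - apply Rmult_le_compat_r; [lra|apply Rmin_r].
    - right. field. lra. }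
  destruct (proj1 (continuous_eps _ _) (Hv (x, phi x)) e He) as [r Hr]. simpl in Hr.
  rewrite deriv01_eps in Hphi. destruct (Hphi e He) as [d1 [Hd1 Hd2]].
  assert (Hd' : 0 < r / (Rabs d + 1)).
  { apply Rdiv_lt_0_compat; [apply cond_pos|pose proof (Rabs_pos d); lra]. }
  exists (Rmin d1 (Rmin r (r / (Rabs d + 1)))). split.
  { repeat apply Rmin_pos; try assumption. apply cond_pos. }
  intros y Hy Hyd.
  assert (Hy1 : Rabs (y - x) < d1) by (eapply Rlt_le_trans; [exact Hyd|apply Rmin_l]).
  assert (Hy2 : Rabs (y - x) < r).
  { eapply Rlt_le_trans; [exact Hyd|]. eapply Rle_trans; [apply Rmin_r|apply Rmin_l]. }
  assert (Hy3 : Rabs (y - x) < r / (Rabs d + 1)).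
  { eapply Rlt_le_trans; [exact Hyd|]. eapply Rle_trans; [apply Rmin_r|apply Rmin_r]. }
  specialize (Hd2 y Hy Hy1).
  assert (Hphi1 : Rabs (phi y - phi x) <= (Rabs d + 1) * Rabs (y - x)).
  { replace (phi y - phi x) with ((phi y - phi x - d * (y - x)) + d * (y - x)) by ring.
    eapply Rle_trans; [apply Rabs_triang|]. rewrite Rabs_mult.
    pose proof (Rabs_pos (y - x)). nra. }
  assert (Hphi2 : Rabs (phi y - phi x) < r).
  { eapply Rle_lt_trans; [exact Hphi1|].
    pose proof (Rabs_pos d).
    apply Rlt_le_trans with ((Rabs d + 1) * (r / (Rabs d + 1))).
    - apply Rmult_lt_compat_l; lra.
    - right. field. lra. }
  (* The mean value theorem is used in [t] only, at the fixed abscissa [y]; continuity of [v] then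
     replaces [v y c] by [V]. *)
  destruct (MVT_gen (fun s => u y s) (phi x) (phi y) (fun s => v y s)) as [c [Hc Ec]].
  { intros s _. apply Huv. }
  { intros s _. apply continuity_pt_filterlim. apply (G0_section u y Hu). }
  simpl in Ec.
  assert (Hcx : Rabs (v y c - V) < e).
  { apply (Hr (y, c)). split; simpl.
    - exact Hy2.
    - change (Rabs (c - phi x) < r). eapply Rle_lt_trans; [|exact Hphi2].
      revert Hc. unfold Rmin, Rmax. destruct Rle_dec; intros Hc.
      + rewrite !Rabs_pos_eq; lra.
      + rewrite !Rabs_left1; lra. }
  replace (u y (phi y) - u y (phi x) - (u x (phi x) - u x (phi x)) - V * d * (y - x))
    with ((v y c - V) * (phi y - phi x) + V * (phi y - phi x - d * (y - x)))
    by (rewrite Ec; ring).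
  eapply Rle_trans; [apply Rabs_triang|]. rewrite !Rabs_mult.
  apply Rle_trans with (e * ((Rabs d + 1) * Rabs (y - x)) + Rabs V * (e * Rabs (y - x))).
  - apply Rplus_le_compat.
    + apply Rmult_le_compat; try apply Rabs_pos; lra.
    + apply Rmult_le_compat_l; [apply Rabs_pos|exact Hd2].
  - replace (e * ((Rabs d + 1) * Rabs (y - x)) + Rabs V * (e * Rabs (y - x)))
      with (e * (Rabs d + 1 + Rabs V) * Rabs (y - x)) by ring.
    apply Rmult_le_compat_r; [apply Rabs_pos|exact He2].
Qed.

Lemma deriv01_RInt_param (g g' : R -> R -> R) (a b x : R) :
  G0 g' -> (forall t, continuous (g x) t) ->
  (forall y t, 0 <= y <= 1 -> is_deriv01 (fun z => g z t) y (g' y t)) ->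
  0 <= x <= 1 ->
  is_deriv01 (fun y => RInt (g y) a b) x (RInt (g' x) a b).
Proof.
  intros Hg' Hgc Hg Hx.
  (* [h] agrees with [g] on [0,1] and has the two-sided derivative [g'] everywhere, so ordinary
     differentiation under the integral applies at 0 and 1 as well. *)
  set (h := fun y t => g x t + RInt (fun z => g' z t) x y).
  assert (Hgx : forall t, continuous (fun t => g x t) t) by exact Hgc.
  assert (Hh : G0 h).
  { intros p. unfold h. apply continuous_Rplus.
    - apply (continuous_comp1 (g x)); cnt.
    - apply (continuous_RInt_param (fun z (q : R * R) => g' z (snd q))); cnt. }
  apply (deriv01_ext (fun y => RInt (h y) a b)); [exact Hx| |].
  - intros y Hy. apply RInt_ext. intros t _. unfold h.
    assert (Hc : forall z, continuous (fun z => g' z t) z) by (intros; cnt).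
    pose proof (deriv01_FTC (fun z => g z t) (fun z => g' z t) Hc (fun z Hz => Hg z t Hz) x y Hx Hy)
      as E. simpl in E. change (g x t + RInt (fun z => g' z t) x y = g y t). lra.
  - apply deriv01_of_derive. apply (is_derive_RInt_param_cont h g').
    + exact Hh.
    + exact Hg'.
    + intros y t. unfold h.
      assert (E : g' y t = 0 + g' y t) by ring. rewrite E.
      apply (is_derive_plus (fun _ => g x t)); [apply (is_derive_const (g x t))|].
      apply (is_derive_RInt_cont (fun z => g' z t)). intros; cnt.
Qed.

(** * Flow of a scalar slope field *)

(** Caratheodory's form of the derivative, suited to the flow, whose increments in [t] are known by
    an exact formula. *)
Lemma is_derive_factor (f Q : R -> R) (t : R) :
  (forall s, f s - f t = (s - t) * Q s) -> continuous Q t -> is_derive f t (Q t).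
Proof.
  intros Hf HQ. apply is_derive_eps. intros eps Heps.
  destruct (proj1 (continuous_eps _ _) HQ eps Heps) as [d Hd].
  exists d. split; [apply cond_pos|]. intros s Hs.
  rewrite Hf. replace ((s - t) * Q s - Q t * (s - t)) with ((Q s - Q t) * (s - t)) by ring.
  rewrite Rabs_mult. apply Rmult_le_compat_r; [apply Rabs_pos|]. left. apply Hd. exact Hs.
Qed.

(** [flow_clamp] fixes the values off [0,1], so that continuity of the flow can be stated on the
    whole space. Uniqueness, the group law and differentiability in [t] are not assumed; they are
    derived from the slope and its global bounds. *)
Record is_flow (m mt : R -> R -> R) (M L : R) (tau : R -> R -> R -> R) : Prop := {
  flow_slope : C1t m mt;
  flow_bound : forall x t, Rabs (m x t) <= M;
  flow_lip : forall x t, Rabs (mt x t) <= L;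
  flow_clamp : forall xi x t, tau xi x t = tau (clamp xi) (clamp x) t;
  flow_init : forall x t, tau x x t = t;
  flow_deriv : forall xi x t, 0 <= xi <= 1 ->
    is_deriv01 (fun z => tau z x t) xi (m xi (tau xi x t)) }.

(** Hadamard's integral form of the difference quotient of [m x] between [s] and [t]; unlike the
    quotient it is continuous across [s = t]. *)
Definition quot_t (mt : R -> R -> R) (x s t : R) : R :=
  RInt (fun th => mt x (s + th * (t - s))) 0 1.

(** The solution of the linearized characteristic equation, which is the t-derivative of the flow by
    [is_derive_flow]. The exponential form gives positivity and is what ties it to the weights
    [c_j^l]. *)
Definition tau_t (mt : R -> R -> R) (tau : R -> R -> R -> R) (xi x t : R) : R :=
  exp (RInt (fun eta => mt eta (tau eta x t)) (clamp x) (clamp xi)).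

Lemma quot_t_diag (mt : R -> R -> R) (x t : R) : quot_t mt x t t = mt x t.
Proof.
  unfold quot_t. rewrite (RInt_ext_R _ (fun _ => mt x t)).
  - rewrite (RInt_const (V := R_CompleteNormedModule)). unfold scal; simpl. unfold mult; simpl. ring.
  - intros th _. f_equal. ring.
Qed.

Lemma continuous_quot_t {U : UniformSpace} (mt : R -> R -> R) (f g h : U -> R) (p : U) :
  G0 mt -> (forall q, continuous f q) -> (forall q, continuous g q) ->
  (forall q, continuous h q) ->
  continuous (fun q => quot_t mt (f q) (g q) (h q)) p.
Proof.
  intros Hm Hf Hg Hh. unfold quot_t.
  assert (Hc : forall (w : U -> R), (forall q, continuous w q) ->
    forall z : R * U, continuous (fun z : R * U => w (snd z)) z).
  { intros w Hw z. apply (continuous_comp snd w); [apply continuous_snd1|apply Hw]. }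
  pose proof (Hc f Hf) as Hf'. pose proof (Hc g Hg) as Hg'. pose proof (Hc h Hh) as Hh'.
  apply (continuous_RInt_param (fun th q => mt (f q) (g q + th * (h q - g q)))); cnt.
Qed.

Section Flow.
Variables (m mt : R -> R -> R) (M L : R) (tau : R -> R -> R -> R).
Hypothesis F : is_flow m mt M L tau.

Let Hm : G0 m := proj1 (flow_slope _ _ _ _ _ F).
Let Hmt : G0 mt := proj1 (proj2 (flow_slope _ _ _ _ _ F)).
Let Hd : forall x t, is_derive (m x) t (mt x t) := proj2 (proj2 (flow_slope _ _ _ _ _ F)).

Lemma flow_M_pos : 0 <= M.
Proof. eapply Rle_trans; [apply Rabs_pos|apply (flow_bound _ _ _ _ _ F 0 0)]. Qed.

Lemma flow_L_pos : 0 <= L.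
Proof. eapply Rle_trans; [apply Rabs_pos|apply (flow_lip _ _ _ _ _ F 0 0)]. Qed.

Lemma quot_t_eq (x s t : R) : m x t - m x s = quot_t mt x s t * (t - s).
Proof.
  unfold quot_t.
  assert (E : RInt (fun th => (t - s) * mt x (s + th * (t - s))) 0 1 = m x t - m x s).
  { assert (H : is_RInt (fun th => (t - s) * mt x (s + th * (t - s))) 0 1
                  (minus (m x (s + 1 * (t - s))) (m x (s + 0 * (t - s))))).
    { apply (is_RInt_derive (fun th => m x (s + th * (t - s)))).
      - intros th _. apply (is_derive_comp (m x) (fun th => s + th * (t - s))).
        + apply Hd.
        + auto_derive; [trivial|ring].
      - intros th _. cnt. }
    rewrite (is_RInt_unique (V := R_CompleteNormedModule) _ _ _ _ H).
    change (m x (s + 1 * (t - s)) - m x (s + 0 * (t - s)) = m x t - m x s).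
    f_equal; f_equal; f_equal; ring. }
  rewrite <- E. rewrite RInt_scal_R; [ring|]. intros th. cnt.
Qed.

Lemma quot_t_bound (x s t : R) : Rabs (quot_t mt x s t) <= L.
Proof.
  unfold quot_t. replace L with (L * Rabs (1 - 0)) by (rewrite Rabs_pos_eq; lra).
  apply Rabs_RInt_le; [cnt|]. intros th _. apply (flow_lip _ _ _ _ _ F).
Qed.

(** The difference of two solutions satisfies a linear equation whose coefficient is the mean slope
    [quot_t], hence an exact formula rather than an estimate. Uniqueness, Lipschitz dependence and
    differentiability in the initial time all follow from it. *)
Lemma solution_gap (y z : R -> R) :
  (forall x, 0 <= x <= 1 -> is_deriv01 y x (m x (y x))) ->
  (forall x, 0 <= x <= 1 -> is_deriv01 z x (m x (z x))) ->
  forall x xi, 0 <= x <= 1 -> 0 <= xi <= 1 ->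
    z xi - y xi = (z x - y x) * exp (RInt (fun eta => quot_t mt eta (y (clamp eta)) (z (clamp eta))) x xi).
Proof.
  intros Hy Hz x xi Hx Hxi.
  pose proof (deriv01_continuous y _ Hy) as Cy. pose proof (deriv01_continuous z _ Hz) as Cz.
  set (A := fun eta => quot_t mt eta (y (clamp eta)) (z (clamp eta))).
  assert (CA : forall eta, continuous A eta).
  { intros eta. apply (continuous_quot_t mt (fun q => q) (fun q => y (clamp q)) (fun q => z (clamp q)));
      [exact Hmt|intros; apply continuous_id|exact Cy|exact Cz]. }
  assert (E := deriv01_zero (fun w => (z w - y w) * exp (- RInt A x w))).
  assert (H : forall w, 0 <= w <= 1 ->
    is_deriv01 (fun w => (z w - y w) * exp (- RInt A x w)) w 0).
  { intros w Hw.
    apply (deriv01_eq _ _ ((m w (z w) - m w (y w)) * exp (- RInt A x w)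
             + (z w - y w) * ((- A w) * exp (- RInt A x w)))).
    - rewrite quot_t_eq. unfold A. rewrite (clamp_id w Hw). ring.
    - apply (deriv01_mult (fun w => z w - y w) (fun w => exp (- RInt A x w)));
        [exact Hw|apply (deriv01_minus z y); auto|].
      apply (deriv01_exp (fun w => - RInt A x w)); [exact Hw|].
      apply (deriv01_ext (fun w => -1 * RInt A x w)); [exact Hw|intros; ring|].
      apply (deriv01_eq _ _ (-1 * A w)); [ring|]. apply (deriv01_scal (-1) (fun w => RInt A x w)); [exact Hw|].
      apply deriv01_of_derive. apply is_derive_RInt_cont, CA. }
  specialize (E H xi x Hxi Hx). cbv beta in E.
  rewrite RInt_point_R, Ropp_0, exp_0, Rmult_1_r in E. rewrite <- E.
  rewrite Rmult_assoc, <- exp_plus. fold A. rewrite Rplus_opp_l, exp_0. ring.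
Qed.

Lemma solution_close (y z : R -> R) :
  (forall x, 0 <= x <= 1 -> is_deriv01 y x (m x (y x))) ->
  (forall x, 0 <= x <= 1 -> is_deriv01 z x (m x (z x))) ->
  forall x xi, 0 <= x <= 1 -> 0 <= xi <= 1 ->
    Rabs (z xi - y xi) <= exp L * Rabs (z x - y x).
Proof.
  intros Hy Hz x xi Hx Hxi.
  pose proof (deriv01_continuous y _ Hy) as Cy. pose proof (deriv01_continuous z _ Hz) as Cz.
  rewrite (solution_gap y z Hy Hz x xi Hx Hxi).
  rewrite Rabs_mult, Rmult_comm. apply Rmult_le_compat_r; [apply Rabs_pos|].
  rewrite Rabs_pos_eq by (left; apply exp_pos).
  match goal with |- exp ?I <= _ => assert (HI : I <= L) end.
  { eapply Rle_trans; [apply Rle_abs|].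
    eapply Rle_trans; [apply (Rabs_RInt_le _ _ _ L)|].
    - intros eta. apply (continuous_quot_t mt (fun q => q) (fun q => y (clamp q)) (fun q => z (clamp q)));
      [exact Hmt|intros; apply continuous_id|exact Cy|exact Cz].
    - intros eta _. apply quot_t_bound.
    - rewrite <- (Rmult_1_r L) at 2. apply Rmult_le_compat_l; [apply flow_L_pos|].
      apply Rabs_le. lra. }
  destruct HI as [HI|HI]; [left; apply exp_increasing, HI|right; rewrite HI; reflexivity].
Qed.

Lemma flow_unique (y : R -> R) (x t : R) :
  (forall x, 0 <= x <= 1 -> is_deriv01 y x (m x (y x))) ->
  0 <= x <= 1 -> y x = t -> forall xi, 0 <= xi <= 1 -> y xi = tau xi x t.
Proof.
  intros Hy Hx Hyx xi Hxi.
  assert (Hz : forall w, 0 <= w <= 1 -> is_deriv01 (fun z => tau z x t) w (m w (tau w x t)))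
    by (intros; apply (flow_deriv _ _ _ _ _ F); assumption).
  pose proof (solution_gap _ _ Hz Hy x xi Hx Hxi) as E. cbv beta in E.
  rewrite (flow_init _ _ _ _ _ F), Hyx in E.
  replace (t - t) with 0 in E by ring. lra.
Qed.

Lemma flow_group (xi y x t : R) : tau xi y (tau y x t) = tau xi x t.
Proof.
  rewrite (flow_clamp _ _ _ _ _ F xi), (flow_clamp _ _ _ _ _ F xi x).
  rewrite (flow_clamp _ _ _ _ _ F y x).
  symmetry. apply (flow_unique (fun z => tau z (clamp x) t) (clamp y)); try apply clamp_01.
  - intros w Hw. apply (flow_deriv _ _ _ _ _ F), Hw.
  - reflexivity.
Qed.

Lemma flow_translate (T : R) :
  (forall x t, m x (t + T) = m x t) -> forall xi x t, tau xi x (t + T) = tau xi x t + T.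
Proof.
  intros Hper xi x t.
  rewrite (flow_clamp _ _ _ _ _ F xi), (flow_clamp _ _ _ _ _ F xi x t).
  symmetry. apply (flow_unique (fun z => tau z (clamp x) t + T) (clamp x)); try apply clamp_01.
  - intros w Hw. rewrite Hper.
    apply (deriv01_eq _ _ (m w (tau w (clamp x) t) + 0)); [ring|].
    apply deriv01_plus; [exact Hw|apply (flow_deriv _ _ _ _ _ F), Hw|apply deriv01_const].
  - rewrite (flow_init _ _ _ _ _ F). reflexivity.
Qed.

Lemma flow_lip_xi (xi xi' x t : R) : Rabs (tau xi x t - tau xi' x t) <= M * Rabs (xi - xi').
Proof.
  rewrite (flow_clamp _ _ _ _ _ F xi), (flow_clamp _ _ _ _ _ F xi').
  assert (Hz : forall w, 0 <= w <= 1 -> is_deriv01 (fun z => tau z (clamp x) t) w (m w (tau w (clamp x) t)))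
    by (intros; apply (flow_deriv _ _ _ _ _ F); assumption).
  pose proof (deriv01_continuous _ _ Hz) as Cz.
  assert (Cz' : forall w, continuous (fun w => tau w (clamp x) t) w).
  { intros w. apply continuous_ext with (fun w => tau (clamp w) (clamp x) t); [|apply Cz].
    intros v. rewrite (flow_clamp _ _ _ _ _ F v), clamp_k. reflexivity. }
  assert (Cg : forall w, continuous (fun w => m w (tau w (clamp x) t)) w).
  { intros w. apply (continuous_G0 m (fun w => w)); [exact Hm|cnt|apply Cz']. }
  pose proof (deriv01_FTC _ _ Cg Hz (clamp xi') (clamp xi) (clamp_01 _) (clamp_01 _)) as E. cbv beta in E.
  rewrite E. eapply Rle_trans; [apply Rabs_RInt_le with (M := M)|].
  - exact Cg.
  - intros w _. apply (flow_bound _ _ _ _ _ F).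
  - apply Rmult_le_compat_l; [apply flow_M_pos|apply clamp_lip].
Qed.

Lemma flow_lip_all (xi x t xi' x' t' : R) :
  Rabs (tau xi x t - tau xi' x' t') <=
  M * Rabs (xi - xi') + exp L * (Rabs (t - t') + M * Rabs (x - x')).
Proof.
  replace (tau xi x t - tau xi' x' t')
    with ((tau xi x t - tau xi' x t) + (tau xi' x t - tau xi' x' t')) by ring.
  eapply Rle_trans; [apply Rabs_triang|]. apply Rplus_le_compat; [apply flow_lip_xi|].
  rewrite (flow_clamp _ _ _ _ _ F xi' x), (flow_clamp _ _ _ _ _ F xi' x').
  eapply Rle_trans; [apply (solution_close (fun z => tau z (clamp x') t') (fun z => tau z (clamp x) t))
    with (x := clamp x)|]; try apply clamp_01.
  - intros; apply (flow_deriv _ _ _ _ _ F); assumption.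
  - intros; apply (flow_deriv _ _ _ _ _ F); assumption.
  - apply Rmult_le_compat_l; [left; apply exp_pos|].
    rewrite (flow_init _ _ _ _ _ F).
    replace (t - tau (clamp x) (clamp x') t') with ((t - t') - (tau (clamp x) (clamp x') t' - t')) by ring.
    eapply Rle_trans; [apply Rabs_triang|]. rewrite Rabs_Ropp.
    apply Rplus_le_compat_l.
    rewrite <- (flow_init _ _ _ _ _ F (clamp x') t') at 2.
    eapply Rle_trans; [apply flow_lip_xi|].
    apply Rmult_le_compat_l; [apply flow_M_pos|apply clamp_lip].
Qed.

Lemma continuous_flow {U : UniformSpace} (f g h : U -> R) (p : U) :
  continuous f p -> continuous g p -> continuous h p ->
  continuous (fun q => tau (f q) (g q) (h q)) p.
Proof.
  intros Hf Hg Hh. apply continuous_eps. intros eps Heps.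
  set (K := M + exp L * (1 + M) + 1).
  pose proof flow_M_pos as HM. pose proof (exp_pos L) as HL.
  assert (HK : 0 < K) by (unfold K; nra).
  assert (He : 0 < eps / K) by (apply Rdiv_lt_0_compat; lra).
  pose proof (proj1 (continuous_eps _ _) Hf _ He) as H1.
  pose proof (proj1 (continuous_eps _ _) Hg _ He) as H2.
  pose proof (proj1 (continuous_eps _ _) Hh _ He) as H3.
  generalize (filter_and _ _ H1 (filter_and _ _ H2 H3)).
  apply filter_imp. intros q (K1 & K2 & K3).
  eapply Rle_lt_trans; [apply flow_lip_all|].
  apply Rle_lt_trans with (M * (eps / K) + exp L * ((eps / K) + M * (eps / K))).
  - apply Rplus_le_compat.
    + apply Rmult_le_compat_l; lra.
    + apply Rmult_le_compat_l; [lra|]. apply Rplus_le_compat; [lra|].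
      apply Rmult_le_compat_l; lra.
  - assert (E : K * (eps / K) = eps) by (field; lra).
    remember (eps / K) as e. rewrite <- E. unfold K.
    replace (M * e + exp L * (e + M * e)) with ((M + exp L * (1 + M)) * e) by ring.
    apply Rmult_lt_compat_r; lra.
Qed.

Lemma continuous_flow_t {U : UniformSpace} (f g h : U -> R) (p : U) :
  (forall q, continuous f q) -> (forall q, continuous g q) -> (forall q, continuous h q) ->
  continuous (fun q => tau_t mt tau (f q) (g q) (h q)) p.
Proof.
  intros Hf Hg Hh. unfold tau_t. apply continuous_Rexp.
  apply (continuous_RInt_param (fun eta q => mt eta (tau eta (g q) (h q)))).
  - intros z. apply continuous_G0; [exact Hmt|cnt|].
    apply continuous_flow; [cnt| |].
    + apply (continuous_comp snd g); [apply continuous_snd1|apply Hg].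
    + apply (continuous_comp snd h); [apply continuous_snd1|apply Hh].
  - apply continuous_k, Hg.
  - apply continuous_k, Hf.
Qed.

Lemma is_derive_flow (xi x t : R) : is_derive (tau xi x) t (tau_t mt tau xi x t).
Proof.
  (* [Q s] is the difference quotient of the flow supplied by [solution_gap]; at [s = t] the mean
     slope becomes [mt], so that [Q t] is [tau_t]. *)
  set (Q := fun s => exp (RInt (fun eta => quot_t mt eta (tau eta x t) (tau eta x s)) (clamp x) (clamp xi))).
  assert (E : tau_t mt tau xi x t = Q t).
  { unfold tau_t, Q. f_equal. apply RInt_ext_R. intros eta _. rewrite quot_t_diag. reflexivity. }
  rewrite E. apply is_derive_factor.
  - intros s. unfold Q.
    rewrite (flow_clamp _ _ _ _ _ F xi x s), (flow_clamp _ _ _ _ _ F xi x t).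
    rewrite (solution_gap (fun z => tau z (clamp x) t) (fun z => tau z (clamp x) s)) with (x := clamp x);
      try apply clamp_01;
      try (intros; apply (flow_deriv _ _ _ _ _ F); assumption).
    rewrite !(flow_init _ _ _ _ _ F). apply (f_equal (fun I => (s - t) * exp I)). apply RInt_ext_R.
    intros eta _. rewrite !(flow_clamp _ _ _ _ _ F eta x). reflexivity.
  - unfold Q. apply continuous_Rexp.
    apply (continuous_RInt_param (fun eta s => quot_t mt eta (tau eta x t) (tau eta x s)));
      try apply continuous_const.
    intros z. apply continuous_quot_t; [exact Hmt|cnt| |].
    + intros q. apply continuous_flow; cnt.
    + intros q. apply continuous_flow; cnt.
Qed.

Lemma flow_t_init (x t : R) : tau_t mt tau x x t = 1.
Proof. unfold tau_t. rewrite RInt_point_R. apply exp_0. Qed.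

Lemma flow_t_pos (xi x t : R) : 0 < tau_t mt tau xi x t.
Proof. apply exp_pos. Qed.

Lemma flow_t_deriv (xi x t : R) : 0 <= xi <= 1 ->
  is_deriv01 (fun z => tau_t mt tau z x t) xi (mt xi (tau xi x t) * tau_t mt tau xi x t).
Proof.
  intros Hxi.
  apply (deriv01_ext (fun z => exp (RInt (fun eta => mt eta (tau eta x t)) (clamp x) z))); [exact Hxi| |].
  - intros y Hy. unfold tau_t. rewrite (clamp_id y Hy). reflexivity.
  - unfold tau_t. rewrite (clamp_id xi Hxi).
    apply (deriv01_exp (fun z => RInt (fun eta => mt eta (tau eta x t)) (clamp x) z)); [exact Hxi|].
    apply deriv01_of_derive. apply (is_derive_RInt_cont (fun eta => mt eta (tau eta x t))).
    intros eta. apply (continuous_G0 mt (fun q => q)); [exact Hmt|cnt|apply continuous_flow; cnt].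
Qed.

Lemma C1t_flow (xi : R) : C1t (fun x t => tau xi x t) (fun x t => tau_t mt tau xi x t).
Proof.
  split; [|split].
  - intros p. apply continuous_flow; cnt.
  - intros p. apply continuous_flow_t; cnt.
  - intros x t. apply is_derive_flow.
Qed.

Lemma C1t_comp_flow (xi : R) (u v : R -> R -> R) : C1t u v ->
  C1t (fun x t => u xi (tau xi x t)) (fun x t => v xi (tau xi x t) * tau_t mt tau xi x t).
Proof.
  intros (H1 & H2 & H3). split; [|split].
  - intros p. apply continuous_G0; [exact H1|cnt|apply continuous_flow; cnt].
  - intros p. apply continuous_Rmult.
    + apply continuous_G0; [exact H2|cnt|apply continuous_flow; cnt].
    + apply continuous_flow_t; cnt.
  - intros x t. rewrite Rmult_comm.
    apply (is_derive_comp (u xi) (tau xi x)); [apply H3|apply is_derive_flow].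
Qed.

(** * Derivatives and integrals along characteristics *)

(** A derivative in one direction only: the integral equations give it to a weak solution at a stage
    where neither partial derivative is known to exist. *)
Definition charD (u Y : R -> R -> R) : Prop :=
  forall xi x t, 0 <= xi <= 1 -> is_deriv01 (fun z => u z (tau z x t)) xi (Y xi (tau xi x t)).

Definition lam (Y : R -> R -> R) (x0 x t : R) : R := RInt (fun eta => Y eta (tau eta x t)) x0 x.

Lemma continuous_along (Y : R -> R -> R) (x t : R) :
  G0 Y -> forall eta, continuous (fun eta => Y eta (tau eta x t)) eta.
Proof.
  intros HY eta. apply (continuous_G0 Y (fun q => q)); [exact HY|cnt|apply continuous_flow; cnt].
Qed.

Lemma charD_int (u Y : R -> R -> R) : G0 Y -> charD u Y ->
  forall x xi t, 0 <= x <= 1 -> 0 <= xi <= 1 ->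
    u xi (tau xi x t) - u x t = RInt (fun eta => Y eta (tau eta x t)) x xi.
Proof.
  intros HY Hu x xi t Hx Hxi.
  pose proof (deriv01_FTC (fun z => u z (tau z x t)) (fun eta => Y eta (tau eta x t))
    (continuous_along Y x t HY) (fun w Hw => Hu w x t Hw) x xi Hx Hxi) as E.
  cbv beta in E. rewrite (flow_init _ _ _ _ _ F) in E. exact E.
Qed.

Lemma charD_lam_eq (u Y : R -> R -> R) (x0 : R) : G0 Y -> charD u Y -> 0 <= x0 <= 1 ->
  forall x t, 0 <= x <= 1 -> u x t = u x0 (tau x0 x t) + lam Y x0 x t.
Proof.
  intros HY Hu Hx0 x t Hx. pose proof (charD_int u Y HY Hu x x0 t Hx Hx0) as E.
  unfold lam. rewrite RInt_swap_R by (apply continuous_along, HY). lra.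
Qed.

Lemma charD_lam (Y : R -> R -> R) (x0 : R) : G0 Y -> charD (lam Y x0) Y.
Proof.
  intros HY xi x t Hxi.
  apply (deriv01_ext (fun z => RInt (fun eta => Y eta (tau eta x t)) x0 z)); [exact Hxi| |].
  - intros y Hy. unfold lam. apply RInt_ext_R. intros eta _. rewrite flow_group. reflexivity.
  - apply deriv01_of_derive. apply (is_derive_RInt_cont (fun eta => Y eta (tau eta x t))).
    apply continuous_along, HY.
Qed.

Lemma charD_eq (u Y Z : R -> R -> R) :
  (forall x t, 0 <= x <= 1 -> Y x t = Z x t) -> charD u Y -> charD u Z.
Proof. intros E H xi x t Hxi. rewrite <- E by assumption. apply H, Hxi. Qed.

Lemma charD_ext (u v Y : R -> R -> R) :
  (forall x t, 0 <= x <= 1 -> u x t = v x t) -> charD u Y -> charD v Y.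
Proof.
  intros E H xi x t Hxi. apply (deriv01_ext (fun z => u z (tau z x t))); [exact Hxi| |].
  - intros y Hy. apply E, Hy.
  - apply H, Hxi.
Qed.

Lemma charD_plus (u v Y Z : R -> R -> R) : charD u Y -> charD v Z ->
  charD (fun x t => u x t + v x t) (fun x t => Y x t + Z x t).
Proof. intros Hu Hv xi x t Hxi. apply deriv01_plus; auto. Qed.

Lemma charD_mult (u v Y Z : R -> R -> R) : charD u Y -> charD v Z ->
  charD (fun x t => u x t * v x t) (fun x t => Y x t * v x t + u x t * Z x t).
Proof.
  intros Hu Hv xi x t Hxi.
  apply (deriv01_mult (fun z => u z (tau z x t)) (fun z => v z (tau z x t))); auto.
Qed.

Lemma charD_exp (u Y : R -> R -> R) : charD u Y ->
  charD (fun x t => exp (u x t)) (fun x t => Y x t * exp (u x t)).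
Proof.
  intros Hu xi x t Hxi. apply (deriv01_exp (fun z => u z (tau z x t))); auto.
Qed.

(** By the group law [tau x0 x t] is the same for all points of one characteristic, so any function
    of it has slope 0 there. *)
Lemma charD_transport (z : R -> R) (x0 : R) : charD (fun x t => z (tau x0 x t)) (fun _ _ => 0).
Proof.
  intros xi x t Hxi.
  apply (deriv01_ext (fun _ => z (tau x0 x t))); [exact Hxi| |apply deriv01_const].
  intros y Hy. rewrite flow_group. reflexivity.
Qed.

(** Together with [pd_of_charD] this trades an x-derivative for a derivative along the flow, the
    difference being the shear term [v * m]. Applying the two with different flows transfers a slope
    from one family of characteristics to the other. *)
Lemma charD_of_pd (u v p : R -> R -> R) : C1t u v ->
  (forall x t, 0 <= x <= 1 -> is_deriv01 (fun y => u y t) x (p x t)) ->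
  charD u (fun x t => p x t + v x t * m x t).
Proof.
  intros Hu Hp xi x t Hxi.
  pose proof (deriv01_shear u v (fun z => tau z x t) xi _ Hxi Hu
    (flow_deriv _ _ _ _ _ F xi x t Hxi)) as H1.
  pose proof (deriv01_plus _ _ _ _ _ Hxi (Hp xi (tau xi x t) Hxi) H1) as H2.
  revert H2. apply deriv01_ext; [exact Hxi|]. intros; ring.
Qed.

Lemma pd_of_charD (u v Y : R -> R -> R) : C1t u v -> charD u Y ->
  forall x t, 0 <= x <= 1 -> is_deriv01 (fun y => u y t) x (Y x t - v x t * m x t).
Proof.
  intros Hu HY x t Hx.
  pose proof (deriv01_shear u v (fun z => tau z x t) x _ Hx Hu
    (flow_deriv _ _ _ _ _ F x x t Hx)) as H1.
  pose proof (HY x x t Hx) as H2.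
  pose proof (deriv01_minus _ _ _ _ _ Hx H2 H1) as H3.
  rewrite !(flow_init _ _ _ _ _ F) in H3.
  revert H3. apply deriv01_ext; [exact Hx|]. intros; ring.
Qed.

Lemma G0_lam (Y : R -> R -> R) (x0 : R) : G0 Y -> G0 (lam Y x0).
Proof.
  intros HY p. unfold lam.
  apply (continuous_RInt_param (fun eta (q : R * R) => Y eta (tau eta (fst q) (snd q)))); try cnt.
  apply continuous_flow; cnt.
Qed.

Lemma C1t_lam (Y Yt : R -> R -> R) (x0 : R) : C1t Y Yt ->
  C1t (lam Y x0)
      (fun x t => RInt (fun eta => Yt eta (tau eta x t) * tau_t mt tau eta x t) x0 x).
Proof.
  intros (H1 & H2 & H3). split; [|split].
  - apply G0_lam, H1.
  - intros p.
    apply (continuous_RInt_param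
      (fun eta (q : R * R) => Yt eta (tau eta (fst q) (snd q)) * tau_t mt tau eta (fst q) (snd q)));
      try cnt; [apply continuous_flow; cnt|apply continuous_flow_t; cnt].
  - intros x t. unfold lam.
    apply (is_derive_RInt_param_cont (fun t eta => Y eta (tau eta x t))
      (fun t eta => Yt eta (tau eta x t) * tau_t mt tau eta x t)).
    + intros p. apply (continuous_G0 Y snd); [exact H1|cnt|apply continuous_flow; cnt].
    + intros p. apply continuous_Rmult.
      * apply (continuous_G0 Yt snd); [exact H2|cnt|apply continuous_flow; cnt].
      * apply continuous_flow_t; cnt.
    + intros s eta. rewrite Rmult_comm.
      apply (is_derive_comp (Y eta) (tau eta x)); [apply H3|apply is_derive_flow].
Qed.

Lemma charD_dt (u v Y Yt : R -> R -> R) : C1t u v -> C1t Y Yt -> charD u Y ->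
  charD v (fun x t => Yt x t - mt x t * v x t).
Proof.
  intros Hu HY HuY xi x t Hxi.
  set (D := fun z => v (clamp x) (tau (clamp x) x t) * tau_t mt tau (clamp x) x t
     + RInt (fun eta => Yt eta (tau eta x t) * tau_t mt tau eta x t) (clamp x) z).
  assert (CY : forall eta, continuous (fun eta => Yt eta (tau eta x t) * tau_t mt tau eta x t) eta).
  { intros eta. apply continuous_Rmult.
    - apply continuous_along, (proj1 (proj2 HY)).
    - apply continuous_flow_t; cnt. }
  assert (E : forall z, 0 <= z <= 1 -> v z (tau z x t) * tau_t mt tau z x t = D z).
  { intros z Hz.
    pose proof (proj2 (proj2 (C1t_comp_flow z u v Hu)) x t) as H1.
    assert (H2 : is_derive (fun s => u z (tau z x s)) t (D z)).
    { apply is_derive_ext with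
        (fun s => u (clamp x) (tau (clamp x) x s) + RInt (fun eta => Y eta (tau eta x s)) (clamp x) z).
      - intros s.
        pose proof (charD_int u Y (proj1 HY) HuY (clamp x) z (tau (clamp x) x s) (clamp_01 x) Hz) as E.
        rewrite flow_group in E. change (u (clamp x) (tau (clamp x) x s) +
          RInt (fun eta => Y eta (tau eta x s)) (clamp x) z = u z (tau z x s)).
        rewrite (RInt_ext_R (fun eta => Y eta (tau eta (clamp x) (tau (clamp x) x s)))
                   (fun eta => Y eta (tau eta x s))) in E; [lra|].
        intros eta _. rewrite flow_group. reflexivity.
      - apply (is_derive_plus (fun s => u (clamp x) (tau (clamp x) x s))
                 (fun s => RInt (fun eta => Y eta (tau eta x s)) (clamp x) z)).
        + apply (proj2 (proj2 (C1t_comp_flow (clamp x) u v Hu))).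
        + apply (is_derive_RInt_param_cont (fun t eta => Y eta (tau eta x t))
            (fun t eta => Yt eta (tau eta x t) * tau_t mt tau eta x t)).
          * intros p. apply (continuous_G0 Y snd); [apply HY|cnt|apply continuous_flow; cnt].
          * intros p. apply continuous_Rmult.
            -- apply (continuous_G0 Yt snd); [apply HY|cnt|apply continuous_flow; cnt].
            -- apply continuous_flow_t; cnt.
          * intros s eta. rewrite Rmult_comm.
            apply (is_derive_comp (Y eta) (tau eta x)); [apply HY|apply is_derive_flow]. }
    rewrite <- (is_derive_unique _ _ _ H1). apply is_derive_unique, H2. }
  apply (deriv01_ext (fun z => D z * / tau_t mt tau z x t)); [exact Hxi| |].
  - intros y Hy. rewrite <- (E y Hy). field. pose proof (flow_t_pos y x t). lra.
  - pose proof (flow_t_pos xi x t) as Hp.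
    apply (deriv01_eq _ _ ((Yt xi (tau xi x t) * tau_t mt tau xi x t) * / tau_t mt tau xi x t
      + D xi * (- (mt xi (tau xi x t) * tau_t mt tau xi x t) / tau_t mt tau xi x t ^ 2))).
    + rewrite <- (E xi Hxi). field. lra.
    + apply (deriv01_mult D (fun z => / tau_t mt tau z x t)); [exact Hxi| |].
      * apply (deriv01_eq _ _ (0 + Yt xi (tau xi x t) * tau_t mt tau xi x t)); [ring|].
        apply deriv01_plus; [exact Hxi|apply deriv01_const|].
        apply deriv01_of_derive.
        apply (is_derive_RInt_cont (fun eta => Yt eta (tau eta x t) * tau_t mt tau eta x t)).
        exact CY.
      * apply (deriv01_inv (fun z => tau_t mt tau z x t)); [exact Hxi|lra|]. apply flow_t_deriv, Hxi.
Qed.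

(* The substitution [s = tau y x b] fixes the domain of integration in [b]. *)
Lemma deriv01_prim_t (y Y : R -> R -> R) : G0 y -> G0 Y -> charD y Y ->
  forall x t, 0 <= x <= 1 ->
  is_deriv01 (fun z => RInt (y z) 0 t) x
    (- (m x t * y x t) + m x 0 * y x 0 + RInt (fun s => Y x s + mt x s * y x s) 0 t).
Proof.
  intros Hy HY Hch x t Hx.
  set (W := fun x t => RInt (y x) 0 t).
  assert (HW : C1t W y) by (apply C1t_prim, Hy).
  set (g := fun z b => y z (tau z x b) * tau_t mt tau z x b).
  set (g' := fun z b => (Y z (tau z x b) + mt z (tau z x b) * y z (tau z x b)) * tau_t mt tau z x b).
  assert (Hg' : G0 g').
  { intros p. unfold g'. apply continuous_Rmult; [|apply continuous_flow_t; cnt].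
    apply continuous_Rplus; [|apply continuous_Rmult];
      (apply continuous_G0; [assumption|cnt|apply continuous_flow; cnt]). }
  assert (Hg : forall z b, 0 <= z <= 1 -> is_deriv01 (fun w => g w b) z (g' z b)).
  { intros z b Hz. unfold g, g'.
    apply (deriv01_eq _ _ (Y z (tau z x b) * tau_t mt tau z x b +
       y z (tau z x b) * (mt z (tau z x b) * tau_t mt tau z x b))); [ring|].
    apply (deriv01_mult (fun z => y z (tau z x b)) (fun z => tau_t mt tau z x b)); [exact Hz|apply Hch, Hz|apply flow_t_deriv, Hz]. }
  assert (Hgc : forall b, continuous (g x) b).
  { intros b. unfold g. apply continuous_Rmult; [|apply continuous_flow_t; cnt].
    apply continuous_G0; [assumption|cnt|apply continuous_flow; cnt]. }
  pose proof (deriv01_RInt_param g g' 0 t x Hg' Hgc Hg Hx) as H1.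
  (* The substituted integral runs from [tau z x 0] to [tau z x t]; the two shear terms bring its
     limits back to [0] and [t]. *)
  pose proof (deriv01_shear W y (fun z => tau z x t) x _ Hx HW
    (flow_deriv _ _ _ _ _ F x x t Hx)) as H2.
  pose proof (deriv01_shear W y (fun z => tau z x 0) x _ Hx HW
    (flow_deriv _ _ _ _ _ F x x 0 Hx)) as H3.
  pose proof (deriv01_plus _ _ _ _ _ Hx (deriv01_minus _ _ _ _ _ Hx H1 H2) H3) as H4.
  rewrite !(flow_init _ _ _ _ _ F) in H4.
  eapply deriv01_eq; [|eapply deriv01_ext; [exact Hx| |exact H4]].
  - assert (E : RInt (g' x) 0 t = RInt (fun s => Y x s + mt x s * y x s) 0 t).
    { apply RInt_ext_R. intros s _. unfold g'. rewrite (flow_init _ _ _ _ _ F), flow_t_init. ring. }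
    rewrite E. ring.
  - intros z Hz.
    assert (E : RInt (g z) 0 t = RInt (y z) (tau z x 0) (tau z x t)).
    { rewrite <- (RInt_comp (y z) (tau z x) (tau_t mt tau z x)).
      - apply RInt_ext_R. intros b _. unfold g. unfold scal; simpl. unfold mult; simpl. ring.
      - intros b _. apply G0_section, Hy.
      - intros b _. split; [apply is_derive_flow|apply continuous_flow_t; cnt]. }
    cbv beta. rewrite E. unfold W.
    pose proof (RInt_Chasles_R (y z) 0 (tau z x 0) (tau z x t) (G0_section y z Hy)) as E2.
    rewrite RInt_point_R.
    lra.
Qed.

End Flow.

Lemma G0_mult (u v : R -> R -> R) : G0 u -> G0 v -> G0 (fun x t => u x t * v x t).
Proof. intros Hu Hv p. cnt. Qed.

Lemma G0_plus (u v : R -> R -> R) : G0 u -> G0 v -> G0 (fun x t => u x t + v x t).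
Proof. intros Hu Hv p. cnt. Qed.

Lemma G0_minus (u v : R -> R -> R) : G0 u -> G0 v -> G0 (fun x t => u x t - v x t).
Proof. intros Hu Hv p. cnt. Qed.

Lemma G0_prim (y : R -> R -> R) : G0 y -> G0 (fun x t => RInt (y x) 0 t).
Proof. intros Hy. apply (C1t_prim y Hy). Qed.

Lemma C1t_cl_ext (u w v : R -> R -> R) :
  (forall x t, 0 <= x <= 1 -> u x t = w x t) -> C1t u v -> C1t (cl w) (cl v).
Proof.
  intros E H. apply C1t_ext with (cl u) (cl v); [|reflexivity|apply C1t_cl, H].
  intros x t. apply E, clamp_01.
Qed.

(** * Gain of regularity from transversality *)

(* With [W] the [t]-primitive of [y], the transversal equation for [y] computes
   [W_x], and the derivative of [W] along [tau] then equals [2 m y] up to terms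
   that are themselves [t]-primitives or independent of [t]. *)
Lemma lam_transversal (m mt n nt : R -> R -> R) (M L M' L' : R) (tau sig : R -> R -> R -> R)
  (y Y : R -> R -> R) (x0 : R) :
  is_flow m mt M L tau -> is_flow n nt M' L' sig ->
  (forall x t, n x t = - m x t) -> (forall x t, nt x t = - mt x t) ->
  0 <= x0 <= 1 -> G0 y -> G0 Y -> charD sig y Y ->
  exists v, C1t (cl (lam tau (fun x t => m x t * y x t) x0)) v.
Proof.
  intros F F' En Ent Hx0 Hy HY Hch.
  pose proof (proj1 (flow_slope _ _ _ _ _ F)) as Hm.
  pose proof (proj1 (proj2 (flow_slope _ _ _ _ _ F))) as Hmt.
  set (W := fun x t => RInt (y x) 0 t).
  set (V := fun x t => RInt (fun s => Y x s - mt x s * y x s) 0 t).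
  set (my0 := fun x (_ : R) => m x 0 * y x 0).
  set (my := fun x t => m x t * y x t).
  assert (HW : C1t W y) by (apply C1t_prim, Hy).
  assert (HYm : G0 (fun x s => Y x s - mt x s * y x s)) by (intros p; cnt).
  assert (HV : C1t V (fun x s => Y x s - mt x s * y x s)) by exact (C1t_prim _ HYm).
  assert (Hmy0 : C1t my0 (fun _ _ => 0)).
  { apply (C1t_frozen (fun x => m x 0 * y x 0)). intros; cnt. }
  assert (Hmy : G0 my) by (apply G0_mult; assumption).
  assert (Wx : forall x t, 0 <= x <= 1 ->
    is_deriv01 (fun z => W z t) x (my x t - my0 x t + V x t)).
  { intros x t Hx.
    pose proof (deriv01_prim_t _ _ _ _ _ F' y Y Hy HY Hch x t Hx) as H.
    eapply deriv01_eq; [|exact H]. unfold my, my0, V. rewrite !En.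
    rewrite (RInt_ext_R (fun s => Y x s + nt x s * y x s) (fun s => Y x s - mt x s * y x s));
      [ring|]. intros s _. rewrite Ent. ring. }
  pose proof (charD_of_pd _ _ _ _ _ F W y _ HW Wx) as HWc.
  assert (GR : G0 (fun x t => V x t - my0 x t)) by (apply G0_minus; [apply HV|apply Hmy0]).
  assert (GD : G0 (fun x t => my x t - my0 x t + V x t + y x t * m x t)).
  { pose proof (proj1 HV). pose proof (proj1 Hmy0). intros p. cnt. }
  (* Transversality acts here: because [n = - m], the term [m * y] in [W_x] and the term [m * W_t]
     add up, whereas for a single family they would cancel. The factor [1 / 2] undoes the
     doubling. *)
  assert (E : forall x t, 0 <= x <= 1 ->
    1 / 2 * (W x t - W x0 (tau x0 x t) - lam tau (fun x t => V x t - my0 x t) x0 x t)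
    = lam tau my x0 x t).
  { intros x t Hx.
    rewrite (charD_lam_eq _ _ _ _ _ F W _ x0 GD HWc Hx0 x t Hx).
    assert (E : lam tau (fun x t => my x t - my0 x t + V x t + y x t * m x t) x0 x t
      = 2 * lam tau my x0 x t + lam tau (fun x t => V x t - my0 x t) x0 x t).
    { unfold lam. rewrite <- RInt_scal_R by exact (continuous_along _ _ _ _ _ F my x t Hmy).
      rewrite <- RInt_plus_R.
      - apply RInt_ext_R. intros eta _. unfold my. ring.
      - intros eta. apply continuous_Rmult; [apply continuous_const|].
        exact (continuous_along _ _ _ _ _ F my x t Hmy eta).
      - exact (continuous_along _ _ _ _ _ F _ x t GR). }
    rewrite E. unfold my. field. }
  eexists. eapply C1t_cl_ext; [exact E|].
  apply C1t_scal. apply C1t_minus; [apply C1t_minus; [exact HW|]|].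
  - exact (C1t_comp_flow _ _ _ _ _ F x0 W y HW).
  - apply (C1t_lam _ _ _ _ _ F). apply C1t_minus; [exact HV|exact Hmy0].
Qed.

(** * A functional equation *)

Definition C1f (f f' : R -> R) : Prop :=
  (forall t, continuous f' t) /\ forall t, is_derive f t (f' t).

Lemma C1f_cont (f f' : R -> R) : C1f f f' -> forall t, continuous f t.
Proof. intros [_ H] t. apply (ex_derive_continuous f). exists (f' t). apply H. Qed.

Lemma C1f_comp (f f' g g' : R -> R) :
  C1f f f' -> C1f g g' -> C1f (fun t => f (g t)) (fun t => g' t * f' (g t)).
Proof.
  intros Hf Hg. pose proof (C1f_cont _ _ Hg) as Cg. destruct Hf as [C1 D1], Hg as [C2 D2]. split.
  - intros t. cnt.
  - intros t. apply (is_derive_comp f g); auto.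
Qed.

Lemma C1f_mult (f f' g g' : R -> R) :
  C1f f f' -> C1f g g' -> C1f (fun t => f t * g t) (fun t => f' t * g t + f t * g' t).
Proof.
  intros Hf Hg. pose proof (C1f_cont _ _ Hf) as Cf. pose proof (C1f_cont _ _ Hg) as Cg.
  destruct Hf as [C1 D1], Hg as [C2 D2]. split.
  - intros t. cnt.
  - intros t. apply is_derive_Rmult; auto.
Qed.

Lemma C1f_plus (f f' g g' : R -> R) :
  C1f f f' -> C1f g g' -> C1f (fun t => f t + g t) (fun t => f' t + g' t).
Proof.
  intros [C1 D1] [C2 D2]. split.
  - intros t. cnt.
  - intros t. apply (is_derive_plus f g); auto.
Qed.

Lemma C1f_const (c : R) : C1f (fun _ => c) (fun _ => 0).
Proof. split; intros t; [cnt|apply (is_derive_const c)]. Qed.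

Lemma C1f_scal (c : R) (f f' : R -> R) : C1f f f' -> C1f (fun t => c * f t) (fun t => c * f' t).
Proof.
  intros [C1 D1]. split; intros t; [cnt|].
  exact (is_derive_scal f t c _ (D1 t)).
Qed.

Lemma geometric_cauchy (y : nat -> R) (A rho : R) :
  0 <= A -> 0 < rho < 1 -> (forall n, Rabs (y (S n) - y n) <= A * rho ^ n) ->
  exists l, forall n, Rabs (y n - l) <= A / (1 - rho) * rho ^ n.
Proof.
  intros HA Hrho Hy.
  (* The factor [1 - rho ^ p] makes the bound an exact partial geometric sum, so the induction on
     [p] closes with equality. *)
  assert (Hb : forall p n, Rabs (y (n + p)%nat - y n) <= A / (1 - rho) * rho ^ n * (1 - rho ^ p)).
  { induction p as [|p IH]; intros n.
    - rewrite Nat.add_0_r, Rminus_diag, Rabs_R0. simpl. right. ring.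
    - replace (n + S p)%nat with (S (n + p)) by lia.
      replace (y (S (n + p)) - y n) with ((y (S (n + p)) - y (n + p)%nat) + (y (n + p)%nat - y n))
        by ring.
      eapply Rle_trans; [apply Rabs_triang|].
      eapply Rle_trans; [apply Rplus_le_compat; [apply Hy|apply IH]|].
      right. rewrite pow_add. simpl. field. lra. }
  set (B := A / (1 - rho)). fold B in Hb.
  assert (HB : 0 <= B) by (unfold B; apply Rdiv_le_0_compat; lra).
  assert (Hpow : forall n, 0 < rho ^ n) by (intros n; apply pow_lt; lra).
  assert (Hb' : forall n p, Rabs (y (n + p)%nat - y n) <= B * rho ^ n).
  { intros n p. eapply Rle_trans; [apply Hb|]. rewrite <- (Rmult_1_r (B * rho ^ n)) at 2.
    apply Rmult_le_compat_l.
    - apply Rmult_le_pos; [exact HB|left; apply Hpow].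
    - pose proof (Hpow p). lra. }
  assert (Hlim : Un_cv (fun n => B * rho ^ n) 0).
  { intros eps Heps. destruct (pow_lt_1_zero rho) with (y := eps / (B + 1)) as [N HN].
    - rewrite Rabs_pos_eq; lra.
    - apply Rdiv_lt_0_compat; lra.
    - exists N. intros n Hn. unfold R_dist. rewrite Rminus_0_r.
      rewrite Rabs_mult, (Rabs_pos_eq B) by exact HB.
      apply Rle_lt_trans with ((B + 1) * Rabs (rho ^ n)).
      + apply Rmult_le_compat_r; [apply Rabs_pos|lra].
      + apply Rlt_le_trans with ((B + 1) * (eps / (B + 1))).
        * apply Rmult_lt_compat_l; [lra|apply HN, Hn].
        * right. field. lra. }
  destruct (Rcomplete.R_complete y) as [l Hl].
  { intros eps Heps. destruct (Hlim (eps / 2)) as [N HN]; [lra|]. exists N.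
    assert (HNb : B * rho ^ N < eps / 2).
    { specialize (HN N (Nat.le_refl N)). unfold R_dist in HN. rewrite Rminus_0_r in HN.
      eapply Rle_lt_trans; [apply Rle_abs|exact HN]. }
    intros n q Hn Hq. unfold R_dist.
    replace n with (N + (n - N))%nat by lia. replace q with (N + (q - N))%nat by lia.
    replace (y (N + (n - N))%nat - y (N + (q - N))%nat)
      with ((y (N + (n - N))%nat - y N) - (y (N + (q - N))%nat - y N)) by ring.
    eapply Rle_lt_trans; [apply Rabs_triang|]. rewrite Rabs_Ropp.
    pose proof (Hb' N (n - N)%nat). pose proof (Hb' N (q - N)%nat). lra. }
  exists l. intros n. fold B. apply Rnot_lt_le. intros Hlt.
  destruct (Hl (Rabs (y n - l) - B * rho ^ n)) as [N HN]; [lra|].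
  specialize (HN (n + N)%nat ltac:(lia)). unfold R_dist in HN.
  pose proof (Hb' n N) as H1.
  assert (Rabs (y n - l) <= Rabs (y (n + N)%nat - y n) + Rabs (y (n + N)%nat - l)); [|lra].
  rewrite <- (Rabs_Ropp (y (n + N)%nat - y n)).
  replace (y n - l) with (- (y (n + N)%nat - y n) + (y (n + N)%nat - l)) by ring.
  apply Rabs_triang.
Qed.

Lemma uniform_C1_limit (f f' : nat -> R -> R) (z y : R -> R) (A B rho : R) :
  0 < rho < 1 -> 0 <= B ->
  (forall n, C1f (f n) (f' n)) ->
  (forall n t, Rabs (f n t - z t) <= A * rho ^ n) ->
  (forall n t, Rabs (f' n t - y t) <= B * rho ^ n) ->
  C1f z y.
Proof.
  intros Hrho HB Hf Hz Hy.
  assert (Hsmall : forall K eps, 0 < eps -> exists N, forall n, (N <= n)%nat -> K * rho ^ n < eps).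
  { intros K eps Heps. destruct (pow_lt_1_zero rho) with (y := eps / (Rabs K + 1)) as [N HN].
    - rewrite Rabs_pos_eq; lra.
    - apply Rdiv_lt_0_compat; [lra|pose proof (Rabs_pos K); lra].
    - exists N. intros n Hn. eapply Rle_lt_trans; [apply Rle_abs|].
      pose proof (Rabs_pos K). rewrite Rabs_mult.
      apply Rle_lt_trans with ((Rabs K + 1) * Rabs (rho ^ n)).
      + apply Rmult_le_compat_r; [apply Rabs_pos|lra].
      + apply Rlt_le_trans with ((Rabs K + 1) * (eps / (Rabs K + 1))).
        * apply Rmult_lt_compat_l; [lra|apply HN, Hn].
        * right. field. lra. }
  assert (Hcvu : forall c r, CVU f' y c r).
  { intros c r eps Heps. destruct (Hsmall B eps Heps) as [N HN]. exists N.
    intros n t Hn _. rewrite Rabs_minus_sym. eapply Rle_lt_trans; [apply Hy|apply HN, Hn]. }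
  assert (Hyc : forall t, continuity_pt y t).
  { intros t. apply (CVU_continuity f' y t (mkposreal 1 Rlt_0_1)).
    - apply Hcvu.
    - intros n s _. apply continuity_pt_filterlim. apply (proj1 (Hf n)).
    - unfold Boule. rewrite Rminus_diag, Rabs_R0. exact Rlt_0_1. }
  split.
  - intros t. apply continuity_pt_filterlim, Hyc.
  - intros t. apply is_derive_Reals.
    apply (derivable_pt_lim_CVU f f' z y t t (mkposreal 1 Rlt_0_1)).
    + unfold Boule. rewrite Rminus_diag, Rabs_R0. exact Rlt_0_1.
    + intros s n _. apply is_derive_Reals. apply (proj2 (Hf n)).
    + intros s _ eps Heps. destruct (Hsmall A eps Heps) as [N HN]. exists N.
      intros n Hn. unfold R_dist. eapply Rle_lt_trans; [apply Hz|apply HN, Hn].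
    + apply Hcvu.
    + intros s _. apply Hyc.
Qed.

(** The iterates started at 0 converge to the given bounded [z] since [|ka| <= q]. Their derivatives
    obey a recursion with factor [ka * phi'], whence the second bound. Differentiability of [z] is
    inherited from the smooth iterates. *)
Lemma contraction_C1 (ka ka' phi phi' h h' z : R -> R) (q B C H : R) :
  C1f ka ka' -> C1f phi phi' -> C1f h h' ->
  0 < q < 1 ->
  (forall t, Rabs (ka t) <= q) -> (forall t, Rabs (ka t * phi' t) <= q) ->
  (forall t, Rabs (z t) <= B) -> (forall t, Rabs (ka' t) <= C) -> (forall t, Rabs (h' t) <= H) ->
  (forall t, z t = ka t * z (phi t) + h t) ->
  exists y, C1f z y.
Proof.
  intros Hka Hphi Hh Hq Kq Kq' HB HC HH Ez.
  set (f := fix f (n : nat) : R -> R := match n with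
     | O => fun _ => 0 | S n => fun t => ka t * f n (phi t) + h t end).
  set (f' := fix f' (n : nat) : R -> R := match n with
     | O => fun _ => 0
     | S n => fun t => ka' t * f n (phi t) + ka t * (phi' t * f' n (phi t)) + h' t end).
  assert (Hf : forall n, C1f (f n) (f' n)).
  { induction n as [|n IH]; [apply C1f_const|].
    apply C1f_plus; [|exact Hh]. apply C1f_mult; [exact Hka|]. apply C1f_comp; assumption. }
  assert (B0 : 0 <= B) by (eapply Rle_trans; [apply Rabs_pos|apply (HB 0)]).
  assert (C0 : 0 <= C) by (eapply Rle_trans; [apply Rabs_pos|apply (HC 0)]).
  assert (H0 : 0 <= H) by (eapply Rle_trans; [apply Rabs_pos|apply (HH 0)]).
  assert (Hqn : forall n, 0 < q ^ n) by (intros n; apply pow_lt; lra).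
  assert (Hz : forall n t, Rabs (f n t - z t) <= B * q ^ n).
  { induction n as [|n IH]; intros t.
    - simpl. replace (0 - z t) with (- z t) by ring. rewrite Rabs_Ropp, Rmult_1_r. apply HB.
    - rewrite (Ez t). simpl.
      replace (ka t * f n (phi t) + h t - (ka t * z (phi t) + h t))
        with (ka t * (f n (phi t) - z (phi t))) by ring.
      rewrite Rabs_mult. replace (B * (q * q ^ n)) with (q * (B * q ^ n)) by ring.
      apply Rmult_le_compat; try apply Rabs_pos; auto. }
  assert (Hff : forall n t, Rabs (f (S n) t - f n t) <= 2 * B * q ^ n).
  { intros n t. replace (f (S n) t - f n t) with ((f (S n) t - z t) - (f n t - z t)) by ring.
    eapply Rle_trans; [apply Rabs_triang|]. rewrite Rabs_Ropp.
    pose proof (Hz (S n) t) as H1. pose proof (Hz n t) as H2.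
    assert (B * q ^ S n <= B * q ^ n); [|lra].
    apply Rmult_le_compat_l; [exact B0|]. simpl. pose proof (Hqn n). nra. }
  (* The increments of the derivatives satisfy [d_(n+1) <= q * d_n + 2 * C * B * q ^ n], a resonant
     recursion allowing growth like [n * q ^ n]; a rate strictly between [q] and 1 absorbs it. [A]
     is chosen to dominate [H] and to satisfy [q * A + 2 * C * B <= rho * A]. *)
  set (rho := (1 + q) / 2).
  assert (Hrho : q < rho < 1) by (unfold rho; lra).
  set (A := H + 2 * C * B / (rho - q)).
  assert (A0 : 0 <= A).
  { unfold A. apply Rplus_le_le_0_compat; [exact H0|].
    apply Rdiv_le_0_compat; [|lra]. apply Rmult_le_pos; lra. }
  assert (HAq : q * A + 2 * C * B <= rho * A).
  { assert (E : (rho - q) * A = (rho - q) * H + 2 * C * B) by (unfold A; field; lra).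
    assert (0 <= (rho - q) * H) by (apply Rmult_le_pos; lra). lra. }
  assert (Hqr : forall n, q ^ n <= rho ^ n) by (intros n; apply pow_incr; lra).
  assert (Hrn : forall n, 0 < rho ^ n) by (intros n; apply pow_lt; lra).
  assert (Hy : forall n t, Rabs (f' (S n) t - f' n t) <= A * rho ^ n).
  { induction n as [|n IH]; intros t.
    - simpl. replace (ka' t * 0 + ka t * (phi' t * 0) + h' t - 0) with (h' t) by ring.
      rewrite Rmult_1_r. eapply Rle_trans; [apply HH|]. unfold A.
      assert (0 <= 2 * C * B / (rho - q)); [|lra].
      apply Rdiv_le_0_compat; [|lra]. apply Rmult_le_pos; lra.
    - assert (E : f' (S (S n)) t - f' (S n) t
        = ka' t * (f (S n) (phi t) - f n (phi t)) +
          (ka t * phi' t) * (f' (S n) (phi t) - f' n (phi t))).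
      { transitivity (ka' t * f (S n) (phi t) + ka t * (phi' t * f' (S n) (phi t)) + h' t -
          (ka' t * f n (phi t) + ka t * (phi' t * f' n (phi t)) + h' t)); [reflexivity|ring]. }
      rewrite E.
      eapply Rle_trans; [apply Rabs_triang|].
      rewrite (Rabs_mult (ka' t)), (Rabs_mult (ka t * phi' t)).
      apply Rle_trans with (C * (2 * B * q ^ n) + q * (A * rho ^ n)).
      + apply Rplus_le_compat; apply Rmult_le_compat; try apply Rabs_pos; auto.
      + apply Rle_trans with (C * (2 * B * rho ^ n) + q * (A * rho ^ n)).
        * apply Rplus_le_compat_r. apply Rmult_le_compat_l; [exact C0|].
          apply Rmult_le_compat_l; [lra|apply Hqr].
        * replace (C * (2 * B * rho ^ n) + q * (A * rho ^ n)) with ((q * A + 2 * C * B) * rho ^ n)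
            by ring.
          simpl. replace (A * (rho * rho ^ n)) with ((rho * A) * rho ^ n) by ring.
          apply Rmult_le_compat_r; [left; apply Hrn|exact HAq]. }
  assert (Hlim : forall t, exists l, forall n, Rabs (f' n t - l) <= A / (1 - rho) * rho ^ n).
  { intros t. apply geometric_cauchy; [exact A0|lra|]. intros n. apply Hy. }
  set (y := fun t => proj1_sig (constructive_indefinite_description _ (Hlim t))).
  exists y. apply (uniform_C1_limit f f' z y B (A / (1 - rho)) rho).
  - lra.
  - apply Rdiv_le_0_compat; lra.
  - exact Hf.
  - intros n t. eapply Rle_trans; [apply Hz|]. apply Rmult_le_compat_l; [exact B0|apply Hqr].
  - intros n t. exact (proj2_sig (constructive_indefinite_description _ (Hlim t)) n).
Qed.

(** * Periodic functions of time and the trace equation *)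

Definition per (T : R) (f : R -> R) : Prop := forall t, f (t + T) = f t.

Lemma per_Z (T : R) (f : R -> R) : per T f -> forall n t, f (t + IZR n * T) = f t.
Proof.
  intros Hf n. induction n as [|n IH|n IH] using Z.peano_ind; intros t.
  - f_equal. ring.
  - rewrite succ_IZR. replace (t + (IZR n + 1) * T) with ((t + IZR n * T) + T) by ring.
    rewrite Hf. apply IH.
  - rewrite <- Z.sub_1_r, minus_IZR.
    replace (t + (IZR n - 1) * T) with ((t - T) + IZR n * T) by ring.
    rewrite IH. rewrite <- (Hf (t - T)). f_equal. ring.
Qed.

Lemma per_max (T : R) (f : R -> R) : 0 < T -> per T f -> (forall t, continuous f t) ->
  exists s, forall t, f t <= f s.
Proof.
  intros HT Hf Hc. destruct (continuity_ab_maj f 0 T) as [s [Hs _]].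
  - lra.
  - intros t _. apply continuity_pt_filterlim, Hc.
  - exists s. intros t.
    destruct (base_Int_part (t / T)) as [H1 H2].
    rewrite <- (per_Z T f Hf (- Int_part (t / T)) t). apply Hs.
    rewrite opp_IZR. set (n := IZR (Int_part (t / T))) in *.
    assert (E : t = t / T * T) by (field; lra).
    split; rewrite E; nra.
Qed.

Lemma per_bounded (T : R) (f : R -> R) : 0 < T -> per T f -> (forall t, continuous f t) ->
  exists B, forall t, Rabs (f t) <= B.
Proof.
  intros HT Hf Hc. destruct (per_max T (fun t => Rabs (f t)) HT) as [s Hs].
  - intros t. rewrite Hf. reflexivity.
  - intros t. apply (continuous_comp f Rabs); [apply Hc|apply continuous_Rabs].
  - exists (Rabs (f s)). exact Hs.
Qed.

Lemma per_derive (T : R) (f f' : R -> R) : per T f -> (forall t, is_derive f t (f' t)) -> per T f'.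
Proof.
  intros Hf Hd t. rewrite <- (is_derive_unique f t (f' t) (Hd t)). symmetry.
  apply is_derive_unique. apply is_derive_ext with (fun s => f (s + T)); [exact Hf|].
  assert (E : f' (t + T) = 1 * f' (t + T)) by ring. rewrite E.
  apply (is_derive_comp f (fun s => s + T)); [apply Hd|]. auto_derive; [trivial|ring].
Qed.

Lemma shift_derive (T : R) (f f' : R -> R) :
  (forall t, f (t + T) = f t + T) -> (forall t, is_derive f t (f' t)) -> per T f'.
Proof.
  intros Hf Hd t.
  assert (H : per T (fun t => f' t - 1)).
  { apply (per_derive T (fun t => f t - t)).
    - intros s. rewrite Hf. ring.
    - intros s. apply (is_derive_minus f (fun s => s)); [apply Hd|apply (is_derive_id s)]. }
  specialize (H t). simpl in H. lra.
Qed.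

(** Periodicity makes maxima attained, so strict pointwise inequalities yield a single [q < 1], and
    it bounds [z], [ka'] and [h']. The periodicity of [h] is forced by the equation. *)
Lemma contraction_C1_per (T : R) (ka ka' phi phi' h h' z : R -> R) :
  0 < T -> C1f ka ka' -> C1f phi phi' -> C1f h h' -> (forall t, continuous z t) ->
  per T ka -> per T z -> (forall t, phi (t + T) = phi t + T) ->
  (forall t, 0 < ka t) -> (forall t, 0 < phi' t) ->
  (forall t, ka t < 1 /\ ka t * phi' t < 1) ->
  (forall t, z t = ka t * z (phi t) + h t) ->
  exists y, C1f z y.
Proof.
  intros HT Hka Hphi Hh Hz Pka Pz Pphi Ka0 Phi0 Hlt Ez.
  assert (Ph : per T h).
  { intros t. pose proof (Ez (t + T)) as E1. pose proof (Ez t) as E2.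
    rewrite Pphi, Pka, !Pz in E1. lra. }
  pose proof (per_derive T ka ka' Pka (proj2 Hka)) as Pka'.
  pose proof (per_derive T h h' Ph (proj2 Hh)) as Ph'.
  pose proof (shift_derive T phi phi' Pphi (proj2 Hphi)) as Pphi'.
  pose proof (C1f_cont _ _ Hka) as Cka.
  pose proof (proj1 Hphi) as Cphi'.
  destruct (per_bounded T z HT Pz Hz) as [B HB].
  destruct (per_bounded T ka' HT Pka' (proj1 Hka)) as [C HC].
  destruct (per_bounded T h' HT Ph' (proj1 Hh)) as [H HH].
  destruct (per_max T ka HT Pka Cka) as [s1 Hs1].
  destruct (per_max T (fun t => ka t * phi' t) HT) as [s2 Hs2].
  { intros t. rewrite Pka, Pphi'. reflexivity. }
  { intros t. cnt. }
  destruct (Hlt s1) as [L1 _]. destruct (Hlt s2) as [_ L2].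
  apply (contraction_C1 ka ka' phi phi' h h' z (Rmax (ka s1) (ka s2 * phi' s2)) B C H);
    try assumption.
  - split; [eapply Rlt_le_trans; [apply (Ka0 s1)|apply Rmax_l]|apply Rmax_lub_lt; assumption].
  - intros t. rewrite Rabs_pos_eq by (left; apply Ka0).
    eapply Rle_trans; [apply Hs1|apply Rmax_l].
  - intros t. rewrite Rabs_pos_eq by (left; apply Rmult_lt_0_compat; auto).
    eapply Rle_trans; [apply Hs2|apply Rmax_r].
Qed.

Lemma C1f_inv (f f' : R -> R) : (forall t, f t <> 0) -> C1f f f' ->
  C1f (fun t => / f t) (fun t => - f' t * (/ f t * / f t)).
Proof.
  intros Hn Hf. pose proof (C1f_cont _ _ Hf) as Cf. destruct Hf as [C1 D1]. split.
  - intros t. assert (Ci : forall t, continuous (fun t => / f t) t).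
    { intros s. apply (continuous_Rinv_all f); [exact Hn|apply Cf]. }
    apply continuous_Rmult; [cnt|]. apply continuous_Rmult; apply Ci.
  - intros t. replace (- f' t * (/ f t * / f t)) with (- f' t / f t ^ 2) by (field; apply Hn).
    apply is_derive_inv; auto.
Qed.

(* When the factor exceeds 1 the equation is solved for [z (phi t)] instead. *)
Lemma functional_C1 (T : R) (ka ka' phi phi' th th' h h' z : R -> R) :
  0 < T -> C1f ka ka' -> C1f phi phi' -> C1f th th' -> C1f h h' -> (forall t, continuous z t) ->
  per T ka -> per T z -> (forall t, phi (t + T) = phi t + T) -> (forall t, th (t + T) = th t + T) ->
  (forall t, phi (th t) = t) ->
  (forall t, 0 < ka t) -> (forall t, 0 < phi' t) ->
  (forall t, ka t < 1 /\ ka t * phi' t < 1) \/ (forall t, 1 < ka t /\ 1 < ka t * phi' t) ->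
  (forall t, z t = ka t * z (phi t) + h t) ->
  exists y, C1f z y.
Proof.
  intros HT Hka Hphi Hth Hh Hz Pka Pz Pphi Pth Eth Ka0 Phi0 [Hlt|Hgt] Ez.
  - apply (contraction_C1_per T ka ka' phi phi' h h' z); assumption.
  - assert (Hn : forall t, ka (th t) <> 0) by (intros t; apply Rgt_not_eq, Ka0).
    pose proof (C1f_inv _ _ Hn (C1f_comp _ _ _ _ Hka Hth)) as Hk1.
    assert (Eth' : forall t, th' t * phi' (th t) = 1).
    { intros t. pose proof (proj2 (C1f_comp _ _ _ _ Hphi Hth) t) as D.
      apply is_derive_unique in D. simpl in D. rewrite <- D.
      apply is_derive_unique. apply is_derive_ext with (fun s => s).
      - intros s. symmetry. apply Eth.
      - apply (is_derive_id t). }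
    assert (Th0 : forall t, 0 < th' t).
    { intros t. pose proof (Phi0 (th t)). pose proof (Eth' t). nra. }
    eapply (contraction_C1_per T (fun t => / ka (th t)) _ th th'
             (fun t => / ka (th t) * (-1 * h (th t))) _ z); try assumption.
    + exact Hk1.
    + apply C1f_mult; [exact Hk1|]. apply C1f_scal. apply C1f_comp; [exact Hh|exact Hth].
    + intros t. rewrite Pth, Pka. reflexivity.
    + intros t. apply Rinv_0_lt_compat, Ka0.
    + intros t. destruct (Hgt (th t)) as [G1 G2]. split.
      * rewrite <- Rinv_1. apply Rinv_lt_contravar; lra.
      * pose proof (Phi0 (th t)) as P0. pose proof (Eth' t) as Et.
        replace (/ ka (th t) * th' t) with (/ (ka (th t) * phi' (th t))).
        -- rewrite <- Rinv_1. apply Rinv_lt_contravar; lra.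
        -- assert (Ei : th' t = / phi' (th t)) by (apply Rmult_eq_reg_r with (phi' (th t)); [rewrite Et; field; lra|lra]).
           rewrite Ei. field. split; [lra|apply Hn].
    + intros t. pose proof (Ez (th t)) as E. rewrite Eth in E. rewrite E. field. apply Hn.
Qed.

(** Eliminating [z2] leaves an equation for [z1] with return map [psi1 (psi2 t)] and factor
    [exp (la t + lb (psi2 t))]. That factor times the derivative of the return map is the same
    exponential built from [la1] and [lb1], so the two sign conditions are exactly the two
    inequalities of [functional_C1]. *)
Lemma trace_C1 (T : R) (z1 z2 la la' lb lb' psi1 psi1' psi2 psi2' th1 th1' th2 th2' P P' Q Q'
    la1 lb1 : R -> R) :
  0 < T ->
  C1f la la' -> C1f lb lb' -> C1f psi1 psi1' -> C1f psi2 psi2' -> C1f th1 th1' -> C1f th2 th2' ->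
  C1f P P' -> C1f Q Q' -> (forall t, continuous z1 t) -> per T z1 -> per T la -> per T lb ->
  (forall t, psi1 (t + T) = psi1 t + T) -> (forall t, psi2 (t + T) = psi2 t + T) ->
  (forall t, th1 (t + T) = th1 t + T) -> (forall t, th2 (t + T) = th2 t + T) ->
  (forall t, psi1 (th1 t) = t) -> (forall t, psi2 (th2 t) = t) ->
  (forall t, 0 < psi1' t) -> (forall t, 0 < psi2' t) ->
  (forall t, exp (la1 t) = exp (la t) * psi2' t) ->
  (forall t, exp (lb1 t) = exp (lb t) * psi1' t) ->
  (forall t, la t + lb (psi2 t) < 0 /\ la1 t + lb1 (psi2 t) < 0) \/
  (forall t, 0 < la t + lb (psi2 t) /\ 0 < la1 t + lb1 (psi2 t)) ->
  (forall t, z1 t = exp (la t) * z2 (psi2 t) + P t) ->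
  (forall t, z2 t = exp (lb t) * z1 (psi1 t) + Q t) ->
  exists y, C1f z1 y.
Proof.
  intros HT Ha Hb Hp1 Hp2 Ht1 Ht2 HP HQ Hz Pz Pa Pb Sp1 Sp2 St1 St2 Et1 Et2 Q1 Q2 Ea Eb HC E1 E2.
  set (ka := fun t => exp (la t + lb (psi2 t))).
  assert (Hka : exists ka', C1f ka ka').
  { pose proof (C1f_plus _ _ _ _ Ha (C1f_comp _ _ _ _ Hb Hp2)) as Hs.
    eexists. apply (C1f_comp exp exp); [|exact Hs].
    split; intros t; [apply continuous_exp|apply is_derive_exp]. }
  destruct Hka as [ka' Hka].
  assert (Hea : exists ea', C1f (fun t => exp (la t)) ea').
  { eexists. apply (C1f_comp exp exp); [|exact Ha].
    split; intros t; [apply continuous_exp|apply is_derive_exp]. }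
  destruct Hea as [ea' Hea].
  assert (Ek : forall t, ka t * (psi2' t * psi1' (psi2 t)) = exp (la1 t + lb1 (psi2 t))).
  { intros t. unfold ka. rewrite !exp_plus, Ea, Eb. ring. }
  eapply (functional_C1 T ka ka' (fun t => psi1 (psi2 t)) (fun t => psi2' t * psi1' (psi2 t))
    (fun t => th2 (th1 t)) _ (fun t => exp (la t) * Q (psi2 t) + P t) _ z1); try assumption.
  - apply C1f_comp; assumption.
  - apply C1f_comp; eassumption.
  - apply C1f_plus; [|exact HP]. apply C1f_mult; [exact Hea|]. apply C1f_comp; eassumption.
  - intros t. unfold ka. rewrite Pa, Sp2, Pb. reflexivity.
  - intros t. rewrite Sp2, Sp1. reflexivity.
  - intros t. rewrite St1, St2. reflexivity.
  - intros t. rewrite Et2, Et1. reflexivity.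
  - intros t. apply exp_pos.
  - intros t. apply Rmult_lt_0_compat; auto.
  - destruct HC as [HC|HC]; [left|right]; intros t; destruct (HC t) as [C1 C2];
      rewrite Ek; unfold ka; rewrite <- exp_0; split; apply exp_increasing; assumption.
  - intros t. rewrite E1, E2. unfold ka. rewrite exp_plus. ring.
Qed.

(** * Systems with reflecting boundary conditions *)

(** The integrating factor [e] removes [al] and leaves the sources [m * (e * b * w)] and [e * ga].
    The second is differentiable in [t] already; the first is handled by [lam_transversal], since
    [e * b * w] has a slope along the other family. So [w] contributes a remainder smoother than [w]
    itself. *)
Lemma transport_gain (m mt n nt : R -> R -> R) (M L M' L' : R) (tau sig : R -> R -> R -> R)
  (x0 : R) (u w al al' b Yb ga ga' Yw : R -> R -> R) :
  is_flow m mt M L tau -> is_flow n nt M' L' sig ->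
  (forall x t, n x t = - m x t) -> (forall x t, nt x t = - mt x t) -> 0 <= x0 <= 1 ->
  G0 u -> G0 w -> C1t al al' -> C1t ga ga' ->
  G0 b -> G0 Yb -> charD sig b Yb -> G0 Yw -> charD sig w Yw ->
  charD tau u (fun x t => al x t * u x t + m x t * b x t * w x t + ga x t) ->
  exists S S', C1t S S' /\
    forall x t, 0 <= x <= 1 ->
      u x t = exp (lam tau al x0 x t) * (u x0 (tau x0 x t) + S x t).
Proof.
  intros F F' En Ent Hx0 Hu Hw Hal Hga Hb HYb Cb HYw Cw Cu.
  pose proof (proj1 (flow_slope _ _ _ _ _ F)) as Hm.
  pose proof (proj1 (flow_slope _ _ _ _ _ F')) as Hnn.
  set (la := lam tau al x0). set (e := fun x t => exp (-1 * la x t)).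
  destruct (C1t_lam _ _ _ _ _ F al al' x0 Hal) as [G1 [G2 D]].
  set (la' := fun x t => RInt (fun eta => al' eta (tau eta x t) * tau_t mt tau eta x t) x0 x) in *.
  assert (Hla : C1t la la') by (split; [exact G1|split; [exact G2|exact D]]). clear G1 G2 D.
  assert (Cla : charD tau la al) by (apply (charD_lam _ _ _ _ _ F), Hal).
  assert (Hla1 : C1t (fun x t => -1 * la x t) (fun x t => -1 * la' x t)) by (apply C1t_scal, Hla).
  pose proof (C1t_exp _ _ Hla1) as He. fold e in He.
  set (e' := fun x t => -1 * la' x t * exp (-1 * la x t)) in *.
  assert (Ce : charD tau e (fun x t => (0 * la x t + -1 * al x t) * e x t)).
  { apply (charD_exp tau (fun x t => -1 * la x t)). apply charD_mult; [|exact Cla].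
    intros xi x t _. apply deriv01_const. }
  assert (Gal : G0 al) by apply Hal. assert (Gla : G0 la) by apply Hla.
  assert (Ge : G0 e) by apply He. assert (Ge' : G0 e') by apply He.
  assert (Gga : G0 ga) by apply Hga.
  (* The slope of [e] is known along [tau]; its x-derivative is extracted from it and recombined
     with the slope [n] of the other family. *)
  assert (Ce' : charD sig e (fun x t => (0 * la x t + -1 * al x t) * e x t - e' x t * m x t
      + e' x t * n x t)).
  { apply (charD_of_pd _ _ _ _ _ F' e e'); [exact He|].
    apply (pd_of_charD _ _ _ _ _ F e e' _ He Ce). }
  set (y := fun x t => e x t * b x t * w x t).
  assert (Hy : G0 y) by (intros p; unfold y; cnt).
  pose proof (charD_mult _ _ _ _ _ (charD_mult _ _ _ _ _ Ce' Cb) Cw) as Cy.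
  cbv beta in Cy. fold y in Cy.
  assert (HS : exists v, C1t (cl (lam tau (fun x t => m x t * y x t) x0)) v).
  { eapply (lam_transversal m mt n nt M L M' L' tau sig y);
      [exact F|exact F'|exact En|exact Ent|exact Hx0|exact Hy| |exact Cy].
    intros p. cnt. }
  destruct HS as [v HS].
  assert (Heg : C1t (fun x t => e x t * ga x t) (fun x t => e' x t * ga x t + e x t * ga' x t))
    by (apply C1t_mult; assumption).
  pose proof (C1t_lam _ _ _ _ _ F _ _ x0 Heg) as HS2.
  pose proof (C1t_plus _ _ _ _ HS HS2) as HSS.
  eexists. eexists. split; [exact HSS|].
  intros x t Hx.
  pose proof (charD_mult _ _ _ _ _ Ce Cu) as Ceu. cbv beta in Ceu.
  assert (Ceu' : charD tau (fun x t => e x t * u x t) (fun x t => m x t * y x t + e x t * ga x t)).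
  { revert Ceu. apply charD_eq. intros x1 t1 _. unfold y. ring. }
  assert (Gmy : G0 (fun x t => m x t * y x t)) by (apply G0_mult; assumption).
  assert (Geg : G0 (fun x t => e x t * ga x t)) by (apply G0_mult; assumption).
  pose proof (charD_lam_eq _ _ _ _ _ F _ _ x0 (G0_plus _ _ Gmy Geg) Ceu' Hx0 x t Hx) as E.
  cbv beta in E.
  assert (E0 : e x0 (tau x0 x t) = 1).
  { unfold e, la, lam. rewrite RInt_point_R, Rmult_0_r. apply exp_0. }
  assert (El : lam tau (fun x t => m x t * y x t + e x t * ga x t) x0 x t =
     lam tau (fun x t => m x t * y x t) x0 x t + lam tau (fun x t => e x t * ga x t) x0 x t).
  { unfold lam. apply (RInt_plus_R (fun eta => m eta (tau eta x t) * y eta (tau eta x t))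
      (fun eta => e eta (tau eta x t) * ga eta (tau eta x t))).
    - exact (continuous_along _ _ _ _ _ F _ x t Gmy).
    - exact (continuous_along _ _ _ _ _ F _ x t Geg). }
  rewrite El, E0 in E. unfold cl. rewrite (clamp_id x Hx).
  assert (Ee : exp (la x t) * e x t = 1).
  { unfold e. rewrite <- exp_plus. replace (la x t + -1 * la x t) with 0 by ring. apply exp_0. }
  change (lam tau al x0 x t) with (la x t).
  transitivity (exp (la x t) * (e x t * u x t)).
  - rewrite <- Rmult_assoc, Ee. ring.
  - rewrite E. ring.
Qed.

(** * The classes C^l on the closed strip *)

(** The counterpart of [Cl] for clamped functions: continuity and t-derivatives hold on the whole
    plane, x-derivatives relative to [0,1]. Existential derivatives spare any computation with the
    [epsilon]-chosen one. *)
Fixpoint CK (l : nat) (u : R -> R -> R) : Prop :=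
  match l with
  | O => G0 u
  | S n => G0 u /\ exists p q,
      (forall x t, 0 <= x <= 1 -> is_deriv01 (fun y => u y t) x (p x t)) /\
      (forall x t, is_derive (fun s => u x s) t (q x t)) /\ CK n p /\ CK n q
  end.

Lemma CK_G0 (l : nat) (u : R -> R -> R) : CK l u -> G0 u.
Proof. destruct l; simpl; tauto. Qed.

Lemma G0_ext (u v : R -> R -> R) : (forall x t, u x t = v x t) -> G0 u -> G0 v.
Proof.
  intros E H p. apply continuous_ext with (fun q => u (fst q) (snd q)); [intros; apply E|apply H].
Qed.

Lemma CK_ext (l : nat) (u v : R -> R -> R) : (forall x t, u x t = v x t) -> CK l u -> CK l v.
Proof.
  intros E. destruct l as [|l]; [apply G0_ext, E|].
  intros (H & p & q & Hp & Hq & Kp & Kq). split; [revert H; apply G0_ext, E|].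
  exists p, q. split; [|split; [|split; assumption]].
  - intros x t Hx. apply (deriv01_ext (fun y => u y t)); auto.
  - intros x t. apply is_derive_ext with (fun s => u x s); auto.
Qed.

Lemma CK_pred (l : nat) : forall u, CK (S l) u -> CK l u.
Proof.
  induction l as [|l IH]; intros u (H & p & q & Hp & Hq & Kp & Kq); [exact H|].
  split; [exact H|]. exists p, q. split; [|split; [|split]]; auto.
Qed.

Lemma CK_le (l n : nat) (u : R -> R -> R) : (l <= n)%nat -> CK n u -> CK l u.
Proof.
  intros H. induction H as [|n H IH]; [auto|]. intros Hu. apply IH, CK_pred, Hu.
Qed.

Lemma CK_plus (l : nat) : forall u v, CK l u -> CK l v -> CK l (fun x t => u x t + v x t).
Proof.
  induction l as [|l IH]; intros u v; [apply G0_plus|].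
  intros (H & p & q & Hp & Hq & Kp & Kq) (H' & p' & q' & Hp' & Hq' & Kp' & Kq').
  split; [apply G0_plus; assumption|].
  exists (fun x t => p x t + p' x t), (fun x t => q x t + q' x t).
  split; [|split; [|split]]; auto.
  - intros x t Hx. apply (deriv01_plus (fun y => u y t) (fun y => v y t)); auto.
  - intros x t. apply (is_derive_plus (u x) (v x)); auto.
Qed.

Lemma CK_mult (l : nat) : forall u v, CK l u -> CK l v -> CK l (fun x t => u x t * v x t).
Proof.
  induction l as [|l IH]; intros u v; [apply G0_mult|].
  intros Ku Kv. pose proof (CK_pred l u Ku) as Ku'. pose proof (CK_pred l v Kv) as Kv'.
  destruct Ku as (H & p & q & Hp & Hq & Kp & Kq).
  destruct Kv as (H' & p' & q' & Hp' & Hq' & Kp' & Kq').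
  split; [apply G0_mult; assumption|].
  exists (fun x t => p x t * v x t + u x t * p' x t), (fun x t => q x t * v x t + u x t * q' x t).
  split; [|split; [|split]].
  - intros x t Hx. apply (deriv01_mult (fun y => u y t) (fun y => v y t)); auto.
  - intros x t. apply (is_derive_Rmult (u x) (v x)); auto.
  - apply CK_plus; apply IH; assumption.
  - apply CK_plus; apply IH; assumption.
Qed.

Lemma CK_frozen (l : nat) (c : R) : CK l (fun _ _ => c).
Proof.
  revert c. induction l as [|l IH]; intros c; [intros p; cnt|].
  split; [intros p; cnt|]. exists (fun _ _ => 0), (fun _ _ => 0).
  split; [|split; [|split]]; auto.
  - intros x t _. apply deriv01_const.
  - intros x t. apply (is_derive_const c).
Qed.

Lemma CK_scal (l : nat) (c : R) (u : R -> R -> R) : CK l u -> CK l (fun x t => c * u x t).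
Proof. intros H. apply (CK_mult l (fun _ _ => c) u); [apply CK_frozen|exact H]. Qed.

Lemma CK_opp (l : nat) (u : R -> R -> R) : CK l u -> CK l (fun x t => - u x t).
Proof.
  intros H. apply (CK_ext l (fun x t => -1 * u x t)); [intros; ring|]. apply CK_scal, H.
Qed.

Lemma CK_minus (l : nat) (u v : R -> R -> R) : CK l u -> CK l v -> CK l (fun x t => u x t - v x t).
Proof. intros Hu Hv. apply (CK_plus l u (fun x t => - v x t)); [exact Hu|apply CK_opp, Hv]. Qed.

Lemma CK_inv (l : nat) : forall u, (forall x t, u x t <> 0) -> CK l u -> CK l (fun x t => / u x t).
Proof.
  induction l as [|l IH]; intros u Hn.
  - intros H p. simpl in H. apply (continuous_Rinv_all (fun q : R * R => u (fst q) (snd q))); [auto|cnt].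
  - intros Ku. pose proof (IH u Hn (CK_pred l u Ku)) as Ki.
    destruct Ku as (H & p & q & Hp & Hq & Kp & Kq).
    split.
    + intros z. apply (continuous_Rinv_all (fun q : R * R => u (fst q) (snd q))); [auto|cnt].
    + exists (fun x t => - p x t * (/ u x t * / u x t)), (fun x t => - q x t * (/ u x t * / u x t)).
      split; [|split; [|split]].
      * intros x t Hx. apply (deriv01_eq _ _ (- p x t / u x t ^ 2)); [field; auto|].
        apply (deriv01_inv (fun y => u y t)); auto.
      * intros x t. replace (- q x t * (/ u x t * / u x t)) with (- q x t / u x t ^ 2)
          by (field; auto).
        apply (is_derive_inv (u x)); auto.
      * apply CK_mult; [apply CK_opp, Kp|apply CK_mult; exact Ki].
      * apply CK_mult; [apply CK_opp, Kq|apply CK_mult; exact Ki].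
Qed.

Lemma CK_div (l : nat) (u v : R -> R -> R) :
  (forall x t, v x t <> 0) -> CK l u -> CK l v -> CK l (fun x t => u x t / v x t).
Proof. intros Hn Hu Hv. apply CK_mult; [exact Hu|]. apply CK_inv; assumption. Qed.

(** Traces stay functions on the strip, constant in [x], so that boundary data and coefficients live
    in one scale of classes. *)
Lemma CK_trace (l : nat) (x0 : R) : forall u, CK l u -> CK l (fun _ t => u x0 t).
Proof.
  induction l as [|l IH]; intros u Hu.
  - intros p. simpl in Hu. cnt.
  - destruct Hu as (H & p & q & Hp & Hq & Kp & Kq). split; [intros z; cnt|].
    exists (fun _ _ => 0), (fun _ t => q x0 t). split; [|split; [|split]].
    + intros x t _. apply deriv01_const.
    + intros _ t. apply Hq.
    + apply CK_frozen.
    + apply IH, Kq.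
Qed.

Lemma CK_cl (l : nat) : forall u, CK l u -> CK l (cl u).
Proof.
  induction l as [|l IH]; intros u Hu; [apply G0_cl, Hu|].
  destruct Hu as (H & p & q & Hp & Hq & Kp & Kq). split; [apply G0_cl, H|].
  exists (cl p), (cl q). split; [|split; [|split]]; auto.
  - intros x t Hx. unfold cl at 2. rewrite (clamp_id x Hx).
    apply (deriv01_ext (fun y => u y t)); auto.
    intros y Hy. unfold cl. rewrite (clamp_id y Hy). reflexivity.
  - intros x t. apply Hq.
Qed.

Lemma CK_C1t (l : nat) (u : R -> R -> R) : CK (S l) u -> exists v, C1t u v /\ CK l v.
Proof.
  intros (H & p & q & Hp & Hq & Kp & Kq). exists q. split; [|exact Kq].
  split; [exact H|split; [apply (CK_G0 l), Kq|exact Hq]].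
Qed.

Lemma CK_dt (l : nat) (u v : R -> R -> R) :
  CK (S l) u -> (forall x t, is_derive (u x) t (v x t)) -> CK l v.
Proof.
  intros (H & p & q & Hp & Hq & Kp & Kq) Hv. apply (CK_ext l q); [|exact Kq].
  intros x t. rewrite <- (is_derive_unique _ _ _ (Hv x t)). symmetry.
  apply is_derive_unique, Hq.
Qed.

Lemma CK_int (l : nat) : forall v, CK l v -> CK l (fun x t => RInt (fun y => v y t) 0 x).
Proof.
  assert (HG : forall v, G0 v -> G0 (fun x t => RInt (fun y => v y t) 0 x)).
  { intros v Hv p. apply (continuous_RInt_param (fun y (q : R * R) => v y (snd q))); cnt. }
  induction l as [|l IH]; intros v Kv; [apply HG, Kv|].
  pose proof (CK_pred l v Kv) as Kv'. pose proof (CK_G0 _ _ Kv) as Gv.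
  destruct Kv as (H & p & q & Hp & Hq & Kp & Kq). pose proof (CK_G0 _ _ Kq) as Gq.
  split; [apply HG, H|].
  exists v, (fun x t => RInt (fun y => q y t) 0 x). split; [|split; [|split]]; auto.
  - intros x t _. apply deriv01_of_derive.
    apply (is_derive_RInt_cont (fun y => v y t)). intros; cnt.
  - intros x t. apply (is_derive_RInt_param_cont (fun t y => v y t) (fun t y => q y t)).
    + intros z. cnt.
    + intros z. cnt.
    + intros s y. apply Hq.
Qed.

Lemma CK_prim (l : nat) (v : R -> R -> R) (x0 : R) :
  CK l v -> CK (S l) (fun _ t => RInt (v x0) 0 t).
Proof.
  intros Kv. pose proof (CK_G0 _ _ Kv) as Gv.
  assert (C : forall t, continuous (v x0) t) by (intros t; apply G0_section, Gv).
  assert (G : G0 (fun _ t => RInt (v x0) 0 t)).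
  { intros p. apply (continuous_RInt_param (fun s (q : R * R) => v x0 s)); cnt. }
  split; [exact G|]. exists (fun _ _ => 0), (fun _ t => v x0 t). split; [|split; [|split]].
  - intros x t _. apply deriv01_const.
  - intros x t. apply is_derive_RInt_cont, C.
  - apply CK_frozen.
  - apply (CK_trace l x0 v Kv).
Qed.

(** * Regularity for reflected transport systems *)

Section System.
Variables (T : R) (m1 m1t m2 m2t : R -> R -> R) (M1 L1 M2 L2 : R) (tau1 tau2 : R -> R -> R -> R).
Hypothesis HT : 0 < T.
Hypothesis F1 : is_flow m1 m1t M1 L1 tau1.
Hypothesis F2 : is_flow m2 m2t M2 L2 tau2.
Hypothesis E21 : forall x t, m2 x t = - m1 x t.
Hypothesis E21t : forall x t, m2t x t = - m1t x t.
Hypothesis P1 : forall x t, m1 x (t + T) = m1 x t.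

Let E12 : forall x t, m1 x t = - m2 x t.
Proof. intros x t. rewrite E21. ring. Qed.
Let E12t : forall x t, m1t x t = - m2t x t.
Proof. intros x t. rewrite E21t. ring. Qed.
Let P2 : forall x t, m2 x (t + T) = m2 x t.
Proof. intros x t. rewrite !E21, P1. reflexivity. Qed.

(** The sources [ga1], [ga2] and the boundary terms [h0], [h1] count as given functions even when
    they are computed from [u]; this hides the nonlocal terms. The coupling carries the factor [m]
    because [lam_transversal] integrates [m * y]. *)
Record reflected (al1 al2 b1 b2 ga1 ga2 : R -> R -> R) (h0 h1 : R -> R)
    (u1 u2 : R -> R -> R) : Prop := {
  ref_G1 : G0 u1;
  ref_G2 : G0 u2;
  ref_cl1 : forall x t, u1 x t = u1 (clamp x) t;
  ref_cl2 : forall x t, u2 x t = u2 (clamp x) t;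
  ref_per1 : forall x, per T (u1 x);
  ref_per2 : forall x, per T (u2 x);
  ref_D1 : charD tau1 u1 (fun x t => al1 x t * u1 x t + m1 x t * b1 x t * u2 x t + ga1 x t);
  ref_D2 : charD tau2 u2 (fun x t => al2 x t * u2 x t + m2 x t * b2 x t * u1 x t + ga2 x t);
  ref_bc0 : forall t, u1 0 t = u2 0 t + h0 t;
  ref_bc1 : forall t, u2 1 t = u1 1 t + h1 t }.

(* [gap1 al l] is the logarithm of $c_1^l(0,1,t)$, and [gap2 al l] that of $c_2^l(1,0,t)$. *)
Definition gap1 (al : R -> R -> R) (l : R) (t : R) : R :=
  lam tau1 (fun x t => al x t - l * m1t x t) 0 1 t.
Definition gap2 (al : R -> R -> R) (l : R) (t : R) : R :=
  lam tau2 (fun x t => al x t - l * m2t x t) 1 0 t.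

(** The alternatives (C1) to (C4) in logarithmic form; the second and fourth describe growth rather
    than decay over a round trip. *)
Definition dissipative (al1 al2 : R -> R -> R) (n : nat) : Prop :=
  (forall t l, (l <= n)%nat -> gap1 al1 (INR l) t + gap2 al2 (INR l) (tau1 0 1 t) < 0) \/
  (forall t l, (l <= n)%nat -> 0 < gap1 al1 (INR l) t + gap2 al2 (INR l) (tau1 0 1 t)) \/
  (forall t l, (l <= n)%nat -> gap2 al2 (INR l) t + gap1 al1 (INR l) (tau2 1 0 t) < 0) \/
  (forall t l, (l <= n)%nat -> 0 < gap2 al2 (INR l) t + gap1 al1 (INR l) (tau2 1 0 t)).

Lemma C1t_C1f (x : R) (u v : R -> R -> R) : C1t u v -> C1f (u x) (v x).
Proof. intros (H1 & H2 & H3). split; intros t; [apply G0_section, H2|apply H3]. Qed.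

Lemma lam_ext (tau : R -> R -> R -> R) (f g : R -> R -> R) (x0 x t : R) :
  (forall x t, f x t = g x t) -> lam tau f x0 x t = lam tau g x0 x t.
Proof. intros E. unfold lam. apply RInt_ext_R. intros; apply E. Qed.

(** Subtracting [mt] in the exponent multiplies the weight by [tau_t]: going from index 0 to index 1
    amounts to including the derivative of the characteristic map. *)
Lemma exp_lam_flow (m mt : R -> R -> R) (M L : R) (tau : R -> R -> R -> R) (al : R -> R -> R)
  (x0 x t : R) : is_flow m mt M L tau -> G0 al -> 0 <= x0 <= 1 -> 0 <= x <= 1 ->
  exp (lam tau (fun x t => al x t - 1 * mt x t) x0 x t) =
  exp (lam tau al x0 x t) * tau_t mt tau x0 x t.
Proof.
  intros F Hal Hx0 Hx. unfold tau_t. rewrite <- exp_plus. f_equal.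
  rewrite (clamp_id x0 Hx0), (clamp_id x Hx). unfold lam.
  pose proof (proj1 (proj2 (flow_slope _ _ _ _ _ F))) as Hmt.
  assert (C : forall eta : R, continuous (fun eta : R => mt eta (tau eta x t)) eta)
    by apply (continuous_along _ _ _ _ _ F _ x t Hmt).
  pose proof (RInt_swap_R _ x0 x C) as Esw. rewrite Esw.
  rewrite (RInt_ext_R _ (fun eta => al eta (tau eta x t) - mt eta (tau eta x t)))
    by (intros; ring).
  rewrite RInt_minus_R; [ring| |exact C]. apply (continuous_along _ _ _ _ _ F _ x t Hal).
Qed.

Lemma lam_per (m mt : R -> R -> R) (M L : R) (tau : R -> R -> R -> R) (al : R -> R -> R)
  (x0 x : R) : is_flow m mt M L tau -> (forall x t, m x (t + T) = m x t) ->
  (forall x, per T (al x)) -> per T (lam tau al x0 x).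
Proof.
  intros F Pm Pal t. unfold lam. apply RInt_ext_R. intros eta _.
  rewrite (flow_translate _ _ _ _ _ F T Pm). apply Pal.
Qed.

Lemma CK_charD (m mt : R -> R -> R) (M L : R) (tau : R -> R -> R -> R) (l : nat) (b : R -> R -> R) :
  is_flow m mt M L tau -> CK (S l) b -> exists Y, G0 Y /\ charD tau b Y.
Proof.
  intros F (H & p & q & Hp & Hq & Kp & Kq).
  pose proof (CK_G0 _ _ Kp) as Gp. pose proof (CK_G0 _ _ Kq) as Gq.
  pose proof (proj1 (flow_slope _ _ _ _ _ F)) as Hm.
  exists (fun x t => p x t + q x t * m x t). split; [intros z; cnt|].
  apply (charD_of_pd _ _ _ _ _ F); [|exact Hp].
  split; [exact H|split; [exact Gq|exact Hq]].
Qed.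

(** Carries the differentiability of the trace at [x0] into the strip along the characteristics. *)
Lemma C1t_transport (m mt : R -> R -> R) (M L : R) (tau : R -> R -> R -> R) (x0 : R)
  (u al al' S S' : R -> R -> R) (z' : R -> R) :
  is_flow m mt M L tau -> C1t al al' -> C1t S S' -> C1f (u x0) z' ->
  (forall x t, u x t = u (clamp x) t) ->
  (forall x t, 0 <= x <= 1 -> u x t = exp (lam tau al x0 x t) * (u x0 (tau x0 x t) + S x t)) ->
  exists v, C1t u v.
Proof.
  intros F Hal HS Hz Hcl E.
  assert (Hz2 : C1t (fun _ t => u x0 t) (fun _ t => z' t)).
  { pose proof (C1f_cont _ _ Hz). destruct Hz as [Z1 Z2]. split; [|split].
    - intros p. apply (continuous_comp snd (u x0)); [apply continuous_snd1|apply H].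
    - intros p. cnt.
    - intros _ t. apply Z2. }
  pose proof (C1t_comp_flow _ _ _ _ _ F x0 _ _ Hz2) as H1.
  pose proof (C1t_exp _ _ (C1t_lam _ _ _ _ _ F _ _ x0 Hal)) as H2.
  pose proof (C1t_mult _ _ _ _ H2 (C1t_plus _ _ _ _ H1 HS)) as H3.
  pose proof (C1t_cl _ _ H3) as H4.
  eexists. eapply C1t_ext; [| |exact H4]; [|reflexivity].
  intros x t. rewrite Hcl. symmetry. apply E, clamp_01.
Qed.

Lemma reflected_C1 (al1 al2 b1 b2 ga1 ga2 : R -> R -> R) (h0 h1 : R -> R) (u1 u2 : R -> R -> R) :
  reflected al1 al2 b1 b2 ga1 ga2 h0 h1 u1 u2 ->
  CK 1 m1 -> CK 1 al1 -> CK 1 al2 -> CK 1 b1 -> CK 1 b2 -> CK 1 ga1 -> CK 1 ga2 ->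
  CK 1 (fun _ t => h0 t) -> CK 1 (fun _ t => h1 t) ->
  (forall x, per T (al1 x)) -> (forall x, per T (al2 x)) ->
  dissipative al1 al2 1 ->
  exists v1 v2, C1t u1 v1 /\ C1t u2 v2.
Proof.
  intros HR Km1 Kal1 Kal2 Kb1 Kb2 Kga1 Kga2 Kh0 Kh1 Pal1 Pal2 HD.
  pose proof (ref_G1 _ _ _ _ _ _ _ _ _ _ HR) as G1. pose proof (ref_G2 _ _ _ _ _ _ _ _ _ _ HR) as G2.
  pose proof (proj1 (flow_slope _ _ _ _ _ F1)) as Gm1.
  pose proof (proj1 (flow_slope _ _ _ _ _ F2)) as Gm2.
  destruct (CK_C1t 0 _ Kal1) as [al1' [Hal1 _]]. destruct (CK_C1t 0 _ Kal2) as [al2' [Hal2 _]].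
  destruct (CK_C1t 0 _ Kga1) as [ga1' [Hga1 _]]. destruct (CK_C1t 0 _ Kga2) as [ga2' [Hga2 _]].
  destruct (CK_charD _ _ _ _ _ 0 _ F2 Kb1) as [Yb1 [GYb1 Cb1]].
  destruct (CK_charD _ _ _ _ _ 0 _ F1 Kb2) as [Yb2 [GYb2 Cb2]].
  pose proof (CK_G0 _ _ Kb1) as Gb1. pose proof (CK_G0 _ _ Kb2) as Gb2.
  pose proof (proj1 Hal1) as Gal1. pose proof (proj1 Hal2) as Gal2.
  pose proof (proj1 Hga1) as Gga1. pose proof (proj1 Hga2) as Gga2.
  pose proof (ref_D1 _ _ _ _ _ _ _ _ _ _ HR) as D1. pose proof (ref_D2 _ _ _ _ _ _ _ _ _ _ HR) as D2.
  assert (I0 : 0 <= 0 <= 1) by lra. assert (I1 : 0 <= 1 <= 1) by lra.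
  destruct (transport_gain m1 m1t m2 m2t M1 L1 M2 L2 tau1 tau2 0 u1 u2 al1 al1' b1 Yb1 ga1 ga1'
    (fun x t => al2 x t * u2 x t + m2 x t * b2 x t * u1 x t + ga2 x t)) as (S1 & S1' & HS1 & E1);
    try assumption; [intros p; cnt|].
  destruct (transport_gain m2 m2t m1 m1t M2 L2 M1 L1 tau2 tau1 1 u2 u1 al2 al2' b2 Yb2 ga2 ga2'
    (fun x t => al1 x t * u1 x t + m1 x t * b1 x t * u2 x t + ga1 x t)) as (S2 & S2' & HS2 & E2);
    try assumption; [intros p; cnt|].
  destruct (CK_C1t 0 _ Kh0) as [h0' [Hh0 _]]. destruct (CK_C1t 0 _ Kh1) as [h1' [Hh1 _]].
  apply (C1t_C1f 0) in Hh0, Hh1.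
  pose proof (C1t_C1f 1 _ _ (C1t_lam _ _ _ _ _ F1 _ _ 0 Hal1)) as HL1.
  pose proof (C1t_C1f 0 _ _ (C1t_lam _ _ _ _ _ F2 _ _ 1 Hal2)) as HL2.
  pose proof (C1t_C1f 1 _ _ (C1t_flow _ _ _ _ _ F1 0)) as Hp1.
  pose proof (C1t_C1f 0 _ _ (C1t_flow _ _ _ _ _ F1 1)) as Hi1.
  pose proof (C1t_C1f 0 _ _ (C1t_flow _ _ _ _ _ F2 1)) as Hp2.
  pose proof (C1t_C1f 1 _ _ (C1t_flow _ _ _ _ _ F2 0)) as Hi2.
  set (l1 := lam tau1 al1 0 1). set (l2 := lam tau2 al2 1 0).
  assert (Hexp : C1f exp exp) by (split; intros t; [apply continuous_exp|apply is_derive_exp]).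
  pose proof (C1f_comp _ _ _ _ Hexp HL1) as HX1. pose proof (C1f_comp _ _ _ _ Hexp HL2) as HX2.
  assert (T1 : forall t, u1 0 t = exp (l2 t) * u2 1 (tau2 1 0 t) + (exp (l2 t) * S2 0 t + h0 t)).
  { intros t. rewrite (ref_bc0 _ _ _ _ _ _ _ _ _ _ HR), (E2 0 t I0). unfold l2. ring. }
  assert (T2 : forall t, u2 1 t = exp (l1 t) * u1 0 (tau1 0 1 t) + (exp (l1 t) * S1 1 t + h1 t)).
  { intros t. rewrite (ref_bc1 _ _ _ _ _ _ _ _ _ _ HR), (E1 1 t I1). unfold l1. ring. }
  pose proof (C1f_plus _ _ _ _ (C1f_mult _ _ _ _ HX2 (C1t_C1f 0 _ _ HS2)) Hh0) as HP.
  pose proof (C1f_plus _ _ _ _ (C1f_mult _ _ _ _ HX1 (C1t_C1f 1 _ _ HS1)) Hh1) as HQ.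
  pose proof (flow_translate _ _ _ _ _ F1 T P1) as S1T. pose proof (flow_translate _ _ _ _ _ F2 T P2) as S2T.
  assert (Eg1 : forall t, gap1 al1 0 t = l1 t).
  { intros t. unfold gap1, l1. apply lam_ext. intros; ring. }
  assert (Eg2 : forall t, gap2 al2 0 t = l2 t).
  { intros t. unfold gap2, l2. apply lam_ext. intros; ring. }
  assert (X1 : forall t, exp (gap1 al1 1 t) = exp (l1 t) * tau_t m1t tau1 0 1 t).
  { intros t. apply (exp_lam_flow _ _ _ _ _ _ _ _ _ F1); assumption. }
  assert (X2 : forall t, exp (gap2 al2 1 t) = exp (l2 t) * tau_t m2t tau2 1 0 t).
  { intros t. apply (exp_lam_flow _ _ _ _ _ _ _ _ _ F2); assumption. }
  assert (I1' : forall t, tau1 0 1 (tau1 1 0 t) = t).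
  { intros t. rewrite (flow_group _ _ _ _ _ F1). apply (flow_init _ _ _ _ _ F1). }
  assert (I2' : forall t, tau2 1 0 (tau2 0 1 t) = t).
  { intros t. rewrite (flow_group _ _ _ _ _ F2). apply (flow_init _ _ _ _ _ F2). }
  assert (Pl1 : per T l1) by (apply (lam_per _ _ _ _ _ _ _ _ F1); assumption).
  assert (Pl2 : per T l2) by (apply (lam_per _ _ _ _ _ _ _ _ F2); assumption).
  assert (HZ : (exists z1', C1f (u1 0) z1') /\ (exists z2', C1f (u2 1) z2')).
  { assert (HC : ((forall t, l1 t + l2 (tau1 0 1 t) < 0 /\
                    gap1 al1 1 t + gap2 al2 1 (tau1 0 1 t) < 0) \/
                   (forall t, 0 < l1 t + l2 (tau1 0 1 t) /\
                    0 < gap1 al1 1 t + gap2 al2 1 (tau1 0 1 t))) \/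
                  ((forall t, l2 t + l1 (tau2 1 0 t) < 0 /\
                    gap2 al2 1 t + gap1 al1 1 (tau2 1 0 t) < 0) \/
                   (forall t, 0 < l2 t + l1 (tau2 1 0 t) /\
                    0 < gap2 al2 1 t + gap1 al1 1 (tau2 1 0 t)))).
    { destruct HD as [HD|[HD|[HD|HD]]];
        [left; left|left; right|right; left|right; right];
        intros t; rewrite <- Eg1, <- Eg2;
        (split; [apply (HD t 0%nat); lia|apply (HD t 1%nat); lia]). }
    (* (C1) and (C2) concern the round trip based at [x = 1] and give the trace of [u2] there; (C3)
       and (C4) concern the one based at [x = 0] and give the trace of [u1]. The remaining trace
       follows from its own equation [T1] or [T2]. *)
    assert (HD1 : (exists z1', C1f (u1 0) z1') \/ (exists z2', C1f (u2 1) z2')).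
    { destruct HC as [HC|HC]; [right|left].
      - exact (trace_C1 T (u2 1) (u1 0) l1 _ l2 _ (tau2 1 0) _ (tau1 0 1) _ (tau2 0 1) _ (tau1 1 0) _
          (fun t => exp (l1 t) * S1 1 t + h1 t) _ (fun t => exp (l2 t) * S2 0 t + h0 t) _
          (gap1 al1 1) (gap2 al2 1)
          HT HL1 HL2 Hp2 Hp1 Hi2 Hi1 HQ HP (G0_section u2 1 G2)
          (ref_per2 _ _ _ _ _ _ _ _ _ _ HR 1) Pl1 Pl2 (S2T 1 0) (S1T 0 1) (S2T 0 1) (S1T 1 0)
          I2' I1' (flow_t_pos m2t tau2 1 0) (flow_t_pos m1t tau1 0 1) X1 X2 HC T2 T1).
      - exact (trace_C1 T (u1 0) (u2 1) l2 _ l1 _ (tau1 0 1) _ (tau2 1 0) _ (tau1 1 0) _ (tau2 0 1) _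
          (fun t => exp (l2 t) * S2 0 t + h0 t) _ (fun t => exp (l1 t) * S1 1 t + h1 t) _
          (gap2 al2 1) (gap1 al1 1)
          HT HL2 HL1 Hp1 Hp2 Hi1 Hi2 HP HQ (G0_section u1 0 G1)
          (ref_per1 _ _ _ _ _ _ _ _ _ _ HR 0) Pl2 Pl1 (S1T 0 1) (S2T 1 0) (S1T 1 0) (S2T 0 1)
          I1' I2' (flow_t_pos m1t tau1 0 1) (flow_t_pos m2t tau2 1 0) X2 X1 HC T1 T2). }
    assert (Hext : forall f g g' : R -> R, (forall t, g t = f t) -> C1f g g' -> C1f f g').
    { intros f g g' E [Q1 Q2]. split; [exact Q1|].
      intros t. apply is_derive_ext with g; auto. }
    destruct HD1 as [[z' Hz]|[z' Hz]]; split; try (exists z'; exact Hz).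
    - eexists. eapply Hext; [intros t; symmetry; apply T2|].
      apply C1f_plus; [|exact HQ]. apply C1f_mult; [exact HX1|]. exact (C1f_comp _ _ _ _ Hz Hp1).
    - eexists. eapply Hext; [intros t; symmetry; apply T1|].
      apply C1f_plus; [|exact HP]. apply C1f_mult; [exact HX2|]. exact (C1f_comp _ _ _ _ Hz Hp2). }
  destruct HZ as [[z1' Hz1] [z2' Hz2]].
  destruct (C1t_transport _ _ _ _ _ 0 u1 al1 al1' S1 S1' z1' F1 Hal1 HS1 Hz1
    (ref_cl1 _ _ _ _ _ _ _ _ _ _ HR) E1) as [v1 Hv1].
  destruct (C1t_transport _ _ _ _ _ 1 u2 al2 al2' S2 S2' z2' F2 Hal2 HS2 Hz2
    (ref_cl2 _ _ _ _ _ _ _ _ _ _ HR) E2) as [v2 Hv2].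
  exists v1, v2. split; assumption.
Qed.

Lemma dissipative_le (al1 al2 : R -> R -> R) (l n : nat) :
  (l <= n)%nat -> dissipative al1 al2 n -> dissipative al1 al2 l.
Proof.
  intros Hl [H|[H|[H|H]]]; [left|right; left|right; right; left|right; right; right];
    intros t j Hj; apply H; lia.
Qed.

Lemma gap1_shift (al : R -> R -> R) (l : nat) (t : R) :
  gap1 (fun x t => al x t - m1t x t) (INR l) t = gap1 al (INR (S l)) t.
Proof. unfold gap1. apply lam_ext. intros x s. rewrite S_INR. ring. Qed.

Lemma gap2_shift (al : R -> R -> R) (l : nat) (t : R) :
  gap2 (fun x t => al x t - m2t x t) (INR l) t = gap2 al (INR (S l)) t.
Proof. unfold gap2. apply lam_ext. intros x s. rewrite S_INR. ring. Qed.

Lemma dissipative_shift (al1 al2 : R -> R -> R) (n : nat) :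
  dissipative al1 al2 (S n) ->
  dissipative (fun x t => al1 x t - m1t x t) (fun x t => al2 x t - m2t x t) n.
Proof.
  intros [H|[H|[H|H]]]; [left|right; left|right; right; left|right; right; right];
    intros t j Hj; rewrite gap1_shift, gap2_shift; apply H; lia.
Qed.

Lemma clamp_derive (u v : R -> R -> R) :
  C1t u v -> (forall x t, u x t = u (clamp x) t) -> forall x t, v x t = v (clamp x) t.
Proof.
  intros (H1 & H2 & H3) E x t. rewrite <- (is_derive_unique _ _ _ (H3 x t)).
  apply is_derive_unique. apply is_derive_ext with (u (clamp x)); [|apply H3].
  intros s. symmetry. apply E.
Qed.

Lemma bc_derive (u v u' v' : R -> R -> R) (h h' : R -> R) (x t : R) :
  C1t u u' -> C1t v v' -> C1f h h' ->
  (forall t, u x t = v x t + h t) -> u' x t = v' x t + h' t.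
Proof.
  intros (A1 & A2 & A3) (B1 & B2 & B3) [C1 C2] E.
  rewrite <- (is_derive_unique _ _ _ (A3 x t)). apply is_derive_unique.
  apply is_derive_ext with (fun s => v x s + h s); [intros s; symmetry; apply E|].
  apply (is_derive_plus (v x) h); [apply B3|apply C2].
Qed.

(* The [t]-derivative of a solution solves a system of the same kind, with
   [al] replaced by [al - m_t]; this shifts the index of the gaps by one. *)
Theorem reflected_regular (l : nat) : forall (al1 al2 b1 b2 ga1 ga2 : R -> R -> R)
    (h0 h1 : R -> R) (u1 u2 : R -> R -> R),
  reflected al1 al2 b1 b2 ga1 ga2 h0 h1 u1 u2 ->
  CK (S l) m1 -> CK l al1 -> CK l al2 -> CK l b1 -> CK l b2 -> CK l ga1 -> CK l ga2 ->
  CK l (fun _ t => h0 t) -> CK l (fun _ t => h1 t) ->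
  (forall x, per T (al1 x)) -> (forall x, per T (al2 x)) ->
  dissipative al1 al2 l ->
  CK l u1 /\ CK l u2.
Proof.
  induction l as [|l IH];
    intros al1 al2 b1 b2 ga1 ga2 h0 h1 u1 u2 HR Km1 Kal1 Kal2 Kb1 Kb2 Kga1 Kga2 Kh0 Kh1 Pal1 Pal2 HD.
  { split; apply HR. }
  assert (K1 : forall u, CK (S l) u -> CK 1 u) by (intros u; apply CK_le; lia).
  destruct (reflected_C1 al1 al2 b1 b2 ga1 ga2 h0 h1 u1 u2) as (v1 & v2 & Hv1 & Hv2); auto.
  { apply (CK_le 1 (S (S l))); [lia|exact Km1]. }
  { apply (dissipative_le _ _ 1 (S l)); [lia|exact HD]. }
  assert (Km1' : CK (S l) m1) by (apply CK_pred, Km1).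
  (* The induction hypothesis is used on [u] before it is used on [v]: in the system for [v] the
     terms [al1' * u1] and [mb1' * u2] count as sources, so they must already be of class [l]. *)
  destruct (IH al1 al2 b1 b2 ga1 ga2 h0 h1 u1 u2) as [Ku1 Ku2]; auto using CK_pred.
  { apply (dissipative_le _ _ l (S l)); [lia|exact HD]. }
  assert (Km2 : CK (S (S l)) m2).
  { apply (CK_ext _ (fun x t => - m1 x t)); [intros; symmetry; apply E21|]. apply CK_opp, Km1. }
  assert (Km2' : CK (S l) m2) by (apply CK_pred, Km2).
  assert (Km1t : CK l m1t) by (apply CK_pred, (CK_dt (S l) m1); [exact Km1|apply (flow_slope _ _ _ _ _ F1)]).
  assert (Km2t : CK l m2t) by (apply CK_pred, (CK_dt (S l) m2); [exact Km2|apply (flow_slope _ _ _ _ _ F2)]).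
  destruct (CK_C1t l _ Kal1) as [al1' [Hal1 Kal1']]. destruct (CK_C1t l _ Kal2) as [al2' [Hal2 Kal2']].
  destruct (CK_C1t l _ Kga1) as [ga1' [Hga1 Kga1']]. destruct (CK_C1t l _ Kga2) as [ga2' [Hga2 Kga2']].
  destruct (CK_C1t l _ (CK_mult _ _ _ Km1' Kb1)) as [mb1' [Hmb1 Kmb1']].
  destruct (CK_C1t l _ (CK_mult _ _ _ Km2' Kb2)) as [mb2' [Hmb2 Kmb2']].
  destruct (CK_C1t l _ Kh0) as [h0' [Hh0 Kh0']]. destruct (CK_C1t l _ Kh1) as [h1' [Hh1 Kh1']].
  assert (HY1 : C1t (fun x t => al1 x t * u1 x t + m1 x t * b1 x t * u2 x t + ga1 x t)
     (fun x t => (al1' x t * u1 x t + al1 x t * v1 x t)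
        + (mb1' x t * u2 x t + m1 x t * b1 x t * v2 x t) + ga1' x t)).
  { apply C1t_plus; [apply C1t_plus; apply C1t_mult|]; assumption. }
  assert (HY2 : C1t (fun x t => al2 x t * u2 x t + m2 x t * b2 x t * u1 x t + ga2 x t)
     (fun x t => (al2' x t * u2 x t + al2 x t * v2 x t)
        + (mb2' x t * u1 x t + m2 x t * b2 x t * v1 x t) + ga2' x t)).
  { apply C1t_plus; [apply C1t_plus; apply C1t_mult|]; assumption. }
  pose proof (charD_dt _ _ _ _ _ F1 _ _ _ _ Hv1 HY1 (ref_D1 _ _ _ _ _ _ _ _ _ _ HR)) as DV1.
  pose proof (charD_dt _ _ _ _ _ F2 _ _ _ _ Hv2 HY2 (ref_D2 _ _ _ _ _ _ _ _ _ _ HR)) as DV2.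
  assert (RV : reflected (fun x t => al1 x t - m1t x t) (fun x t => al2 x t - m2t x t) b1 b2
     (fun x t => al1' x t * u1 x t + mb1' x t * u2 x t + ga1' x t)
     (fun x t => al2' x t * u2 x t + mb2' x t * u1 x t + ga2' x t)
     (h0' 0) (h1' 1) v1 v2).
  { constructor.
    - apply Hv1.
    - apply Hv2.
    - apply (clamp_derive u1); [exact Hv1|apply HR].
    - apply (clamp_derive u2); [exact Hv2|apply HR].
    - intros x. apply (per_derive T (u1 x)); [apply HR|apply Hv1].
    - intros x. apply (per_derive T (u2 x)); [apply HR|apply Hv2].
    - revert DV1. apply charD_eq. intros; ring.
    - revert DV2. apply charD_eq. intros; ring.
    - intros t. apply (bc_derive u1 u2 v1 v2 h0 (h0' 0) 0 t Hv1 Hv2); [apply (C1t_C1f 0 _ _ Hh0)|apply HR].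
    - intros t. apply (bc_derive u2 u1 v2 v1 h1 (h1' 1) 1 t Hv2 Hv1); [apply (C1t_C1f 1 _ _ Hh1)|apply HR]. }
  assert (Pm1t : forall x, per T (m1t x)).
  { intros x. apply (per_derive T (m1 x)); [intros t; apply P1|apply (flow_slope _ _ _ _ _ F1)]. }
  assert (Pm2t : forall x, per T (m2t x)).
  { intros x. apply (per_derive T (m2 x)); [intros t; apply P2|apply (flow_slope _ _ _ _ _ F2)]. }
  destruct (IH _ _ _ _ _ _ _ _ _ _ RV) as [Kv1 Kv2]; auto using CK_pred, CK_minus, CK_plus, CK_mult.
  { apply (CK_trace l 0 h0'), Kh0'. }
  { apply (CK_trace l 1 h1'), Kh1'. }
  { intros x t. rewrite Pal1, Pm1t. reflexivity. }
  { intros x t. rewrite Pal2, Pm2t. reflexivity. }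
  { apply dissipative_shift, HD. }
  split.
  - split; [apply HR|].
    exists (fun x t => al1 x t * u1 x t + m1 x t * b1 x t * u2 x t + ga1 x t - v1 x t * m1 x t), v1.
    split; [|split; [apply Hv1|split; [|exact Kv1]]].
    + intros x t Hx. apply (pd_of_charD _ _ _ _ _ F1 u1 v1 _ Hv1 (ref_D1 _ _ _ _ _ _ _ _ _ _ HR) x t Hx).
    + auto 10 using CK_pred, CK_minus, CK_plus, CK_mult.
  - split; [apply HR|].
    exists (fun x t => al2 x t * u2 x t + m2 x t * b2 x t * u1 x t + ga2 x t - v2 x t * m2 x t), v2.
    split; [|split; [apply Hv2|split; [|exact Kv2]]].
    + intros x t Hx. apply (pd_of_charD _ _ _ _ _ F2 u2 v2 _ Hv2 (ref_D2 _ _ _ _ _ _ _ _ _ _ HR) x t Hx).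
    + auto 10 using CK_pred, CK_minus, CK_plus, CK_mult.
Qed.

End System.

Lemma strip_bounded (T : R) (f : R -> R -> R) :
  0 < T -> G0 f -> (forall x, per T (f x)) -> (forall x t, f x t = f (clamp x) t) ->
  exists M, forall x t, Rabs (f x t) <= M.
Proof.
  intros HT Hf Hper Hcl.
  (* Compactness of [0,1] yields only a common lower bound for the radii, so the local bound on [f]
     is stored as the inverse of the radius. *)
  assert (Hd : forall x : R, exists d : posreal,
            forall y, Rabs (y - x) < d -> forall t, Rabs (f y t) <= / d).
  { intros x. destruct (per_bounded T (f x) HT (Hper x) (G0_section f x Hf)) as [B HB].
    pose proof (Rle_trans _ _ _ (Rabs_pos _) (HB 0)) as B0.
    destruct (continuous_tube (fun t y => f y t) 0 T x 1) as [d Hd].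
    - intros t. cnt.
    - lra.
    - assert (Hm : 0 < Rmin d (/ (B + 1))).
      { apply Rmin_pos; [apply cond_pos|apply Rinv_0_lt_compat; lra]. }
      exists (mkposreal _ Hm). intros y Hy t. simpl in Hy |- *.
      assert (HyB : forall s, 0 <= s <= T -> Rabs (f y s) <= B + 1).
      { intros s Hs. specialize (Hd y (Rlt_le_trans _ _ _ Hy (Rmin_l _ _)) s Hs).
        replace (f y s) with ((f y s - f x s) + f x s) by ring.
        eapply Rle_trans; [apply Rabs_triang|]. specialize (HB s). lra. }
      apply Rle_trans with (B + 1).
      + destruct (base_Int_part (t / T)) as [H1 H2].
        rewrite <- (per_Z T (f y) (Hper y) (- Int_part (t / T)) t). apply HyB.
        rewrite opp_IZR. set (n := IZR (Int_part (t / T))) in *.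
        assert (E : t = t / T * T) by (field; lra).
        split; rewrite E; nra.
      + apply Rle_trans with (/ / (B + 1)); [right; symmetry; apply Rinv_inv|].
        apply Rinv_le_contravar; [exact Hm|apply Rmin_r]. }
  set (delta := fun x => proj1_sig (constructive_indefinite_description _ (Hd x))).
  assert (Hdelta : forall x y, Rabs (y - x) < delta x -> forall t, Rabs (f y t) <= / delta x).
  { intros x. exact (proj2_sig (constructive_indefinite_description _ (Hd x))). }
  destruct (compactness_value_1d 0 1 delta) as [d Hc].
  exists (/ d). intros x t. rewrite Hcl. apply Rnot_lt_le. intros Hlt.
  apply (Hc (clamp x) (clamp_01 x)). intros [s (Hs & Hxs & Hds)].
  assert (H1 : Rabs (f (clamp x) t) <= / delta s) by (apply Hdelta, Hxs).
  assert (H2 : / delta s <= / d) by (apply Rinv_le_contravar; [apply cond_pos|exact Hds]).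
  lra.
Qed.

(** * Transfer between [Cl] and [CK] *)

Lemma Cl_CK (l : nat) : forall u, Cl l u -> CK l (cl u).
Proof.
  induction l as [|l IH]; intros u; [apply cont01_cl|].
  intros (H & Hd & Hx & Ht). split; [apply cont01_cl, H|].
  exists (cl (Defs.Dx u)), (cl (Dt u)). split; [|split; [|split]]; auto.
  - intros x t Hx1. unfold cl at 2. rewrite (clamp_id x Hx1).
    apply (deriv01_ext (fun y => u y t)); [exact Hx1| |apply (Hd x t Hx1)].
    intros y Hy. unfold cl. rewrite (clamp_id y Hy). reflexivity.
  - intros x t. apply (Hd (clamp x) t (clamp_01 x)).
Qed.

(** Derivatives relative to [0,1] are unique, endpoints included; this identifies the
    [epsilon]-chosen x-derivative with the witness in [CK]. *)
Lemma CK_Cl (l : nat) : forall u v,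
  (forall x t, 0 <= x <= 1 -> u x t = v x t) -> CK l u -> Cl l v.
Proof.
  assert (Hcont : forall u v, (forall x t, 0 <= x <= 1 -> u x t = v x t) -> G0 u -> cont01 v).
  { intros u v E Hu. apply cont01_cl. apply G0_ext with (cl u); [|apply G0_cl, Hu].
    intros x t. apply E, clamp_01. }
  induction l as [|l IH]; intros u v E Hu; [apply (Hcont u); assumption|].
  destruct Hu as (H & p & q & Hp & Hq & Kp & Kq).
  assert (Hpx : forall x t, 0 <= x <= 1 -> is_pderiv_x v x t (p x t)).
  { intros x t Hx. apply (deriv01_ext (fun y => u y t)); auto. }
  assert (Hqt : forall x t, 0 <= x <= 1 -> is_derive (fun s => v x s) t (q x t)).
  { intros x t Hx. apply is_derive_ext with (fun s => u x s); auto. }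
  assert (HDx : forall x t, 0 <= x <= 1 -> is_pderiv_x v x t (Defs.Dx v x t)).
  { intros x t Hx. unfold Defs.Dx. apply epsilon_spec. exists (p x t). apply Hpx, Hx. }
  assert (HDt : forall x t, 0 <= x <= 1 -> is_derive (fun s => v x s) t (Dt v x t)).
  { intros x t Hx. unfold Dt. apply Derive_correct. exists (q x t). apply Hqt, Hx. }
  split; [apply (Hcont u); assumption|]. split; [auto|]. split.
  - apply (IH p); [|exact Kp]. intros x t Hx.
    apply (deriv01_unique (fun y => v y t) x); [exact Hx|apply Hpx, Hx|apply HDx, Hx].
  - apply (IH q); [|exact Kq]. intros x t Hx.
    rewrite <- (is_derive_unique _ _ _ (HDt x t Hx)). symmetry. apply is_derive_unique, Hqt, Hx.
Qed.

Lemma Cl1_CK (l : nat) : forall r, Cl1 l r -> CK l (fun _ t => r t).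
Proof.
  induction l as [|l IH]; intros r.
  - intros H p. simpl in H. cnt.
  - intros (H & Hd & HD). split; [intros p; cnt|].
    exists (fun _ _ => 0), (fun _ t => Derive r t). split; [|split; [|split]].
    + intros x t _. apply deriv01_const.
    + intros _ t. apply Derive_correct, Hd.
    + apply CK_frozen.
    + apply IH, HD.
Qed.

Lemma cl_cl (u : R -> R -> R) (x t : R) : cl u x t = cl u (clamp x) t.
Proof. unfold cl. rewrite clamp_k. reflexivity. Qed.

(** * From the integral equations to derivatives along characteristics *)

Definition tauc (tau : R -> R -> R -> R) (xi x t : R) : R := tau (clamp xi) (clamp x) t.

(** Reads variation of constants backwards: along a characteristic [z (tau x0 x t)] is constant and
    [lam] is a primitive, so the integral formula can be differentiated there. *)
Lemma charD_duhamel (m mt : R -> R -> R) (M L : R) (tau : R -> R -> R -> R) (x0 : R)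
  (u al g : R -> R -> R) (z : R -> R) :
  is_flow m mt M L tau -> G0 al -> G0 g ->
  (forall x t, 0 <= x <= 1 -> u x t = exp (lam tau al x0 x t) *
     (z (tau x0 x t) + lam tau (fun x t => exp (-1 * lam tau al x0 x t) * g x t) x0 x t)) ->
  charD tau u (fun x t => al x t * u x t + g x t).
Proof.
  intros F Hal Hg E.
  pose proof (G0_lam _ _ _ _ _ F al x0 Hal) as Gla.
  set (e := fun x t => exp (-1 * lam tau al x0 x t) * g x t) in *.
  assert (Ge : G0 e) by (intros p; unfold e; cnt).
  pose proof (charD_exp tau _ _ (charD_lam _ _ _ _ _ F al x0 Hal)) as C1.
  pose proof (charD_plus tau _ _ _ _ (charD_transport _ _ _ _ _ F z x0)
                (charD_lam _ _ _ _ _ F e x0 Ge)) as C2.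
  pose proof (charD_mult tau _ _ _ _ C1 C2) as C3. cbv beta in C3.
  apply (charD_ext _ _ u) in C3; [|intros x t Hx; symmetry; apply E, Hx].
  revert C3. apply charD_eq. intros x t Hx. rewrite (E x t Hx).
  assert (Ee : exp (lam tau al x0 x t) * e x t = g x t).
  { unfold e. rewrite <- Rmult_assoc, <- exp_plus.
    replace (lam tau al x0 x t + -1 * lam tau al x0 x t) with 0 by ring. rewrite exp_0. ring. }
  rewrite <- Ee. ring.
Qed.

Lemma RInt_reverse (f : R -> R) (a b : R) :
  (forall x, continuous f x) -> RInt f b a = RInt (fun x => -1 * f x) a b.
Proof. intros Hf. rewrite RInt_scal_R, (RInt_swap_R f a b) by exact Hf. lra. Qed.

Section Coefficients.
Variables (a : R -> R -> R) (j : nat) (tau : R -> R -> R -> R) (M L : R).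
Let m := fun x t => (-1) ^ j / cl a x t.
Let mt := fun x t => - (-1) ^ j * cl (Dt a) x t / (cl a x t) ^ 2.
Hypothesis F : is_flow m mt M L (tauc tau).
Hypothesis Ha : forall x t, 0 < cl a x t.

(** In terms of the slope [m], the integrand of [c_j^l] is [m * b + l * m_t]. The sign is reversed
    here because [lam] integrates from [x0] to [x] while [c_j^l] integrates from [x] to [x0]. *)
Lemma cjl_lam (b : R -> R -> R) (l : nat) (x0 x t : R) :
  G0 (cl b) -> 0 <= x0 <= 1 -> 0 <= x <= 1 ->
  cjl a b j l tau x0 x t =
  exp (lam (tauc tau) (fun x t => - (m x t * cl b x t) - INR l * mt x t) x0 x t).
Proof.
  intros Hb Hx0 Hx. unfold cjl. f_equal.
  set (f := fun x t => - (m x t * cl b x t) - INR l * mt x t).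
  assert (Gm : G0 m) by apply (flow_slope _ _ _ _ _ F).
  assert (Gmt : G0 mt) by apply (flow_slope _ _ _ _ _ F).
  assert (Gf : G0 f) by (intros p; unfold f; cnt).
  assert (C : forall eta : R, continuous (fun eta : R => f eta (tauc tau eta x t)) eta)
    by apply (continuous_along _ _ _ _ _ F _ x t Gf).
  unfold lam. rewrite (RInt_reverse _ x x0 C).
  apply RInt_ext_R. intros eta Heta.
  pose proof (between_01 _ _ _ Hx Hx0 Heta) as He.
  unfold f, m, mt, tauc, cl. rewrite (clamp_id eta He), (clamp_id x Hx).
  specialize (Ha eta (tau eta x t)). unfold cl in Ha. rewrite (clamp_id eta He) in Ha.
  field. lra.
Qed.

Lemma weak_charD (b b' u u' g : R -> R -> R) (x0 : R) (z : R -> R) :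
  G0 (cl b) -> G0 (cl b') -> G0 (cl u') -> G0 (cl g) -> 0 <= x0 <= 1 ->
  (forall x t, 0 <= x <= 1 ->
     u x t = cjl a b j 0 tau x0 x t * z (tau x0 x t)
       - RInt (fun xi => dj a b j tau xi x t * b' xi (tau xi x t) * u' xi (tau xi x t)) x0 x
       + RInt (fun xi => dj a b j tau xi x t * g xi (tau xi x t)) x0 x) ->
  charD (tauc tau) (cl u)
    (fun x t => - (m x t * cl b x t) * cl u x t + m x t * (- cl b' x t) * cl u' x t
                + m x t * cl g x t).
Proof.
  intros Hb Hb' Hu' Hg Hx0 E.
  assert (Gm : G0 m) by apply (flow_slope _ _ _ _ _ F).
  set (al := fun x t => - (m x t * cl b x t)).
  set (r := fun x t => m x t * (- cl b' x t) * cl u' x t + m x t * cl g x t).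
  assert (Gal : G0 al) by (intros p; unfold al; cnt).
  assert (Gr : G0 r) by (intros p; unfold r; cnt).
  apply (charD_eq _ _ (fun x t => al x t * cl u x t + r x t)); [intros; unfold al, r; ring|].
  apply (charD_duhamel _ _ _ _ _ x0 (cl u) al r z F Gal Gr).
  intros x t Hx. unfold cl at 1. rewrite (clamp_id x Hx), (E x t Hx).
  (* The cocycle identity: the weight between [xi] and [x] is that between [x0] and [x] divided by
     that between [x0] and [xi]. It pulls one common factor out of the integrals and gives the
     Duhamel form. *)
  assert (Ec : forall xi, 0 <= xi <= 1 ->
    cjl a b j 0 tau xi x t = exp (lam (tauc tau) al x0 x t) * exp (-1 * lam (tauc tau) al x0 xi (tauc tau xi x t))).
  { intros xi Hxi. rewrite (cjl_lam b 0 xi x t Hb Hxi Hx), <- exp_plus. f_equal.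
    assert (C : forall eta : R, continuous (fun eta : R => al eta (tauc tau eta x t)) eta)
      by apply (continuous_along _ _ _ _ _ F _ x t Gal).
    unfold lam. rewrite (RInt_ext_R _ (fun eta => al eta (tauc tau eta x t)))
      by (intros; unfold al; simpl; ring).
    rewrite (RInt_ext_R (fun eta => al eta (tauc tau eta xi (tauc tau xi x t)))
               (fun eta => al eta (tauc tau eta x t)))
      by (intros; rewrite (flow_group _ _ _ _ _ F); reflexivity).
    pose proof (RInt_Chasles_R _ x0 xi x C) as Ech. lra. }
  set (e := fun x t => exp (-1 * lam (tauc tau) al x0 x t) * r x t).
  assert (Gla : G0 (lam (tauc tau) al x0)) by apply (G0_lam _ _ _ _ _ F al x0 Gal).
  assert (Ge : G0 e) by (intros p; unfold e; cnt).
  assert (Ce : forall eta : R, continuous (fun eta : R => e eta (tauc tau eta x t)) eta)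
    by apply (continuous_along _ _ _ _ _ F _ x t Ge).
  set (el := exp (lam (tauc tau) al x0 x t)) in *.
  set (f1 := fun xi => el * exp (-1 * lam (tauc tau) al x0 xi (tauc tau xi x t))
     * (m xi (tauc tau xi x t) * cl b' xi (tauc tau xi x t) * cl u' xi (tauc tau xi x t))).
  set (f2 := fun xi => el * exp (-1 * lam (tauc tau) al x0 xi (tauc tau xi x t))
     * (m xi (tauc tau xi x t) * cl g xi (tauc tau xi x t))).
  assert (C0 : forall eta : R, continuous (fun eta : R => tauc tau eta x t) eta).
  { intros eta. apply (continuous_flow _ _ _ _ _ F); cnt. }
  assert (Cf1 : forall xi : R, continuous f1 xi) by (intros xi; unfold f1; cnt).
  assert (Cf2 : forall xi : R, continuous f2 xi) by (intros xi; unfold f2; cnt).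
  assert (Et : forall xi, 0 <= xi <= 1 -> tauc tau xi x t = tau xi x t).
  { intros xi Hxi. unfold tauc. rewrite (clamp_id xi Hxi), (clamp_id x Hx). reflexivity. }
  assert (Ed : forall xi, 0 <= xi <= 1 -> dj a b j tau xi x t =
     el * exp (-1 * lam (tauc tau) al x0 xi (tauc tau xi x t)) * m xi (tauc tau xi x t)).
  { intros xi Hxi. unfold dj. rewrite (Ec xi Hxi). rewrite (Et xi Hxi). unfold m, cl.
    rewrite (clamp_id xi Hxi). unfold Rdiv. ring. }
  assert (R1 : RInt (fun xi => dj a b j tau xi x t * b' xi (tau xi x t) * u' xi (tau xi x t)) x0 x
     = RInt f1 x0 x).
  { apply RInt_ext_R. intros xi Hxi. pose proof (between_01 _ _ _ Hx0 Hx Hxi) as H.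
    rewrite (Ed xi H). unfold f1. rewrite !(Et xi H). unfold cl. rewrite !(clamp_id xi H). ring. }
  assert (R2 : RInt (fun xi => dj a b j tau xi x t * g xi (tau xi x t)) x0 x = RInt f2 x0 x).
  { apply RInt_ext_R. intros xi Hxi. pose proof (between_01 _ _ _ Hx0 Hx Hxi) as H.
    rewrite (Ed xi H). unfold f2. rewrite !(Et xi H). unfold cl. rewrite !(clamp_id xi H). ring. }
  rewrite R1, R2.
  assert (R3 : RInt f2 x0 x - RInt f1 x0 x = el * lam (tauc tau) e x0 x t).
  { rewrite <- RInt_minus_R by assumption. unfold lam. rewrite <- RInt_scal_R by exact Ce.
    apply RInt_ext_R. intros xi _. unfold f1, f2, e, r. ring. }
  rewrite (Ec x0 Hx0).
  assert (E0 : exp (-1 * lam (tauc tau) al x0 x0 (tauc tau x0 x t)) = 1).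
  { unfold lam. rewrite RInt_point_R, Rmult_0_r. apply exp_0. }
  rewrite E0.
  rewrite (Et x0 Hx0). fold e. lra.
Qed.

End Coefficients.

(* The divergence theorem for the two transport equations, in integrated form. *)
Lemma flux_balance (m1 m1t m2 m2t : R -> R -> R) (M1 L1 M2 L2 : R) (tau1 tau2 : R -> R -> R -> R)
  (u1 u2 Y1 Y2 : R -> R -> R) :
  is_flow m1 m1t M1 L1 tau1 -> is_flow m2 m2t M2 L2 tau2 ->
  (forall x t, m2 x t = - m1 x t) ->
  G0 u1 -> G0 u2 -> G0 Y1 -> G0 Y2 -> charD tau1 u1 Y1 -> charD tau2 u2 Y2 ->
  forall x t, 0 <= x <= 1 ->
  is_derive (fun t => RInt (fun s => u1 0 s + u2 0 s) 0 t
                      + RInt (fun y => - m1 y t * (u1 y t - u2 y t)) 0 x) t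
    (u1 x t + u2 x t
     - RInt (fun y => Y1 y t + Y2 y t + m1t y t * u1 y t + m2t y t * u2 y t) 0 x).
Proof.
  intros F1 F2 E21 H1 H2 HY1 HY2 C1 C2 x t Hx.
  pose proof (proj1 (flow_slope _ _ _ _ _ F1)) as Gm1.
  pose proof (proj1 (proj2 (flow_slope _ _ _ _ _ F1))) as Gm1t.
  pose proof (proj1 (proj2 (flow_slope _ _ _ _ _ F2))) as Gm2t.
  set (E := fun y t => Y1 y t + Y2 y t + m1t y t * u1 y t + m2t y t * u2 y t).
  set (q := fun y t => - m1 y t * (u1 y t - u2 y t)).
  assert (GE : G0 E) by (intros p; unfold E; cnt).
  assert (Gq : G0 q) by (intros p; unfold q; cnt).
  assert (GIE : G0 (fun y t => RInt (E y) 0 t)) by (apply G0_prim, GE).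
  assert (I0 : 0 <= 0 <= 1) by lra.
  (* The balance over the rectangle between [0] and [x] in space and [0] and [t] in time. The flux
     [q] at the upper time, which is not yet known to be differentiable, is traded for t-primitives,
     which are. *)
  assert (Eq : forall t,
    RInt (fun s => u1 0 s + u2 0 s) 0 t + RInt (fun y => q y t) 0 x =
    RInt (u1 x) 0 t + RInt (u2 x) 0 t + RInt (fun y => q y 0) 0 x - RInt (fun y => RInt (E y) 0 t) 0 x).
  { intros s.
    assert (Cw : forall y : R, continuous (fun y : R => q y s - q y 0 + RInt (E y) 0 s) y).
    { intros y. apply (continuous_Rplus (fun y => q y s - q y 0) (fun y => RInt (E y) 0 s)); [cnt|].
      apply (continuous_G0 (fun y t => RInt (E y) 0 t) (fun y => y) (fun _ => s)); [exact GIE|cnt|cnt]. }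
    assert (D : forall y, 0 <= y <= 1 ->
      is_deriv01 (fun y => RInt (u1 y) 0 s + RInt (u2 y) 0 s) y (q y s - q y 0 + RInt (E y) 0 s)).
    { intros y Hy.
      pose proof (deriv01_prim_t _ _ _ _ _ F1 u1 Y1 H1 HY1 C1 y s Hy) as D1.
      pose proof (deriv01_prim_t _ _ _ _ _ F2 u2 Y2 H2 HY2 C2 y s Hy) as D2.
      eapply deriv01_eq; [|exact (deriv01_plus _ _ _ _ _ Hy D1 D2)].
      assert (Es : RInt (E y) 0 s = RInt (fun s => Y1 y s + m1t y s * u1 y s) 0 s
                    + RInt (fun s => Y2 y s + m2t y s * u2 y s) 0 s).
      { rewrite <- RInt_plus_R; [|intros; cnt|intros; cnt].
        apply RInt_ext_R. intros r _. unfold E. ring. }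
      rewrite Es. unfold q. rewrite !E21. ring. }
    pose proof (deriv01_FTC _ _ Cw D 0 x I0 Hx) as FT. cbv beta in FT.
    rewrite RInt_plus_R in FT;
      [|intros; cnt|intros y; apply (continuous_G0 (fun y t => RInt (E y) 0 t) (fun y => y) (fun _ => s)); [exact GIE|cnt|cnt]].
    rewrite RInt_minus_R in FT by (intros; cnt).
    rewrite RInt_plus_R by (intros; apply G0_section; assumption).
    change (fun s => u1 0 s) with (u1 0). change (fun s => u2 0 s) with (u2 0). lra. }
  apply is_derive_ext with (fun t => RInt (u1 x) 0 t + RInt (u2 x) 0 t
     + RInt (fun y => q y 0) 0 x - RInt (fun y => RInt (E y) 0 t) 0 x).
  { intros s. symmetry. apply Eq. }
  assert (Z : u1 x t + u2 x t = u1 x t + u2 x t + 0) by ring. rewrite Z.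
  apply (is_derive_minus (fun t => RInt (u1 x) 0 t + RInt (u2 x) 0 t + RInt (fun y => q y 0) 0 x)
    (fun t => RInt (fun y => RInt (E y) 0 t) 0 x) t (u1 x t + u2 x t + 0)
    (RInt (fun y => E y t) 0 x)).
  - apply (is_derive_plus (fun t => RInt (u1 x) 0 t + RInt (u2 x) 0 t)
      (fun t => RInt (fun y => q y 0) 0 x) t (u1 x t + u2 x t) 0).
    + apply (is_derive_plus (fun t => RInt (u1 x) 0 t) (fun t => RInt (u2 x) 0 t) t (u1 x t) (u2 x t)).
      * apply is_derive_RInt_cont, G0_section, H1.
      * apply is_derive_RInt_cont, G0_section, H2.
    + apply (is_derive_const (RInt (fun y => q y 0) 0 x)).
  - apply (is_derive_RInt_param_cont (fun t y => RInt (E y) 0 t) (fun t y => E y t)).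
    + intros p. apply (continuous_G0 (fun y t => RInt (E y) 0 t) snd fst); [exact GIE|cnt|cnt].
    + intros p. cnt.
    + intros s y. apply is_derive_RInt_cont, G0_section, GE.
Qed.

Lemma flow_of_char (T : R) (a : R -> R -> R) (j : nat) (tau : R -> R -> R -> R) :
  0 < T -> (forall x, per T (cl a x)) -> (forall x t, 0 < cl a x t) -> Cl 1 a -> is_char a j tau ->
  exists M L, is_flow (fun x t => (-1) ^ j / cl a x t)
    (fun x t => - (-1) ^ j * cl (Dt a) x t / (cl a x t) ^ 2) M L (tauc tau).
Proof.
  intros HT Hper Hpos Ha Hch.
  set (m := fun x t => (-1) ^ j / cl a x t).
  set (mt := fun x t => - (-1) ^ j * cl (Dt a) x t / (cl a x t) ^ 2).
  assert (Hn : forall x t, cl a x t <> 0) by (intros x t; apply Rgt_not_eq, Hpos).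
  assert (Hac : C1t (cl a) (cl (Dt a))).
  { destruct Ha as (H & Hd & Hx & Ht). split; [apply cont01_cl, H|split; [apply cont01_cl, Ht|]].
    intros x t. apply (Hd (clamp x) t (clamp_01 x)). }
  assert (Hm : C1t m mt).
  { eapply C1t_ext; [| |exact (C1t_scal ((-1) ^ j) _ _ (C1t_inv _ _ Hn Hac))].
    - intros x t. reflexivity.
    - intros x t. unfold mt. simpl. field. apply Hn. }
  assert (Pm : forall x, per T (m x)).
  { intros x t. unfold m. rewrite Hper. reflexivity. }
  assert (Pmt : forall x, per T (mt x)).
  { intros x. apply (per_derive T (m x)); [apply Pm|apply Hm]. }
  destruct (strip_bounded T m HT (proj1 Hm) Pm) as [M HM].
  { intros x t. unfold m. rewrite cl_cl. reflexivity. }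
  destruct (strip_bounded T mt HT (proj1 (proj2 Hm)) Pmt) as [L HL].
  { intros x t. unfold mt. rewrite (cl_cl a), (cl_cl (Dt a)). reflexivity. }
  exists M, L. constructor; try assumption.
  - intros xi x t. unfold tauc. rewrite !clamp_k. reflexivity.
  - intros x t. apply (Hch (clamp x) t (clamp_01 x)).
  - intros xi x t Hxi.
    apply (deriv01_ext (fun z => tau z (clamp x) t)); [exact Hxi| |].
    + intros y Hy. unfold tauc. rewrite (clamp_id y Hy). reflexivity.
    + unfold m, tauc, cl. rewrite (clamp_id xi Hxi). apply (Hch (clamp x) t (clamp_01 x)), Hxi.
Qed.

(** * The weak solution as a reflected system with nonlocal data *)

Section Problem.
Variables (T : R) (a a1 a2 a3 f : R -> R -> R) (r0 r1 : R -> R)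
  (tau1 tau2 : R -> R -> R -> R) (u1 u2 : R -> R -> R) (n : nat) (M1 L1 M2 L2 : R).
Hypothesis HT : 0 < T.
Hypothesis Pa : periodic2 T a.
Hypothesis Pr0 : periodic1 T r0.
Hypothesis Ppos : forall x t, 0 <= x <= 1 -> 0 < a x t.
Hypothesis HC : RInt (fun t => a 0 t * r0 t) 0 T <> 0.

Let m1 := fun x t => (-1) ^ 1 / cl a x t.
Let m2 := fun x t => (-1) ^ 2 / cl a x t.
Let m1t := fun x t => - (-1) ^ 1 * cl (Dt a) x t / (cl a x t) ^ 2.
Let m2t := fun x t => - (-1) ^ 2 * cl (Dt a) x t / (cl a x t) ^ 2.
Hypothesis F1 : is_flow m1 m1t M1 L1 (tauc tau1).
Hypothesis F2 : is_flow m2 m2t M2 L2 (tauc tau2).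
Hypothesis Hn : (1 <= n)%nat.
Hypothesis Ka : Cl (S n) a.
Hypothesis Ka1 : CT n T a1.
Hypothesis Ka2 : CT n T a2.
Hypothesis Ka3 : Cl n a3.
Hypothesis Kf : Cl n f.
Hypothesis Kr0 : Cl1 n r0.
Hypothesis Kr1 : Cl1 n r1.

Let B11 := b11 a a1 a2.
Let B12 := b12 a a1 a2.
Let B21 := b21 a a1 a2.
Let B22 := b22 a a1 a2.
Let al1 := fun x t => - (m1 x t * cl B11 x t).
Let al2 := fun x t => - (m2 x t * cl B22 x t).
Let F := Fop T a r0 u1 u2.
Let g := fun x t => f x t - a3 x t * F x t.

Hypothesis HD : dissipative m1t m2t (tauc tau1) (tauc tau2) al1 al2 n.
Hypothesis HW : weak_sol_sys T a a1 a2 a3 f r0 r1 tau1 tau2 u1 u2.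

Let ac0 : forall x t, 0 < cl a x t.
Proof. intros x t. apply Ppos, clamp_01. Qed.
Let acn : forall x t, cl a x t <> 0.
Proof. intros x t. apply Rgt_not_eq, ac0. Qed.
Let Kac : CK (S n) (cl a).
Proof. apply Cl_CK, Ka. Qed.
Let Kac' : CK n (cl a).
Proof. apply CK_pred, Kac. Qed.
Let Kax : CK n (cl (Defs.Dx a)).
Proof. apply Cl_CK, Ka. Qed.
Let Kat : CK n (cl (Dt a)).
Proof. apply Cl_CK, Ka. Qed.
Let Ka1' : CK n (cl a1).
Proof. apply Cl_CK, Ka1. Qed.
Let Ka2' : CK n (cl a2).
Proof. apply Cl_CK, Ka2. Qed.
Let Km1 : CK (S n) m1.
Proof. apply (CK_div (S n) (fun _ _ => (-1) ^ 1)); [exact acn|apply CK_frozen|exact Kac]. Qed.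
Let Km2 : CK (S n) m2.
Proof. apply (CK_div (S n) (fun _ _ => (-1) ^ 2)); [exact acn|apply CK_frozen|exact Kac]. Qed.

Let Kia : CK n (fun x t => / cl a x t).
Proof. apply CK_inv; assumption. Qed.

(** The four [b_ij] differ only in signs, which [s1], [s2] and [s3] carry. *)
Let KB (s1 s2 s3 : R) : CK n (fun x t => 1 / 2 * cl a1 x t + s1 * (cl a2 x t * / cl a x t)
   + s2 * cl (Defs.Dx a) x t + s3 * (cl (Dt a) x t * / cl a x t)).
Proof. auto 10 using CK_plus, CK_mult, CK_scal. Qed.

Let KB11 : CK n (cl B11).
Proof.
  eapply CK_ext; [|exact (KB (1/2) (1/2) (-1/2))]. intros x t.
  unfold cl, B11, b11. simpl. field. apply Rgt_not_eq, (ac0 x t).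
Qed.
Let KB12 : CK n (cl B12).
Proof.
  eapply CK_ext; [|exact (KB (-1/2) (1/2) (-1/2))]. intros x t.
  unfold cl, B12, b12. simpl. field. apply Rgt_not_eq, (ac0 x t).
Qed.
Let KB21 : CK n (cl B21).
Proof.
  eapply CK_ext; [|exact (KB (1/2) (1/2) (1/2))]. intros x t.
  unfold cl, B21, b21. simpl. field. apply Rgt_not_eq, (ac0 x t).
Qed.
Let KB22 : CK n (cl B22).
Proof.
  eapply CK_ext; [|exact (KB (-1/2) (-1/2) (-1/2))]. intros x t.
  unfold cl, B22, b22. simpl. field. apply Rgt_not_eq, (ac0 x t).
Qed.

Lemma c1_gap (l : nat) (t : R) :
  cjl a B11 1 l tau1 0 1 t = exp (gap1 m1t (tauc tau1) al1 (INR l) t).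
Proof. apply (cjl_lam a 1 tau1 M1 L1 F1 ac0); [apply (CK_G0 n), KB11|lra|lra]. Qed.

Lemma c2_gap (l : nat) (t : R) :
  cjl a B22 2 l tau2 1 0 t = exp (gap2 m2t (tauc tau2) al2 (INR l) t).
Proof. apply (cjl_lam a 2 tau2 M2 L2 F2 ac0); [apply (CK_G0 n), KB22|lra|lra]. Qed.

Let tauc_01 (tau : R -> R -> R -> R) (t : R) : tauc tau 0 1 t = tau 0 1 t.
Proof. unfold tauc. rewrite clamp_0, clamp_1. reflexivity. Qed.
Let tauc_10 (tau : R -> R -> R -> R) (t : R) : tauc tau 1 0 t = tau 1 0 t.
Proof. unfold tauc. rewrite clamp_0, clamp_1. reflexivity. Qed.

Lemma dissipative_of_c :
  (forall t l, (l <= n)%nat -> cjl a B11 1 l tau1 0 1 t * cjl a B22 2 l tau2 1 0 (tau1 0 1 t) < 1) \/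
  (forall t l, (l <= n)%nat -> cjl a B11 1 l tau1 0 1 t * cjl a B22 2 l tau2 1 0 (tau1 0 1 t) > 1) \/
  (forall t l, (l <= n)%nat -> cjl a B22 2 l tau2 1 0 t * cjl a B11 1 l tau1 0 1 (tau2 1 0 t) < 1) \/
  (forall t l, (l <= n)%nat -> cjl a B22 2 l tau2 1 0 t * cjl a B11 1 l tau1 0 1 (tau2 1 0 t) > 1) ->
  dissipative m1t m2t (tauc tau1) (tauc tau2) al1 al2 n.
Proof.
  intros H. unfold dissipative.
  destruct H as [H|[H|[H|H]]]; [left|right; left|right; right; left|right; right; right];
    intros t l Hl; specialize (H t l Hl); rewrite c1_gap, c2_gap, <- exp_plus in H;
    rewrite ?tauc_01, ?tauc_10; apply exp_lt_inv; rewrite exp_0; exact H.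
Qed.

Lemma gap_sum (t s : R) :
  gap1 m1t (tauc tau1) al1 0 t + gap2 m2t (tauc tau2) al2 0 s =
  RInt (fun eta => B11 eta (tau1 eta 1 t) / a eta (tau1 eta 1 t)
                   + B22 eta (tau2 eta 0 s) / a eta (tau2 eta 0 s)) 0 1.
Proof.
  set (g1 := fun x t => al1 x t - 0 * m1t x t). set (g2 := fun x t => al2 x t - 0 * m2t x t).
  pose proof (CK_G0 _ _ KB11). pose proof (CK_G0 _ _ KB22).
  pose proof (CK_G0 _ _ Km1). pose proof (CK_G0 _ _ Km2).
  assert (G1 : G0 g1).
  { apply (G0_ext al1); [intros; unfold g1; ring|]. intros p. unfold al1. cnt. }
  assert (G2 : G0 g2).
  { apply (G0_ext al2); [intros; unfold g2; ring|]. intros p. unfold al2. cnt. }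
  assert (C1 : forall eta : R, continuous (fun eta : R => g1 eta (tauc tau1 eta 1 t)) eta)
    by apply (continuous_along _ _ _ _ _ F1 _ 1 t G1).
  assert (C2 : forall eta : R, continuous (fun eta : R => g2 eta (tauc tau2 eta 0 s)) eta)
    by apply (continuous_along _ _ _ _ _ F2 _ 0 s G2).
  match goal with |- _ = ?r =>
    change (RInt (fun eta => g1 eta (tauc tau1 eta 1 t)) 0 1
            + RInt (fun eta => g2 eta (tauc tau2 eta 0 s)) 1 0 = r) end.
  rewrite (RInt_reverse (fun eta => g2 eta (tauc tau2 eta 0 s)) 0 1 C2).
  rewrite <- RInt_plus_R; [|exact C1|intros; apply continuous_Rmult; [apply continuous_const|apply C2]].
  apply RInt_ext_R. intros eta He.
  assert (He1 : 0 <= eta <= 1) by (apply (between_01 0 1); lra).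
  unfold g1, g2, al1, al2, m1, m2, tauc, cl. rewrite clamp_0, clamp_1, (clamp_id eta He1).
  field. split; apply Rgt_not_eq, Ppos, He1.
Qed.

Lemma gap_sum_continuous (t : R) :
  continuous (fun t => gap1 m1t (tauc tau1) al1 0 t + gap2 m2t (tauc tau2) al2 0 (tau1 0 1 t)) t.
Proof.
  pose proof (CK_G0 _ _ KB11). pose proof (CK_G0 _ _ KB22).
  pose proof (proj1 (flow_slope _ _ _ _ _ F1)). pose proof (proj1 (flow_slope _ _ _ _ _ F2)).
  pose proof (proj1 (proj2 (flow_slope _ _ _ _ _ F1))).
  pose proof (proj1 (proj2 (flow_slope _ _ _ _ _ F2))).
  assert (G1 : G0 (fun x t => al1 x t - 0 * m1t x t)) by (intros p; unfold al1; cnt).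
  assert (G2 : G0 (fun x t => al2 x t - 0 * m2t x t)) by (intros p; unfold al2; cnt).
  apply (G0_lam _ _ _ _ _ F1 _ 0) in G1. apply (G0_lam _ _ _ _ _ F2 _ 1) in G2.
  unfold gap1, gap2. apply continuous_Rplus.
  - apply (G0_section _ 1 G1).
  - apply (continuous_G0 _ (fun _ => 0) (fun t => tau1 0 1 t) t G2); [apply continuous_const|].
    apply continuous_ext with (fun t => tauc tau1 0 1 t); [apply tauc_01|].
    apply (continuous_flow _ _ _ _ _ F1); cnt.
Qed.

(** For [a] independent of [t] the terms [l * m_t] vanish, so every round-trip sum equals the one
    with [l = 0]. Being continuous and nowhere zero it keeps one sign, which is (C1) or (C2) for all
    [l] at once. *)
Lemma autonomous_dissipative :
  (forall x t s, 0 <= x <= 1 -> a x t = a x s) ->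
  (forall t, RInt (fun eta => B11 eta (tau1 eta 1 t) / a eta (tau1 eta 1 t)
     + B22 eta (tau2 eta 0 (tau1 0 1 t)) / a eta (tau2 eta 0 (tau1 0 1 t))) 0 1 <> 0) ->
  dissipative m1t m2t (tauc tau1) (tauc tau2) al1 al2 n.
Proof.
  intros Haut H0.
  set (s := fun t => gap1 m1t (tauc tau1) al1 0 t + gap2 m2t (tauc tau2) al2 0 (tau1 0 1 t)).
  assert (Hs : forall t, s t <> 0) by (intros t; unfold s; rewrite gap_sum; apply H0).
  assert (Dt0 : forall x t, cl (Dt a) x t = 0).
  { intros x t. unfold cl, Dt. apply is_derive_unique.
    apply is_derive_ext with (fun _ => a (clamp x) t); [intros r; apply Haut, clamp_01|].
    apply (is_derive_const (a (clamp x) t)). }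
  assert (El : forall l t, gap1 m1t (tauc tau1) al1 (INR l) t + gap2 m2t (tauc tau2) al2 (INR l) (tauc tau1 0 1 t) = s t).
  { intros l t. rewrite tauc_01. unfold s, gap1, gap2. f_equal; apply lam_ext; intros x r;
      unfold m1t, m2t; rewrite Dt0; field; apply acn. }
  assert (Hsign : (forall t, s t < 0) \/ (forall t, 0 < s t)).
  { assert (Hc : continuity s).
    { intros t. apply continuity_pt_filterlim, gap_sum_continuous. }
    assert (Hnc : forall t r, s t < 0 -> 0 < s r -> False).
    { intros t r Ht Hr. destruct (IVT_gen s t r 0 Hc) as [z [_ Hz]].
      - rewrite Rmin_left, Rmax_right; lra.
      - exact (Hs z Hz). }
    pose proof (Hs 0) as Hs0.
    destruct (Rtotal_order (s 0) 0) as [H|[H|H]]; [left|contradiction|right];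
      intros t; destruct (Rtotal_order (s t) 0) as [H'|[H'|H']]; try assumption; exfalso;
      try exact (Hs t H'); eauto. }
  destruct Hsign as [H|H]; [left|right; left]; intros t l _; rewrite El; apply H.
Qed.

(** With a speed independent of time the second family is the time reflection of the first:
    [t + tau1 0 1 t - tau1 z 1 t] solves the second characteristic equation, with value [tau1 0 1 t]
    at [z = 1] and [t] at [z = 0]. *)
Lemma autonomous_return (t : R) :
  (forall x t s, 0 <= x <= 1 -> a x t = a x s) -> tau2 0 1 (tau1 0 1 t) = t.
Proof.
  intros Haut.
  assert (H : forall x, 0 <= x <= 1 ->
    is_deriv01 (fun z => t + tau1 0 1 t - tauc tau1 z 1 t) x (m2 x (t + tau1 0 1 t - tauc tau1 x 1 t))).
  { intros x Hx.
    apply (deriv01_eq _ _ (0 - m1 x (tauc tau1 x 1 t))).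
    - unfold m1, m2, cl. rewrite (Haut (clamp x) _ (t + tau1 0 1 t - tauc tau1 x 1 t) (clamp_01 x)).
      field. apply (acn x).
    - apply (deriv01_minus (fun _ => t + tau1 0 1 t) (fun z => tauc tau1 z 1 t));
        [exact Hx|apply deriv01_const|apply (flow_deriv _ _ _ _ _ F1), Hx]. }
  pose proof (flow_unique _ _ _ _ _ F2 (fun z => t + tau1 0 1 t - tauc tau1 z 1 t) 1 (tau1 0 1 t) H)
    as E.
  rewrite <- (tauc_01 tau2). rewrite <- E; [rewrite tauc_01; ring|lra| |lra].
  rewrite (flow_init _ _ _ _ _ F1). ring.
Qed.

Let Pac : forall x, per T (cl a x).
Proof. intros x t. apply Pa, clamp_01. Qed.

Let Gu1 : G0 (cl u1).
Proof. apply cont01_cl, HW. Qed.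
Let Gu2 : G0 (cl u2).
Proof. apply cont01_cl, HW. Qed.

Let pc := fun x t => 1 / 2 * (cl u1 x t + cl u2 x t).
Let jc := fun x t => 1 / 2 * (- m1 x t * (cl u1 x t - cl u2 x t)).
(** [F] rewritten with clamped integrands, hence continuous on the plane; [Nop] enters only as a
    constant. *)
Let Fc := fun x t => RInt (pc 0) 0 t + Nop T a r0 u1 u2 + RInt (fun y => jc y t) 0 x.

Lemma F_Fc (x t : R) : 0 <= x <= 1 -> F x t = Fc x t.
Proof.
  intros Hx. unfold F, Fc, Fop, Gop, Iop, Jop. f_equal; [f_equal|].
  - apply RInt_ext_R. intros s _. unfold pc, cl. rewrite clamp_0. field.
  - apply RInt_ext_R. intros y Hy.
    assert (Hy1 : 0 <= y <= 1) by (apply (between_01 0 x); lra).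
    unfold jc, m1, cl. rewrite (clamp_id y Hy1). field. apply Rgt_not_eq, Ppos, Hy1.
Qed.

Let CK_jc (l : nat) : (l <= n)%nat -> CK l (cl u1) -> CK l (cl u2) -> CK l jc.
Proof.
  intros Hl H1 H2. apply CK_scal, CK_mult; [|apply CK_minus; assumption].
  apply CK_opp. apply (CK_le l (S n)); [lia|exact Km1].
Qed.

Let CK_pc (l : nat) : CK l (cl u1) -> CK l (cl u2) -> CK l pc.
Proof. intros H1 H2. apply CK_scal, CK_plus; assumption. Qed.

Let CK_Fc (l : nat) : (l <= n)%nat -> CK l (cl u1) -> CK l (cl u2) -> CK l Fc.
Proof.
  intros Hl H1 H2. unfold Fc. apply CK_plus; [apply CK_plus; [|apply CK_frozen]|].
  - apply CK_pred, (CK_prim l pc 0), CK_pc; assumption.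
  - apply CK_int, CK_jc; assumption.
Qed.

Let cl_F (x t : R) : cl F x t = cl Fc x t.
Proof. apply F_Fc, clamp_01. Qed.

Let GF : G0 (cl F).
Proof.
  apply (G0_ext (cl Fc)); [intros; symmetry; apply cl_F|].
  apply G0_cl, (CK_Fc 0); [lia|exact Gu1|exact Gu2].
Qed.

Let Gg : G0 (cl g).
Proof.
  pose proof (CK_G0 _ _ (Cl_CK _ _ Kf)). pose proof (CK_G0 _ _ (Cl_CK _ _ Ka3)).
  apply (G0_minus (cl f) (fun x t => cl a3 x t * cl F x t)); [assumption|].
  apply G0_mult; assumption.
Qed.

Let Y1 := fun x t => al1 x t * cl u1 x t + m1 x t * (- cl B12 x t) * cl u2 x t + m1 x t * cl g x t.
Let Y2 := fun x t => al2 x t * cl u2 x t + m2 x t * (- cl B21 x t) * cl u1 x t + m2 x t * cl g x t.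

Let D1 : charD (tauc tau1) (cl u1) Y1.
Proof.
  apply (weak_charD a 1 tau1 M1 L1 F1 ac0 B11 B12 u1 u2 g 0
    (fun s => u2 0 s + 2 * a 0 s * r0 s * Gop T a r0 u1 u2 s));
    try assumption; try (apply (CK_G0 n); assumption); [lra|].
  intros x t Hx. destruct HW as (_ & _ & H). apply (H x t Hx).
Qed.

Let D2 : charD (tauc tau2) (cl u2) Y2.
Proof.
  apply (weak_charD a 2 tau2 M2 L2 F2 ac0 B22 B21 u2 u1 g 1
    (fun s => u1 1 s - 2 * a 1 s * r1 s * F 1 s));
    try assumption; try (apply (CK_G0 n); assumption); [lra|].
  intros x t Hx. destruct HW as (_ & _ & H). apply (H x t Hx).
Qed.

Let E21 : forall x t, m2 x t = - m1 x t.
Proof. intros x t. unfold m1, m2. field. apply acn. Qed.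
Let E21t : forall x t, m2t x t = - m1t x t.
Proof. intros x t. unfold m1t, m2t. field. apply acn. Qed.

(* With the sign that [b12] has here, the [t]-derivative of [F] is not [(u1 + u2) / 2]:
   there remains the [x]-integral of [ex * u2], which is no less regular than [u2]. *)
Let ex := fun x t => cl (Defs.Dx a) x t * / cl a x t - cl (Dt a) x t * (/ cl a x t * / cl a x t).

Let CK_ex : CK n ex.
Proof. apply CK_minus; auto using CK_mult. Qed.

Let GY1 : G0 Y1.
Proof.
  pose proof (CK_G0 _ _ KB11). pose proof (CK_G0 _ _ KB12). pose proof (CK_G0 _ _ Km1).
  intros p. unfold Y1, al1. cnt.
Qed.
Let GY2 : G0 Y2.
Proof.
  pose proof (CK_G0 _ _ KB22). pose proof (CK_G0 _ _ KB21). pose proof (CK_G0 _ _ Km2).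
  intros p. unfold Y2, al2. cnt.
Qed.

Let Ft := fun x t => pc x t - 1 / 2 * RInt (fun y => ex y t * cl u2 y t) 0 x.

Let F_t (x t : R) : 0 <= x <= 1 -> is_derive (Fc x) t (Ft x t).
Proof.
  intros Hx.
  pose proof (flux_balance m1 m1t m2 m2t M1 L1 M2 L2 (tauc tau1) (tauc tau2) (cl u1) (cl u2) Y1 Y2
    F1 F2 E21 Gu1 Gu2 GY1 GY2 D1 D2 x t Hx) as H.
  pose proof (CK_G0 _ _ Km1) as Gm1.
  assert (E : Ft x t = 1 / 2 * (cl u1 x t + cl u2 x t -
     RInt (fun y => Y1 y t + Y2 y t + m1t y t * cl u1 y t + m2t y t * cl u2 y t) 0 x) + 0).
  { unfold Ft, pc.
    (* Once the [b_ij] are inserted, the terms in [u1] cancel, and so do the two terms in [g]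
       because the slopes are opposite; only [ex * u2] remains. *)
    rewrite (RInt_ext_R (fun y => Y1 y t + Y2 y t + m1t y t * cl u1 y t + m2t y t * cl u2 y t)
      (fun y => ex y t * cl u2 y t)); [ring|].
    intros y _. unfold Y1, Y2, al1, al2, ex, m1, m2, m1t, m2t, cl, B11, B12, B21, B22, b11, b12, b21, b22.
    field. apply (acn y t). }
  rewrite E.
  apply is_derive_ext with (fun t => 1 / 2 * (RInt (fun s => cl u1 0 s + cl u2 0 s) 0 t
      + RInt (fun y => - m1 y t * (cl u1 y t - cl u2 y t)) 0 x) + Nop T a r0 u1 u2).
  - intros s. unfold Fc, pc, jc.
    rewrite (RInt_scal_R (fun s => cl u1 0 s + cl u2 0 s)) by (intros; cnt).
    rewrite (RInt_scal_R (fun y => - m1 y s * (cl u1 y s - cl u2 y s))) by (intros; cnt).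
    lra.
  - apply (is_derive_plus (fun t => 1 / 2 * (RInt (fun s => cl u1 0 s + cl u2 0 s) 0 t
      + RInt (fun y => - m1 y t * (cl u1 y t - cl u2 y t)) 0 x)) (fun _ => Nop T a r0 u1 u2)).
    + apply (is_derive_scal _ t (1 / 2)). exact H.
    + apply (is_derive_const (Nop T a r0 u1 u2)).
Qed.

(** The gain of one class: both partial derivatives of [F], namely [jc] and [Ft], contain [u]
    undifferentiated. *)
Let CK_clF (l : nat) : (l <= n)%nat -> CK l (cl u1) -> CK l (cl u2) -> CK (S l) (cl F).
Proof.
  intros Hl H1 H2. apply (CK_ext _ (cl Fc)); [intros; symmetry; apply cl_F|].
  split; [apply (G0_ext (cl F)); [exact cl_F|exact GF]|].
  exists jc, (cl Ft). split; [|split; [|split]].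
  - intros x t Hx. apply (deriv01_ext (fun y => Fc y t)); [exact Hx| |].
    + intros y Hy. unfold cl. rewrite (clamp_id y Hy). reflexivity.
    + apply deriv01_of_derive. unfold Fc.
      apply (is_derive_ext (fun y => (RInt (pc 0) 0 t + Nop T a r0 u1 u2) + RInt (fun y => jc y t) 0 y));
        [reflexivity|].
      replace (jc x t) with (0 + jc x t) by ring.
      apply (is_derive_plus (fun _ => RInt (pc 0) 0 t + Nop T a r0 u1 u2)).
      * apply (is_derive_const (RInt (pc 0) 0 t + Nop T a r0 u1 u2)).
      * apply (is_derive_RInt_cont (fun y => jc y t)).
        pose proof (CK_G0 _ _ (CK_jc l Hl H1 H2)). intros; cnt.
  - intros x t. apply F_t, clamp_01.
  - apply CK_jc; assumption.
  - apply CK_cl. apply CK_minus; [apply CK_pc; assumption|]. apply CK_scal.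
    apply (CK_int l (fun y t => ex y t * cl u2 y t)). apply CK_mult; [|exact H2].
    apply (CK_le l n); [exact Hl|exact CK_ex].
Qed.

Let h0 := fun t => 2 * a 0 t * r0 t * Gop T a r0 u1 u2 t.
Let h1 := fun t => -2 * a 1 t * r1 t * F 1 t.

Lemma trace_0 (t : R) : u1 0 t = u2 0 t + h0 t.
Proof.
  destruct HW as (_ & _ & H). destruct (H 0 t) as [E _]; [lra|]. rewrite E.
  pose proof (flow_init _ _ _ _ _ F1 0 t) as Ei. unfold tauc in Ei. rewrite clamp_0 in Ei.
  rewrite !RInt_point_R, Ei. unfold cjl. rewrite RInt_point_R, exp_0. unfold h0. ring.
Qed.

Lemma trace_1 (t : R) : u2 1 t = u1 1 t + h1 t.
Proof.
  destruct HW as (_ & _ & H). destruct (H 1 t) as [_ E]; [lra|]. rewrite E.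
  pose proof (flow_init _ _ _ _ _ F2 1 t) as Ei. unfold tauc in Ei. rewrite clamp_1 in Ei.
  rewrite !RInt_point_R, Ei. unfold cjl. rewrite RInt_point_R, exp_0. unfold h1, F. ring.
Qed.

Let GopF (t : R) : Gop T a r0 u1 u2 t = cl F 0 t.
Proof. unfold cl. rewrite clamp_0. unfold F, Fop, Jop. rewrite RInt_point_R. ring. Qed.

Let HR : reflected T m1 m2 (tauc tau1) (tauc tau2) al1 al2 (fun x t => - cl B12 x t) (fun x t => - cl B21 x t)
  (fun x t => m1 x t * cl g x t) (fun x t => m2 x t * cl g x t) h0 h1 (cl u1) (cl u2).
Proof.
  constructor; try assumption.
  - intros; apply cl_cl.
  - intros; apply cl_cl.
  - intros x t. apply HW, clamp_01.
  - intros x t. apply HW, clamp_01.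
  - intros t. unfold cl. rewrite clamp_0. apply trace_0.
  - intros t. unfold cl. rewrite clamp_1. apply trace_1.
Qed.

Let P1 : forall x t, m1 x (t + T) = m1 x t.
Proof. intros x t. unfold m1. rewrite Pac. reflexivity. Qed.
Let P2 : forall x t, m2 x (t + T) = m2 x t.
Proof. intros x t. unfold m2. rewrite Pac. reflexivity. Qed.

Let PDt : forall x, per T (cl (Dt a) x).
Proof.
  intros x. apply (per_derive T (cl a x)); [apply Pac|].
  intros t. destruct Ka as (_ & Hd & _). apply (Hd (clamp x) t (clamp_01 x)).
Qed.

Let PDx : forall x, per T (cl (Defs.Dx a) x).
Proof.
  intros x t. destruct Ka as (_ & Hd & _). unfold cl.
  apply (deriv01_unique (fun y => a y (t + T)) (clamp x)); [apply clamp_01|apply (Hd (clamp x) (t + T) (clamp_01 x))|].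
  apply (deriv01_ext (fun y => a y t)); [apply clamp_01| |apply (Hd (clamp x) t (clamp_01 x))].
  intros y Hy. symmetry. apply Pa, Hy.
Qed.

Let Pal1 : forall x, per T (al1 x).
Proof.
  intros x t. unfold al1. rewrite P1. unfold cl, B11, b11.
  pose proof (PDt x t) as E1. pose proof (PDx x t) as E2. unfold cl in E1, E2.
  rewrite E1, E2, (proj1 Ka1), (proj1 Ka2), Pa by apply clamp_01. reflexivity.
Qed.
Let Pal2 : forall x, per T (al2 x).
Proof.
  intros x t. unfold al2. rewrite P2. unfold cl, B22, b22.
  pose proof (PDt x t) as E1. pose proof (PDx x t) as E2. unfold cl in E1, E2.
  rewrite E1, E2, (proj1 Ka1), (proj1 Ka2), Pa by apply clamp_01. reflexivity.
Qed.

(** The bootstrap: [u] in class [l] puts [F] in class [l + 1], which makes [g], [h0] and [h1],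
    although built from [u], admissible data of class [l + 1] for [reflected_regular]. *)
Let main_reg (l : nat) : (l <= n)%nat -> CK l (cl u1) /\ CK l (cl u2).
Proof.
  induction l as [|l IH]; intros Hl; [split; assumption|].
  destruct IH as [H1 H2]; [lia|].
  pose proof (CK_clF l ltac:(lia) H1 H2) as KF.
  assert (Kn : forall u, CK n u -> CK (S l) u) by (intros u; apply CK_le, Hl).
  assert (KSn : forall u, CK (S n) u -> CK (S l) u) by (intros u; apply CK_le; lia).
  assert (Kg : CK (S l) (cl g)).
  { apply (CK_minus (S l) (cl f) (fun x t => cl a3 x t * cl F x t)); [apply Kn, Cl_CK, Kf|].
    apply CK_mult; [apply Kn, Cl_CK, Ka3|exact KF]. }
  assert (Ktr : forall x0, CK (S l) (fun _ t => cl a x0 t)).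
  { intros x0. apply (CK_trace (S l) x0 (cl a)), Kn, Kac'. }
  eapply (reflected_regular T m1 m1t m2 m2t M1 L1 M2 L2 (tauc tau1) (tauc tau2) HT F1 F2 E21 E21t P1
    (S l)); [exact HR|..].
  - apply (CK_le (S (S l)) (S n)); [lia|exact Km1].
  - unfold al1. apply CK_opp, CK_mult; auto.
  - unfold al2. apply CK_opp, CK_mult; auto.
  - apply CK_opp; auto.
  - apply CK_opp; auto.
  - apply CK_mult; auto.
  - apply CK_mult; auto.
  - apply (CK_ext _ (fun _ t => 2 * cl a 0 t * r0 t * cl F 0 t)).
    + intros x t. unfold h0. rewrite GopF. unfold cl. rewrite clamp_0. reflexivity.
    + apply (CK_mult (S l) (fun _ t => 2 * cl a 0 t * r0 t) (fun _ t => cl F 0 t)).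
      * apply (CK_mult (S l) (fun _ t => 2 * cl a 0 t) (fun _ t => r0 t)).
        -- apply (CK_scal (S l) 2 (fun _ t => cl a 0 t)), Ktr.
        -- apply Kn, Cl1_CK, Kr0.
      * apply (CK_trace (S l) 0 (cl F)), KF.
  - apply (CK_ext _ (fun _ t => -2 * cl a 1 t * r1 t * cl F 1 t)).
    + intros x t. unfold h1, cl. rewrite clamp_1. reflexivity.
    + apply (CK_mult (S l) (fun _ t => -2 * cl a 1 t * r1 t) (fun _ t => cl F 1 t)).
      * apply (CK_mult (S l) (fun _ t => -2 * cl a 1 t) (fun _ t => r1 t)).
        -- apply (CK_scal (S l) (-2) (fun _ t => cl a 1 t)), Ktr.
        -- apply Kn, Cl1_CK, Kr1.
      * apply (CK_trace (S l) 1 (cl F)), KF.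
  - exact Pal1.
  - exact Pal2.
  - apply (dissipative_le _ _ _ _ _ _ (S l) n); [exact Hl|exact HD].
Qed.

(* [a(0,t) r_0(t) Gu(t)] is half the jump of a periodic pair, and [a(0,.) r_0] does not
   vanish identically, so [Gu] itself is periodic. *)
Lemma Gop_per (t : R) : Gop T a r0 u1 u2 (t + T) = Gop T a r0 u1 u2 t.
Proof.
  assert (Gd : forall t, is_derive (Gop T a r0 u1 u2) t (pc 0 t)).
  { intros s. apply is_derive_ext with (fun t => RInt (pc 0) 0 t + Nop T a r0 u1 u2).
    - intros r. unfold Gop, Iop. apply (f_equal (fun z => z + Nop T a r0 u1 u2)).
      apply RInt_ext_R. intros q _. unfold pc, cl. rewrite clamp_0. field.
    - replace (pc 0 s) with (pc 0 s + 0) by ring.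
      apply (is_derive_plus (fun t => RInt (pc 0) 0 t) (fun _ => Nop T a r0 u1 u2)).
      + apply is_derive_RInt_cont. apply G0_section. apply (CK_pc 0); assumption.
      + apply (is_derive_const (Nop T a r0 u1 u2)). }
  assert (Pu : per T (pc 0)).
  { intros s. unfold pc, cl.
    destruct HW as ((Q1 & _) & (Q2 & _) & _). rewrite Q1, Q2 by apply clamp_01. reflexivity. }
  set (D := fun t => Gop T a r0 u1 u2 (t + T) - Gop T a r0 u1 u2 t).
  assert (Dd : forall t, is_derive D t 0).
  { intros s. replace 0 with (1 * pc 0 (s + T) - pc 0 s) by (rewrite Pu; ring).
    apply (is_derive_minus (fun t => Gop T a r0 u1 u2 (t + T)) (Gop T a r0 u1 u2)); [|apply Gd].
    apply (is_derive_comp (Gop T a r0 u1 u2) (fun t => t + T)); [apply Gd|].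
    auto_derive; [trivial|ring]. }
  assert (Dc : forall s, D s = D t).
  { intros s. destruct (Rtotal_order s t) as [H|[->|H]].
    - apply (eq_is_derive D s t); [intros; apply Dd|exact H].
    - reflexivity.
    - symmetry. apply (eq_is_derive D t s); [intros; apply Dd|exact H]. }
  assert (Hz : forall s, a 0 s * r0 s * D t = 0).
  { intros s. rewrite <- (Dc s).
    pose proof (trace_0 s) as E1. pose proof (trace_0 (s + T)) as E2.
    assert (I0 : 0 <= 0 <= 1) by lra.
    destruct HW as ((Q1 & _) & (Q2 & _) & _).
    unfold h0 in E1, E2. rewrite (Q1 0 s I0), (Q2 0 s I0), (Pa 0 s I0), (Pr0 s) in E2.
    unfold D. lra. }
  destruct (Req_dec (D t) 0) as [E|E]; [unfold D in E; lra|].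
  exfalso. apply HC. rewrite (RInt_ext_R _ (fun _ => 0)).
  - rewrite (RInt_const (V := R_CompleteNormedModule)). unfold scal; simpl. unfold mult; simpl. ring.
  - intros s _. apply Rmult_eq_reg_r with (D t); [|exact E]. rewrite Hz. ring.
Qed.

(** Since [w] is [F], the class [S n] is the gain of [CK_clF] over the class [n] of [u]. *)
Theorem weak_regular : CT (S n) T (wP T a r0 u1 u2).
Proof.
  assert (E : forall x t, wP T a r0 u1 u2 x t = F x t).
  { intros x t. unfold wP, F, Fop, Gop. ring. }
  split.
  - intros x t Hx. rewrite !E. unfold F, Fop. rewrite Gop_per. f_equal.
    apply RInt_ext_R. intros y Hy.
    assert (Hy1 : 0 <= y <= 1) by (apply (between_01 0 x); lra).
    destruct HW as ((Q1 & _) & (Q2 & _) & _). rewrite (Q1 y t Hy1), (Q2 y t Hy1), (Pa y t Hy1).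
    reflexivity.
  - destruct (main_reg n (Nat.le_refl n)) as [H1 H2].
    apply (CK_Cl (S n) (cl F)); [|apply CK_clF; auto].
    intros x t Hx. rewrite E. unfold cl. rewrite (clamp_id x Hx). reflexivity.
Qed.

End Problem.

(** * From finite order of smoothness to infinite order *)

Lemma Cl_le (l n : nat) (u : R -> R -> R) : (l <= n)%nat -> Cl n u -> Cl l u.
Proof.
  intros Hl Hu. apply (CK_Cl l (cl u)).
  - intros x t Hx. unfold cl. rewrite (clamp_id x Hx). reflexivity.
  - apply (CK_le l n); [exact Hl|]. apply Cl_CK, Hu.
Qed.

Theorem theorem1p2 (T : R) (a a1 a2 a3 f : R -> R -> R) (r0 r1 : R -> R)
  (tau1 tau2 : R -> R -> R -> R) :
  0 < T ->
  periodic2 T a -> periodic2 T a1 -> periodic2 T a2 -> periodic2 T a3 -> periodic2 T f ->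
  periodic1 T r0 -> periodic1 T r1 ->
  (forall x t, 0 <= x <= 1 -> 0 < a x t) ->
  RInt (fun t => a 0 t * r0 t) 0 T <> 0 ->
  is_char a 1 tau1 -> is_char a 2 tau2 ->
  let c1 := cjl a (b11 a a1 a2) 1 in
  let c2 := cjl a (b22 a a1 a2) 2 in
  (* (i) *)
  (forall k : nat, (1 <= k)%nat ->
     CT (S k) T a -> CT k T a1 -> CT k T a2 -> CT k T a3 -> CT k T f ->
     CT1 k T r0 -> CT1 k T r1 ->
     ((forall t l, (l <= k)%nat -> c1 l tau1 0 1 t * c2 l tau2 1 0 (tau1 0 1 t) < 1) \/
      (forall t l, (l <= k)%nat -> c1 l tau1 0 1 t * c2 l tau2 1 0 (tau1 0 1 t) > 1) \/
      (forall t l, (l <= k)%nat -> c2 l tau2 1 0 t * c1 l tau1 0 1 (tau2 1 0 t) < 1) \/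
      (forall t l, (l <= k)%nat -> c2 l tau2 1 0 t * c1 l tau1 0 1 (tau2 1 0 t) > 1)) ->
     forall w, weak_sol_P T a a1 a2 a3 f r0 r1 tau1 tau2 w -> CT (S k) T w)
  /\
  (* (ii) *)
  ((forall x t s, 0 <= x <= 1 -> a x t = a x s) ->
     CTinf T a -> CTinf T a1 -> CTinf T a2 -> CTinf T a3 -> CTinf T f ->
     CT1inf T r0 -> CT1inf T r1 ->
     ((forall t, RInt (fun eta =>
          b11 a a1 a2 eta (tau1 eta 1 t) / a eta (tau1 eta 1 t)
        + b22 a a1 a2 eta (tau2 eta 0 (tau1 0 1 t)) / a eta (tau2 eta 0 (tau1 0 1 t))) 0 1 <> 0) \/
      (forall t, RInt (fun eta =>
          b22 a a1 a2 eta (tau2 eta 0 t) / a eta (tau2 eta 0 t)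
        + b11 a a1 a2 eta (tau1 eta 1 (tau2 0 1 t)) / a eta (tau1 eta 1 (tau2 0 1 t))) 0 1 <> 0)) ->
     forall w, weak_sol_P T a a1 a2 a3 f r0 r1 tau1 tau2 w -> CTinf T w).
Proof.
  intros HT Pa _ _ _ _ Pr0 _ Hpos HC Ch1 Ch2 c1 c2.
  assert (Pac : forall x, per T (cl a x)) by (intros x t; apply Pa, clamp_01).
  assert (ac0 : forall x t, 0 < cl a x t) by (intros x t; apply Hpos, clamp_01).
  split.
  - intros n Hn [_ Ka] Ka1 Ka2 [_ Ka3] [_ Kf] [_ Kr0] [_ Kr1] HD w (u1 & u2 & HW & ->).
    pose proof (Cl_le 1 (S n) a ltac:(lia) Ka) as Ka0.
    destruct (flow_of_char T a 1 tau1 HT Pac ac0 Ka0 Ch1) as (M1 & L1 & F1).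
    destruct (flow_of_char T a 2 tau2 HT Pac ac0 Ka0 Ch2) as (M2 & L2 & F2).
    apply (weak_regular T a a1 a2 a3 f r0 r1 tau1 tau2 u1 u2 n M1 L1 M2 L2); try assumption.
    apply (dissipative_of_c T a a1 a2 tau1 tau2 n M1 L1 M2 L2); assumption.
  - intros Haut Ka Ka1 Ka2 Ka3 Kf Kr0 Kr1 HI w (u1 & u2 & HW & ->) l.
    assert (Ka0 : Cl 1 a) by apply Ka.
    destruct (flow_of_char T a 1 tau1 HT Pac ac0 Ka0 Ch1) as (M1 & L1 & F1).
    destruct (flow_of_char T a 2 tau2 HT Pac ac0 Ka0 Ch2) as (M2 & L2 & F2).
    (* The finite-order result asks for an index at least 1, which [S l] satisfies even for [l = 0];
       the surplus smoothness is dropped at the end. *)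
    set (n := S l).
    assert (HW' : CT (S n) T (wP T a r0 u1 u2)).
    { apply (weak_regular T a a1 a2 a3 f r0 r1 tau1 tau2 u1 u2 n M1 L1 M2 L2); try assumption;
        try (unfold n; lia); try apply Ka; try apply Ka1; try apply Ka2; try apply Ka3;
        try apply Kf; try apply Kr0; try apply Kr1.
      apply (autonomous_dissipative T a a1 a2 tau1 tau2 n M1 L1 M2 L2); try assumption;
        try apply Ka; try apply Ka1; try apply Ka2.
      destruct HI as [HI|HI]; [exact HI|].
      (* The second condition is the first one along the shift [t -> tau1 0 1 t]. *)
      intros t. specialize (HI (tau1 0 1 t)).
      rewrite (autonomous_return a tau1 tau2 M1 L1 M2 L2 Hpos F1 F2 t Haut) in HI.
      intros E. apply HI. refine (eq_trans _ E). apply RInt_ext_R. intros eta _. ring. }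
    split; [apply HW'|]. apply (Cl_le l (S n)); [unfold n; lia|apply HW'].
Qed.
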